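(* Let $m,n\geq 2$ be integers, and let $f$ and $g$ be meromorphic functions on $\mathbf{C}$ satisfying $f^m(z)+g^n(z)=1$ on $\mathbf{C}$. Then $f$ and $g$ are constant if and only if $\mathcal{Z}(f')=\mathcal{Z}(g')$ counting multiplicity.
   Context: For a meromorphic function $h$ on $\mathbf{C}$, $\mathcal{Z}(h)$ denotes the zero set of $h$. ''$\mathcal{Z}(h_1)=\mathcal{Z}(h_2)$ counting multiplicity'' means that $h_1$ and $h_2$ have the same zeros with the same multiplicities (two identically zero functions are regarded as having the same zeros counting multiplicity). *)

(* Defs.v *)
From Stdlib Require Export Reals.
From Coquelicot Require Export Coquelicot.

Open Scope C_scope.

Definition holomorphic_at (f : C -> C) (a : C) : Prop :=
  locally a (fun z : C => ex_derive f z).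

(* A meromorphic function is encoded as a map to the Riemann sphere
   [option C], where [None] is the point at infinity. *)

(* The value [0] at the poles is junk and is never used there. *)
Definition finite_value (f : C -> option C) (z : C) : C :=
  match f z with Some w => w | None => 0 end.

Definition regular_at (f : C -> option C) (a : C) : Prop :=
  locally a (fun z : C => f z <> None) /\ holomorphic_at (finite_value f) a.

Definition pole_at (f : C -> option C) (a : C) : Prop :=
  f a = None /\
  locally' a (fun z : C => regular_at f z) /\
  filterlim (fun z : C => Cmod (finite_value f z))
    (locally' a) (Rbar_locally p_infty).

(* This excludes the constant map to infinity, since poles are isolated. *)
Definition meromorphic (f : C -> option C) : Prop :=
  forall a : C, regular_at f a \/ pole_at f a.

(* The derivative of a meromorphic function has a pole at each of its poles. *)
Definition mderive (f : C -> option C) (z : C) : option C :=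
  match f z with
  | Some _ => Some (C_derive (finite_value f) z)
  | None => None
  end.

Definition constant (f : C -> option C) : Prop :=
  exists c : C, forall z : C, f z = Some c.

Definition zero_of_order (h : C -> option C) (a : C) (k : nat) : Prop :=
  (1 <= k)%nat /\
  exists phi : C -> C,
    holomorphic_at phi a /\ phi a <> 0 /\
    locally a (fun z : C => h z = Some ((z - a) ^ k * phi z)).

(* [zero_of_order] never holds for an identically zero function; the first
   conjunct makes such a function agree only with another one. *)
Definition same_zeros_counting_multiplicity (h1 h2 : C -> option C) : Prop :=
  (forall a : C, h1 a = Some (RtoC 0) <-> h2 a = Some (RtoC 0)) /\
  (forall (a : C) (k : nat), zero_of_order h1 a k <-> zero_of_order h2 a k).

(* [f ^ m + g ^ n = 1] as an identity of meromorphic functions, i.e. at every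
   point that is a pole of neither [f] nor [g]. *)
Definition fermat_identity (m n : nat) (f g : C -> option C) : Prop :=
  forall z u v : C, f z = Some u -> g z = Some v -> u ^ m + v ^ n = 1.

(* Main.v *)
From Stdlib Require Import Lra Lia ClassicalEpsilon.
Require Import Defs.

(* If the zeros of [f'] and [g'] agree and [f] vanishes to order [p] at [a],
   then [m f^(m-1) f' = - n g^(n-1) g'] makes [g'] vanish at [a] to order
   [m p - 1], strictly more than the order [p - 1] of [f'].  So [f] has no
   isolated zero: either [f] is identically zero and [g] is constant, or,
   exchanging the roles of [f] and [g] as well, neither function has a zero.
   In that case [1 / f] is entire and omits the [m]-th roots of unity, since
   [f^m = 1] would force [g = 0]; it is constant by the little Picard theorem.

   Little Picard: an entire function omitting [1] and [-1] is [cosh (i pi V)]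
   where [V] is entire and omits the integers, so [V = cosh W], and the range
   of [W] contains no disc of radius 12.  But the range of a non-constant
   entire function contains discs of every radius (Bloch): a doubling argument
   provides points [p] such that [|W'| <= 2 |W'(p)|] on a disc of radius
   [k / |W'(p)|], with [k] arbitrary, and there [W] is close to its affine
   approximation by Cauchy's estimate. *)

(** * Complex derivatives and path integrals *)

(** The analysis rests on Cauchy's formula. The obstacle is that differentiability at each point
    gives no continuity of the derivative, so Green's theorem is out of reach at the start.
    Goursat's bisection avoids it. It is carried out in the parameter rectangle of
    [(s, t) |-> b + s * c t] and not in the plane, so the region between a circle and its shrunken
    copy around [b] need not be cut into simple pieces. The two radial sides cancel because [c] is
    closed, and letting [s] tend to 0 leaves [f b] times a winding integral.

    The radius 12 is 4 + 8: [cosh] takes an integer value within distance 4 of every real number,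
    and every ordinate lies within [2 pi <= 8] of a multiple of [2 pi], where [ccosh] is real.

    The bound [m >= 2] enters twice: it makes [m p - 1] exceed [p - 1], and it provides the two
    distinct [m]-th roots of unity that Picard's theorem asks for. *)

Definition cderive (f : C -> C) (z l : C) : Prop :=
  @is_derive C_AbsRing C_NormedModule f z l.

(** Here [C] is a module over the reals, in [cderive] over itself; naming both structures keeps
    unification from mixing them up. *)
Definition curve_derive (f : R -> C) (t : R) (l : C) : Prop :=
  @is_derive R_AbsRing C_R_NormedModule f t l.

(** The balls of [C] as a product of two lines are squares; they compare with Euclidean discs up to
    the factor [sqrt 2]. *)
Lemma locally_C_iff (z : C) (P : C -> Prop) :
  locally z P <-> exists d : R, 0 < d /\ forall w, Cmod (w - z) < d -> P w.
Proof.
  split.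
  - intros [e He].
    exists e. split; [apply cond_pos|].
    intros w Hw. apply He. now apply C_NormedModule_mixin_compat1.
  - intros [d [Hd H]].
    assert (Hs : 0 < d / sqrt 2) by (apply Rdiv_lt_0_compat; [lra | apply sqrt_lt_R0; lra]).
    exists (mkposreal _ Hs). intros w Hw. apply H.
    apply (C_NormedModule_mixin_compat2 z w) in Hw. simpl in Hw.
    change (Cmod (w - z) < sqrt 2 * (d / sqrt 2)) in Hw.
    replace (sqrt 2 * (d / sqrt 2))%R with d in Hw; [exact Hw|].
    field. apply Rgt_not_eq, sqrt_lt_R0; lra.
Qed.

Lemma continuous_C_iff {U : UniformSpace} (f : U -> C) (x : U) :
  continuous f x <->
  forall e : R, 0 < e -> locally x (fun y => Cmod (f y - f x) < e).
Proof.
  split.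
  - intros H e He. apply (H (fun w => Cmod (w - f x) < e)).
    apply locally_C_iff. exists e. auto.
  - intros H P HP. apply locally_C_iff in HP. destruct HP as [d [Hd HP]].
    unfold filtermap. generalize (H d Hd). apply filter_imp. auto.
Qed.

Lemma continuous_CC_iff (f : C -> C) (z : C) :
  continuous f z <->
  forall e : R, 0 < e -> exists d : R, 0 < d /\
    forall w, Cmod (w - z) < d -> Cmod (f w - f z) < e.
Proof.
  rewrite continuous_C_iff.
  split; intros H e He; apply locally_C_iff; auto.
Qed.

Section ContinuityRules.
Context {U : UniformSpace}.
Implicit Types f g : U -> C.

Lemma continuous_Cplus f g x :
  continuous f x -> continuous g x -> continuous (fun y => f y + g y) x.
Proof. exact (continuous_plus (V := C_R_NormedModule) f g x). Qed.

Lemma continuous_Copp f x : continuous f x -> continuous (fun y => - f y) x.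
Proof. exact (continuous_opp (V := C_R_NormedModule) f x). Qed.

Lemma continuous_Cminus f g x :
  continuous f x -> continuous g x -> continuous (fun y => f y - g y) x.
Proof. exact (continuous_minus (V := C_R_NormedModule) f g x). Qed.

Lemma continuous_Cmult f g x :
  continuous f x -> continuous g x -> continuous (fun y => f y * g y) x.
Proof.
  rewrite !continuous_C_iff. intros Hf Hg e He.
  set (A := Cmod (f x)). set (B := Cmod (g x)).
  assert (HA : 0 <= A) by apply Cmod_ge_0. assert (HB : 0 <= B) by apply Cmod_ge_0.
  set (d := Rmin 1 (e / (1 + A + B))).
  assert (Hd : 0 < d).
  { apply Rmin_pos; [lra|]. apply Rdiv_lt_0_compat; lra. }
  generalize (filter_and _ _ (Hf d Hd) (Hg d Hd)). apply filter_imp.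
  intros y [H1 H2].
  replace (f y * g y - f x * g x)%C
    with ((f y - f x) * (g y - g x) + (f x * (g y - g x) + g x * (f y - f x)))%C by ring.
  assert (Hd1 : d <= 1) by apply Rmin_l.
  assert (Hd2 : d * (1 + A + B) <= e).
  { apply Rle_trans with (e / (1 + A + B) * (1 + A + B))%R.
    - apply Rmult_le_compat_r; [lra | apply Rmin_r].
    - right; field; lra. }
  eapply Rle_lt_trans; [apply Cmod_triangle|].
  eapply Rle_lt_trans; [apply Rplus_le_compat_l, Cmod_triangle|].
  rewrite !Cmod_mult. fold A B.
  generalize (Cmod_ge_0 (f y - f x)) (Cmod_ge_0 (g y - g x)). intros H3 H4.
  assert (Cmod (f y - f x) * Cmod (g y - g x) < d).
  { apply Rle_lt_trans with (Cmod (f y - f x) * 1)%R.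
    - apply Rmult_le_compat_l; lra.
    - lra. }
  assert (A * Cmod (g y - g x) <= A * d) by (apply Rmult_le_compat_l; lra).
  assert (B * Cmod (f y - f x) <= B * d) by (apply Rmult_le_compat_l; lra).
  lra.
Qed.

Lemma continuous_Cinv f x : continuous f x -> f x <> 0 -> continuous (fun y => / f y) x.
Proof.
  rewrite !continuous_C_iff. intros Hf H0 e He.
  set (A := Cmod (f x)). assert (HA : 0 < A) by now apply Cmod_gt_0.
  (* The first bound keeps [Cmod (f y)] above [A / 2], so the denominator [f y * f x] exceeds
     [A * A / 2]; the second bounds the numerator accordingly. *)
  set (d := Rmin (A / 2) (e * (A * A / 2))).
  assert (Hd : 0 < d).
  { apply Rmin_pos; [lra|]. apply Rmult_lt_0_compat; [lra|].
    apply Rdiv_lt_0_compat; [|lra]. now apply Rmult_lt_0_compat. }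
  generalize (Hf d Hd). apply filter_imp. intros y Hy.
  assert (Hd1 : d <= A / 2) by apply Rmin_l.
  assert (Hd2 : d <= e * (A * A / 2)) by apply Rmin_r.
  assert (HB : A / 2 < Cmod (f y)).
  { assert (Htri := Cmod_triangle (f y) (- (f y - f x))).
    replace (f y + - (f y - f x))%C with (f x) in Htri by ring.
    rewrite Cmod_opp in Htri. fold A in Htri. lra. }
  assert (f y <> 0) by (apply Cmod_gt_0; lra).
  replace (/ f y - / f x)%C with (- (f y - f x) / (f y * f x))%C by (field; auto).
  rewrite Cmod_div by now apply Cmult_neq_0.
  rewrite Cmod_opp, Cmod_mult. fold A.
  apply Rmult_lt_reg_r with (Cmod (f y) * A)%R; [apply Rmult_lt_0_compat; lra|].
  unfold Rdiv. rewrite Rmult_assoc, Rinv_l, Rmult_1_r;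
    [|apply Rgt_not_eq, Rmult_lt_0_compat; lra].
  eapply Rlt_le_trans; [apply Hy|].
  apply Rle_trans with (1 := Hd2). apply Rmult_le_compat_l; [lra|].
  assert (A * (A/2) <= A * Cmod (f y)) by (apply Rmult_le_compat_l; lra). lra.
Qed.

Lemma continuous_Cdiv f g x :
  continuous f x -> continuous g x -> g x <> 0 -> continuous (fun y => f y / g y) x.
Proof. intros. apply continuous_Cmult; auto. now apply continuous_Cinv. Qed.

Lemma continuous_Cpow f x n : continuous f x -> continuous (fun y => f y ^ n) x.
Proof.
  intros H. induction n as [|n IH]; simpl.
  - apply continuous_const.
  - now apply continuous_Cmult.
Qed.

Lemma continuous_Cmod f x : continuous f x -> continuous (fun y => Cmod (f y)) x.
Proof.
  intros H. apply (continuous_comp f Cmod); auto.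
  intros P [e He]. apply locally_C_iff. exists e. split; [apply cond_pos|].
  intros w Hw. apply He. change (Rabs (Cmod w - Cmod (f x)) < e).
  apply Rle_lt_trans with (2 := Hw).
  assert (H1 := Cmod_triangle (w - f x) (f x)).
  replace (w - f x + f x)%C with w in H1 by ring.
  assert (H2 := Cmod_triangle (f x - w) w).
  replace (f x - w + w)%C with (f x) in H2 by ring.
  rewrite <- (Copp_minus_distr w), Cmod_opp in H2.
  apply Rabs_le. lra.
Qed.

End ContinuityRules.

Lemma is_linear_scal_C (l : C) :
  @is_linear C_AbsRing (AbsRing_NormedModule C_AbsRing) C_NormedModule (fun y => scal y l).
Proof. exact (is_linear_scal_l (K := C_AbsRing) (V := C_NormedModule) l). Qed.

(* Carathéodory's criterion; it turns the rules of calculus into algebra of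
   continuous functions. *)
Lemma cderive_iff (f : C -> C) (z l : C) :
  cderive f z l <->
  exists Q : C -> C, continuous Q z /\ Q z = l /\ forall w, f w = f z + Q w * (w - z).
Proof.
  split.
  - intros [_ H].
    assert (H' := H z (fun P HP => HP)). clear H.
    exists (fun w => if Ceq_dec w z then l else (f w - f z) / (w - z)).
    split; [|split].
    + apply continuous_CC_iff. intros e He.
      assert (He2 : 0 < e / 2) by lra.
      destruct (H' (mkposreal _ He2)) as [d Hd].
      exists d. split; [apply cond_pos|]. intros w Hw.
      destruct (Ceq_dec z z) as [_|n]; [|now elim n].
      destruct (Ceq_dec w z) as [->|n].
      * replace (l - l)%C with (RtoC 0) by ring. rewrite Cmod_0. exact He.
      * specialize (Hd w Hw).
        change (Cmod ((f w - f z) - (w - z) * l) <= e / 2 * Cmod (w - z)) in Hd.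
        assert (Hn : w - z <> 0) by (intro E; apply n, Ceq_minus, E).
        replace ((f w - f z) / (w - z) - l)%C
          with (((f w - f z) - (w - z) * l) / (w - z))%C by (field; auto).
        rewrite Cmod_div by auto. apply Cmod_gt_0 in Hn.
        apply Rle_lt_trans with (e/2)%R; [|lra].
        apply Rmult_le_reg_r with (Cmod (w - z)); auto.
        unfold Rdiv at 1. rewrite Rmult_assoc, Rinv_l, Rmult_1_r; lra.
    + destruct (Ceq_dec z z) as [_|n]; [reflexivity|now elim n].
    + intros w. destruct (Ceq_dec w z) as [->|n]; [ring|].
      field. intro E; apply n, Ceq_minus, E.
  - intros [Q [HQ [<- HF]]]. split; [apply is_linear_scal_C|].
    intros z' Hz'. assert (z = z') as <-.
    { apply (is_filter_lim_locally_unique (K := C_AbsRing) (V := AbsRing_NormedModule C_AbsRing)).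
      exact Hz'. }
    intros e. rewrite continuous_CC_iff in HQ.
    destruct (HQ e (cond_pos e)) as [d [Hd HQ']].
    exists (mkposreal d Hd). intros w Hw.
    change (Cmod ((f w - f z) - (w - z) * Q z) <= e * Cmod (w - z)).
    rewrite (HF w).
    replace (f z + Q w * (w - z) - f z - (w - z) * Q z)%C
      with ((Q w - Q z) * (w - z))%C by ring.
    rewrite Cmod_mult. apply Rmult_le_compat_r; [apply Cmod_ge_0|].
    left. apply HQ'. exact Hw.
Qed.

Lemma curve_derive_iff (f : R -> C) (t : R) (l : C) :
  curve_derive f t l <->
  exists Q : R -> C, continuous Q t /\ Q t = l /\
    forall s : R, f s = f t + Q s * (RtoC (s - t)).
Proof.
  split.
  - intros [_ H].
    assert (H' := H t (fun P HP => HP)). clear H.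
    exists (fun s => if Req_EM_T s t then l else (f s - f t) / RtoC (s - t)).
    split; [|split].
    + apply continuous_C_iff. intros e He.
      assert (He2 : 0 < e / 2) by lra.
      generalize (H' (mkposreal _ He2)). apply filter_imp. intros s Hs.
      destruct (Req_EM_T t t) as [_|n]; [|now elim n].
      destruct (Req_EM_T s t) as [->|n].
      * replace (l - l)%C with (RtoC 0) by ring. rewrite Cmod_0. exact He.
      * rewrite <- Cmod_norm in Hs.
        change (minus (minus (f s) (f t)) (scal (minus s t) l))
          with ((f s - f t) - scal (s - t)%R l)%C in Hs.
        rewrite scal_R_Cmult in Hs.
        change (Cmod ((f s - f t) - RtoC (s - t) * l) <= e / 2 * Rabs (s - t)) in Hs.
        assert (Hn : RtoC (s - t) <> 0) by (intro E; apply RtoC_inj in E; lra).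
        replace ((f s - f t) / RtoC (s - t) - l)%C
          with (((f s - f t) - RtoC (s - t) * l) / RtoC (s - t))%C by (field; auto).
        rewrite Cmod_div by auto. rewrite Cmod_R.
        assert (0 < Rabs (s - t)) by (apply Rabs_pos_lt; lra).
        apply Rle_lt_trans with (e/2)%R; [|lra].
        apply Rmult_le_reg_r with (Rabs (s - t)); auto.
        unfold Rdiv at 1. rewrite Rmult_assoc, Rinv_l, Rmult_1_r; lra.
    + destruct (Req_EM_T t t) as [_|n]; [reflexivity|now elim n].
    + intros s. destruct (Req_EM_T s t) as [->|n].
      * replace (t - t)%R with 0%R by ring. ring.
      * field. intro E; apply RtoC_inj in E; lra.
  - intros [Q [HQ [<- HF]]]. split.
    { exact (is_linear_scal_l (K := R_AbsRing) (V := C_R_NormedModule) (Q t)). }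
    intros t' Ht'. assert (t = t') as <-.
    { apply (is_filter_lim_locally_unique (K := R_AbsRing) (V := R_NormedModule)).
      exact Ht'. }
    intros e. rewrite continuous_C_iff in HQ.
    generalize (HQ e (cond_pos e)). apply filter_imp. intros s Hs.
    rewrite <- Cmod_norm.
    change (minus (minus (f s) (f t)) (scal (minus s t) (Q t)))
      with ((f s - f t) - scal (s - t)%R (Q t))%C.
    rewrite scal_R_Cmult.
    change (Cmod ((f s - f t) - RtoC (s - t) * Q t) <= e * Rabs (s - t)).
    rewrite (HF s).
    replace (f t + Q s * RtoC (s - t) - f t - RtoC (s - t) * Q t)%C
      with ((Q s - Q t) * RtoC (s - t))%C by ring.
    rewrite Cmod_mult, Cmod_R. apply Rmult_le_compat_r; [apply Rabs_pos|]. lra.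
Qed.

Section ComplexDerivatives.
Implicit Types (f g : C -> C) (z w l a b : C) (n : nat).

Lemma cderive_continuous f z l : cderive f z l -> continuous f z.
Proof.
  intros H. apply cderive_iff in H. destruct H as [Q [HQ [_ HF]]].
  apply (continuous_ext (fun w => f z + Q w * (w - z))); [intros w; symmetry; apply HF|].
  apply continuous_Cplus; [apply continuous_const|].
  apply continuous_Cmult; [exact HQ|].
  apply continuous_Cminus; [apply continuous_id|apply continuous_const].
Qed.

Lemma ex_cderive_continuous f z : ex_derive f z -> continuous f z.
Proof. intros [l H]. now apply cderive_continuous with l. Qed.

Lemma curve_derive_continuous (f : R -> C) (t : R) l : curve_derive f t l -> continuous f t.
Proof.
  intros H. apply (ex_derive_continuous (V := C_R_NormedModule)). now exists l.
Qed.

Lemma cderive_const (c z : C) : cderive (fun _ => c) z 0.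
Proof.
  apply cderive_iff. exists (fun _ => RtoC 0). repeat split; [apply continuous_const|].
  intros; ring.
Qed.

Lemma cderive_id (z : C) : cderive (fun w => w) z 1.
Proof.
  apply cderive_iff. exists (fun _ => RtoC 1). repeat split; [apply continuous_const|].
  intros; ring.
Qed.

Lemma cderive_plus f g z a b :
  cderive f z a -> cderive g z b -> cderive (fun w => f w + g w) z (a + b).
Proof.
  rewrite !cderive_iff. intros [P [HP [<- Ef]]] [Q [HQ [<- Eg]]].
  exists (fun w => P w + Q w). repeat split; [now apply continuous_Cplus|].
  intros w. rewrite (Ef w), (Eg w). ring.
Qed.

Lemma cderive_mult f g z a b :
  cderive f z a -> cderive g z b ->
  cderive (fun w => f w * g w) z (a * g z + f z * b).
Proof.
  intros Hf Hg. assert (Cg := cderive_continuous _ _ _ Hg). revert Hf Hg.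
  rewrite !cderive_iff. intros [P [HP [<- Ef]]] [Q [HQ [<- Eg]]].
  exists (fun w => P w * g w + f z * Q w). repeat split.
  - apply continuous_Cplus; apply continuous_Cmult; auto; apply continuous_const.
  - intros w. rewrite (Ef w) at 1. rewrite (Eg w) at 1 2. ring.
Qed.

Lemma cderive_opp f z a : cderive f z a -> cderive (fun w => - f w) z (- a).
Proof.
  rewrite !cderive_iff. intros [P [HP [<- Ef]]].
  exists (fun w => - P w). repeat split; [now apply continuous_Copp|].
  intros w. rewrite (Ef w). ring.
Qed.

Lemma cderive_minus f g z a b :
  cderive f z a -> cderive g z b -> cderive (fun w => f w - g w) z (a - b).
Proof. intros. apply cderive_plus; auto. now apply cderive_opp. Qed.

Lemma cderive_comp f g z a b :
  cderive f (g z) a -> cderive g z b -> cderive (fun w => f (g w)) z (a * b).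
Proof.
  intros Hf Hg. assert (Cg := cderive_continuous _ _ _ Hg). revert Hf Hg.
  rewrite !cderive_iff. intros [P [HP [<- Ef]]] [Q [HQ [<- Eg]]].
  exists (fun w => P (g w) * Q w). repeat split.
  - apply continuous_Cmult; auto. now apply (continuous_comp g P).
  - intros w. rewrite (Ef (g w)). rewrite (Eg w) at 2. ring.
Qed.

Lemma curve_derive_comp f (g : R -> C) (t : R) a b :
  cderive f (g t) a -> curve_derive g t b -> curve_derive (fun s => f (g s)) t (a * b).
Proof.
  intros Hf Hg. assert (Cg := curve_derive_continuous _ _ _ Hg). revert Hf Hg.
  rewrite cderive_iff, !curve_derive_iff. intros [P [HP [<- Ef]]] [Q [HQ [<- Eg]]].
  exists (fun s => P (g s) * Q s). repeat split.
  - apply continuous_Cmult; auto. now apply (continuous_comp g P).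
  - intros s. rewrite (Ef (g s)). rewrite (Eg s) at 2. ring.
Qed.

Lemma cderive_ext_loc f g z l :
  locally z (fun w => f w = g w) -> cderive f z l -> cderive g z l.
Proof.
  intros Hloc Hf. apply locally_C_iff in Hloc. destruct Hloc as [d [Hd E]].
  apply (is_derive_ext_loc (V := C_NormedModule) f g z l).
  - exists (mkposreal d Hd). intros w Hw. apply E. exact Hw.
  - exact Hf.
Qed.

Lemma cderive_ext f g z l : (forall w, f w = g w) -> cderive f z l -> cderive g z l.
Proof. intros E. apply cderive_ext_loc. apply filter_forall. exact E. Qed.

Lemma cderive_eq f z l l' : cderive f z l -> l = l' -> cderive f z l'.
Proof. now intros H <-. Qed.

Lemma locally_neq f (z c : C) : continuous f z -> f z <> c -> locally z (fun w => f w <> c).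
Proof.
  intros Hf H0. assert (Hp : 0 < Cmod (f z - c)).
  { apply Cmod_gt_0. intro E. now apply H0, Ceq_minus. }
  rewrite continuous_C_iff in Hf. generalize (Hf _ Hp). apply filter_imp.
  intros w Hw E. rewrite E, <- Copp_minus_distr, Cmod_opp in Hw. lra.
Qed.

Lemma cderive_inv f z a :
  cderive f z a -> f z <> 0 -> cderive (fun w => / f w) z (- a / (f z * f z)).
Proof.
  intros Hf H0. assert (Cf := cderive_continuous _ _ _ Hf).
  assert (Hn := locally_neq f z 0 Cf H0).
  apply cderive_iff in Hf. destruct Hf as [P [HP [<- Ef]]].
  apply locally_C_iff in Hn. destruct Hn as [d [Hd Hn]].
  apply cderive_ext_loc with
    (fun w => / f z + (- P w / (f w * f z)) * (w - z)).
  - apply locally_C_iff. exists d. split; auto. intros w Hw.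
    assert (f w <> 0) by auto.
    assert (E : P w * (w - z) = f w - f z) by (rewrite (Ef w); ring).
    replace (- P w / (f w * f z) * (w - z)) with (- (P w * (w - z)) / (f w * f z))
      by (field; auto).
    rewrite E. field; auto.
  - apply cderive_iff. exists (fun w => - P w / (f w * f z)). repeat split.
    + apply continuous_Cdiv.
      * now apply continuous_Copp.
      * apply continuous_Cmult; auto. apply continuous_const.
      * now apply Cmult_neq_0.
    + intros w. ring.
Qed.

Lemma cderive_div f g z a b :
  cderive f z a -> cderive g z b -> g z <> 0 ->
  cderive (fun w => f w / g w) z ((a * g z - f z * b) / (g z * g z)).
Proof.
  intros Hf Hg H0.
  eapply cderive_eq; [apply cderive_mult; [exact Hf|apply cderive_inv; eauto]|].
  cbv beta; field; auto.
Qed.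

Lemma cderive_pow f z a n :
  cderive f z a -> cderive (fun w => f w ^ n) z (INR n * f z ^ pred n * a).
Proof.
  intros Hf. induction n as [|n IH].
  - eapply cderive_eq; [apply (cderive_const 1)|]. simpl. ring.
  - eapply cderive_eq; [apply (cderive_mult f (fun w => f w ^ n)); [exact Hf|exact IH]|].
    rewrite S_INR, RtoC_plus. simpl pred.
    destruct n as [|n]; simpl; [|rewrite ?RtoC_plus]; ring.
Qed.

Lemma cderive_unique f z a b : cderive f z a -> cderive f z b -> a = b.
Proof.
  intros Ha Hb. rewrite <- (is_C_derive_unique f z a Ha). now apply is_C_derive_unique.
Qed.

Lemma C_derive_ok f z : ex_derive f z -> cderive f z (C_derive f z).
Proof. intros [l H]. now rewrite (is_C_derive_unique f z l H). Qed.

(** A quadratic remainder survives integration over a parameter, which makes this the tool for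
    differentiating integrals. *)
Lemma cderive_of_quadratic_bound f z l (K d : R) :
  0 < d ->
  (forall w, Cmod (w - z) < d -> Cmod (f w - f z - (w - z) * l) <= K * Cmod (w - z) ^ 2) ->
  cderive f z l.
Proof.
  intros Hd H. split; [apply is_linear_scal_C|].
  intros z' Hz'. assert (z = z') as <-.
  { apply (is_filter_lim_locally_unique (K := C_AbsRing) (V := AbsRing_NormedModule C_AbsRing)).
    exact Hz'. }
  intros e. assert (HK : 0 < Rabs K + 1) by (generalize (Rabs_pos K); lra).
  assert (He := cond_pos e).
  assert (Hm : 0 < Rmin d (e / (Rabs K + 1))).
  { apply Rmin_pos; auto. now apply Rdiv_lt_0_compat. }
  exists (mkposreal _ Hm). intros w Hw.
  change (Cmod (f w - f z - (w - z) * l) <= e * Cmod (w - z)).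
  change (Cmod (w - z) < Rmin d (e / (Rabs K + 1))) in Hw.
  assert (H1 : Cmod (w - z) < d) by (eapply Rlt_le_trans; [exact Hw|apply Rmin_l]).
  assert (H2 : Cmod (w - z) <= e / (Rabs K + 1))
    by (left; eapply Rlt_le_trans; [exact Hw|apply Rmin_r]).
  eapply Rle_trans; [apply H, H1|]. simpl. rewrite Rmult_1_r, <- Rmult_assoc.
  apply Rmult_le_compat_r; [apply Cmod_ge_0|].
  apply Rle_trans with ((Rabs K + 1) * Cmod (w - z))%R.
  - apply Rmult_le_compat_r; [apply Cmod_ge_0|]. generalize (Rle_abs K); lra.
  - apply Rle_trans with ((Rabs K + 1) * (e / (Rabs K + 1)))%R.
    + apply Rmult_le_compat_l; lra.
    + right. field. lra.
Qed.

End ComplexDerivatives.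

(** * Integrals of complex-valued functions of a real variable *)

Definition is_CInt (f : R -> C) (a b : R) (l : C) : Prop := @is_RInt C_R_NormedModule f a b l.
Definition CInt (f : R -> C) (a b : R) : C := @RInt C_R_CompleteNormedModule f a b.

Section CurveIntegrals.
Implicit Types (f g : R -> C) (a b : R) (l m c : C).

Lemma is_CInt_unique f a b l : is_CInt f a b l -> CInt f a b = l.
Proof. exact (is_RInt_unique (V := C_R_CompleteNormedModule) f a b l). Qed.

Lemma continuous_is_CInt f a b :
  a <= b -> (forall t : R, a <= t <= b -> continuous f t) -> is_CInt f a b (CInt f a b).
Proof.
  intros Hab H. apply (RInt_correct (V := C_R_CompleteNormedModule)).
  apply (ex_RInt_continuous (V := C_R_CompleteNormedModule)).
  intros t Ht. rewrite Rmin_left, Rmax_right in Ht by assumption. now apply H.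
Qed.

Lemma is_CInt_plus f g a b l m :
  is_CInt f a b l -> is_CInt g a b m -> is_CInt (fun t => f t + g t) a b (l + m).
Proof. exact (is_RInt_plus (V := C_R_NormedModule) f g a b l m). Qed.

Lemma is_CInt_minus f g a b l m :
  is_CInt f a b l -> is_CInt g a b m -> is_CInt (fun t => f t - g t) a b (l - m).
Proof. exact (is_RInt_minus (V := C_R_NormedModule) f g a b l m). Qed.

(** The integral is only linear over the reals by construction; a complex factor is handled through
    real and imaginary parts. *)
Lemma is_CInt_scal f a b c l : is_CInt f a b l -> is_CInt (fun t => c * f t) a b (c * l).
Proof.
  intros H.
  assert (H1 := is_RInt_fct_extend_fst (U := R_NormedModule) (V := R_NormedModule) f a b l H).
  assert (H2 := is_RInt_fct_extend_snd (U := R_NormedModule) (V := R_NormedModule) f a b l H).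
  apply (is_RInt_fct_extend_pair (U := R_NormedModule) (V := R_NormedModule)
           (fun t => c * f t) a b).
  - apply (is_RInt_minus (V := R_NormedModule)); now apply (is_RInt_scal (V := R_NormedModule)).
  - apply (is_RInt_plus (V := R_NormedModule)); now apply (is_RInt_scal (V := R_NormedModule)).
Qed.

Lemma is_CInt_ext f g a b l :
  a <= b -> (forall t : R, a <= t <= b -> f t = g t) -> is_CInt f a b l -> is_CInt g a b l.
Proof.
  intros Hab E. apply (is_RInt_ext (V := C_R_NormedModule)).
  intros t Ht. rewrite Rmin_left, Rmax_right in Ht by assumption. apply E. lra.
Qed.

Lemma is_CInt_eq f a b l m : is_CInt f a b l -> l = m -> is_CInt f a b m.
Proof. now intros H <-. Qed.

Lemma is_CInt_Chasles f a b (d : R) l m :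
  is_CInt f a b l -> is_CInt f b d m -> is_CInt f a d (l + m).
Proof. exact (is_RInt_Chasles (V := C_R_NormedModule) f a b d l m). Qed.

Lemma is_CInt_bound f a b l (M : R) :
  a <= b -> (forall t : R, a <= t <= b -> Cmod (f t) <= M) ->
  is_CInt f a b l -> Cmod l <= (b - a) * M.
Proof.
  intros Hab H Hl. rewrite Cmod_norm.
  apply (norm_RInt_le_const (V := C_R_NormedModule) f a b l M); auto.
  intros t Ht. rewrite <- Cmod_norm. auto.
Qed.

Lemma is_CInt_derive f g a b :
  a <= b ->
  (forall t : R, a <= t <= b -> curve_derive f t (g t)) ->
  (forall t : R, a <= t <= b -> continuous g t) ->
  is_CInt g a b (f b - f a).
Proof.
  intros Hab Hf Hg.
  apply (is_RInt_derive (V := C_R_CompleteNormedModule) f g a b);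
    intros t Ht; rewrite Rmin_left, Rmax_right in Ht by assumption; [apply Hf|apply Hg]; auto.
Qed.

Lemma continuous_bounded f a b :
  a <= b -> (forall t : R, a <= t <= b -> continuous f t) ->
  exists M : R, 0 < M /\ forall t : R, a <= t <= b -> Cmod (f t) <= M.
Proof.
  intros Hab Hf.
  destruct (continuity_ab_maj (fun t => Cmod (f t)) a b Hab) as [t0 [H0 _]].
  - intros t Ht. apply continuity_pt_filterlim. apply continuous_Cmod. auto.
  - exists (Cmod (f t0) + 1)%R. split; [generalize (Cmod_ge_0 (f t0)); lra|].
    intros t Ht. generalize (H0 t Ht). lra.
Qed.

(* [P] is a primitive of the affine function [al + be * (z - w)]. *)
Lemma path_integral_affine_approx (h : C -> C) (p p' : R -> C) a b (w al be l : C) (e L : R) :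
  a <= b ->
  (forall t : R, a <= t <= b -> curve_derive p t (p' t)) ->
  (forall t : R, a <= t <= b -> continuous p' t) ->
  (forall t : R, a <= t <= b -> Cmod (h (p t) - (al + be * (p t - w))) <= e) ->
  (forall t : R, a <= t <= b -> Cmod (p' t) <= L) ->
  is_CInt (fun t => h (p t) * p' t) a b l ->
  let P z := al * z + be / 2 * (z - w) ^ 2 in
  Cmod (l - (P (p b) - P (p a))) <= (b - a) * (e * L).
Proof.
  intros Hab Hp Hp' Hh HL Hl P.
  assert (HP : forall z, cderive P z (al + be * (z - w))).
  { intros z. unfold P. eapply cderive_eq.
    - apply cderive_plus.
      + apply (cderive_mult (fun _ => al) (fun z => z)); [apply cderive_const|apply cderive_id].
      + apply (cderive_mult (fun _ => be / 2) (fun z => (z - w) ^ 2)); [apply cderive_const|].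
        apply (cderive_pow (fun z => z - w)).
        apply (cderive_minus (fun z => z) (fun _ => w)); [apply cderive_id|apply cderive_const].
    - simpl. rewrite ?RtoC_plus. field. }
  assert (HI : is_CInt (fun t => (al + be * (p t - w)) * p' t) a b (P (p b) - P (p a))).
  { apply (is_CInt_derive (fun t => P (p t))); auto.
    - intros t Ht. apply curve_derive_comp; auto.
    - intros t Ht. apply continuous_Cmult; auto.
      apply continuous_Cplus; [apply continuous_const|].
      apply continuous_Cmult; [apply continuous_const|].
      apply continuous_Cminus; [|apply continuous_const].
      eapply curve_derive_continuous; eauto. }
  eapply is_CInt_bound; [exact Hab| |apply is_CInt_minus; [exact Hl|exact HI]].
  intros t Ht. cbv beta.
  replace (h (p t) * p' t - (al + be * (p t - w)) * p' t)
    with ((h (p t) - (al + be * (p t - w))) * p' t) by ring.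
  rewrite Cmod_mult. apply Rmult_le_compat; try apply Cmod_ge_0; auto.
Qed.

(** Differentiation under the integral sign: the remainder of the integral is the integral of the
    remainders, and these are uniformly quadratic. *)
Lemma cderive_CInt_param (H : C -> R -> C) (q : R -> C) a b (z : C) (K d : R) :
  a <= b -> 0 < d ->
  (forall w t, Cmod (w - z) < d -> a <= t <= b -> continuous (H w) t) ->
  (forall t, a <= t <= b -> continuous q t) ->
  (forall w t, Cmod (w - z) < d -> a <= t <= b ->
     Cmod (H w t - H z t - (w - z) * q t) <= K * Cmod (w - z) ^ 2) ->
  cderive (fun w => CInt (H w) a b) z (CInt q a b).
Proof.
  intros Hab Hd HH Hq Hb.
  apply cderive_of_quadratic_bound with ((b - a) * K)%R d; auto.
  intros w Hw. rewrite Rmult_assoc.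
  assert (Hz : Cmod (z - z) < d) by (replace (z - z) with (RtoC 0) by ring; rewrite Cmod_0; auto).
  eapply is_CInt_bound; [exact Hab| |apply is_CInt_minus;
    [apply is_CInt_minus; apply continuous_is_CInt; eauto|
     apply is_CInt_scal, continuous_is_CInt; eauto]].
  intros t Ht. cbv beta. auto.
Qed.
End CurveIntegrals.

(** * Goursat's theorem *)

Lemma Cmod_le_Re_Im (z : C) : Cmod z <= Rabs (fst z) + Rabs (snd z).
Proof.
  assert (E : z = RtoC (fst z) + Ci * RtoC (snd z))
    by (destruct z; apply injective_projections; simpl; ring).
  rewrite E at 1. eapply Rle_trans; [apply Cmod_triangle|].
  rewrite Cmod_mult, !Cmod_R, Cmod_Ci. lra.
Qed.

Lemma im_le_Cmod (z : C) : Rabs (Im z) <= Cmod z.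
Proof.
  rewrite <- (Ropp_involutive (Im z)), Rabs_Ropp, <- re_mult_Ci.
  eapply Rle_trans; [apply re_le_Cmod|]. rewrite Cmod_mult, Cmod_Ci. lra.
Qed.

Lemma pow_half_small (K e : R) : 0 < e -> exists n : nat, K * (/ 2) ^ n < e.
Proof.
  intros He.
  destruct (pow_lt_1_zero (/ 2) ltac:(rewrite Rabs_right; lra) (e / (Rabs K + 1)))
    as [n Hn].
  - apply Rdiv_lt_0_compat; auto. generalize (Rabs_pos K); lra.
  - exists n. specialize (Hn n (le_n _)).
    assert (HK := Rabs_pos K).
    assert (Hp : 0 < (/ 2) ^ n) by (apply pow_lt; lra).
    rewrite Rabs_right in Hn by lra.
    apply Rle_lt_trans with ((Rabs K + 1) * (/ 2) ^ n)%R.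
    + apply Rmult_le_compat_r; [lra|]. generalize (Rle_abs K); lra.
    + apply Rlt_le_trans with ((Rabs K + 1) * (e / (Rabs K + 1)))%R.
      * apply Rmult_lt_compat_l; lra.
      * right; field; lra.
Qed.

(** The common source of limit points for the nested rectangles, the doubling argument and Newton's
    iteration. *)
Lemma geometric_sequence_converges (z : nat -> C) (K : R) :
  (forall n, Cmod (z (S n) - z n) <= K * (/ 2) ^ n) ->
  exists l : C, forall n, Cmod (z n - l) <= 2 * K * (/ 2) ^ n.
Proof.
  intros Hz.
  assert (HK : 0 <= K).
  { specialize (Hz 0%nat). simpl in Hz. generalize (Cmod_ge_0 (z 1%nat - z 0%nat)). lra. }
  (* Subtracting the tail of the series makes the bound strong enough for the induction on [k]. *)
  assert (Hnk : forall n k, Cmod (z (n + k)%nat - z n) <= 2 * K * (/ 2) ^ n - 2 * K * (/ 2) ^ (n + k)).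
  { intros n k. induction k as [|k IH].
    - rewrite Nat.add_0_r. replace (z n - z n) with (RtoC 0) by ring. rewrite Cmod_0. lra.
    - rewrite Nat.add_succ_r.
      replace (z (S (n + k)) - z n)
        with ((z (S (n + k)) - z (n + k)%nat) + (z (n + k)%nat - z n)) by ring.
      eapply Rle_trans; [apply Cmod_triangle|]. specialize (Hz (n + k)%nat).
      simpl ((/ 2) ^ S (n + k))%R. lra. }
  assert (Hnm : forall n m, (n <= m)%nat -> Cmod (z m - z n) <= 2 * K * (/ 2) ^ n).
  { intros n m Hm. replace m with (n + (m - n))%nat by lia.
    eapply Rle_trans; [apply Hnk|].
    assert (0 <= 2 * K * (/ 2) ^ (n + (m - n))); [|lra].
    apply Rmult_le_pos; [lra|]. apply pow_le; lra. }
  destruct (proj1 (filterlim_locally_cauchy (U := C_R_CompleteNormedModule) (F := eventually) z))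
    as [l Hl].
  - intros e. destruct (pow_half_small (4 * K) e (cond_pos e)) as [n Hn].
    exists (fun m => (n <= m)%nat). split; [now exists n|].
    intros u v Hu Hv. apply C_NormedModule_mixin_compat1.
    change (Cmod (z v - z u) < e).
    replace (z v - z u) with ((z v - z n) + - (z u - z n)) by ring.
    eapply Rle_lt_trans; [apply Cmod_triangle|]. rewrite Cmod_opp.
    generalize (Hnm n u Hu) (Hnm n v Hv). lra.
  - exists l. intros n. apply le_epsilon. intros e He.
    assert (Hb : locally l (fun w : C => Cmod (w - l) < e)).
    { apply locally_C_iff. exists e. auto. }
    destruct (Hl _ Hb) as [N HN].
    specialize (HN (N + n)%nat ltac:(lia)).
    specialize (Hnm n (N + n)%nat ltac:(lia)).
    replace (z n - l) with (- (z (N + n)%nat - z n) + (z (N + n)%nat - l)) by ring.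
    eapply Rle_trans; [apply Cmod_triangle|]. rewrite Cmod_opp. lra.
Qed.

(* Goursat's subdivision argument: [J s t h] stands for the integral over the
   boundary of the rectangle with corner [(s, t)] and sides [h * X], [h * Y]. *)
Section Subdivision.
Variables (J : R -> R -> R -> C) (X Y : R).
Hypotheses (HX : 0 <= X) (HY : 0 <= Y).
Let inside (s t h : R) : Prop := 0 <= s /\ s + h * X <= X /\ 0 <= t /\ t + h * Y <= Y.
Hypothesis Hadd : forall s t h : R, 0 <= h -> inside s t h ->
  J s t h = J s t (h / 2) + J (s + h / 2 * X)%R t (h / 2)
    + J s (t + h / 2 * Y)%R (h / 2) + J (s + h / 2 * X)%R (t + h / 2 * Y)%R (h / 2).
Hypothesis Hsmall : forall x y e : R, 0 <= x <= X -> 0 <= y <= Y -> 0 < e ->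
  exists d : R, 0 < d /\ forall s t h : R, 0 < h < d -> inside s t h ->
    Rabs (s - x) <= 2 * (X + Y) * h -> Rabs (t - y) <= 2 * (X + Y) * h ->
    Cmod (J s t h) <= e * h ^ 2.

(** The four quarters add up to the whole, so one of them carries at least a quarter of its
    modulus. *)
Lemma subdivision_step (s t h : R) : 0 <= h -> inside s t h ->
  exists st : R * R, inside (fst st) (snd st) (h / 2) /\
    Cmod (J s t h) <= 4 * Cmod (J (fst st) (snd st) (h / 2)) /\
    Rabs (fst st - s) <= h / 2 * X /\ Rabs (snd st - t) <= h / 2 * Y.
Proof.
  intros Hh Hin.
  assert (HhX : 0 <= h / 2 * X) by (apply Rmult_le_pos; lra).
  assert (HhY : 0 <= h / 2 * Y) by (apply Rmult_le_pos; lra).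
  assert (E := Hadd s t h Hh Hin).
  set (A := J s t (h / 2)) in E. set (B := J (s + h / 2 * X)%R t (h / 2)) in E.
  set (D := J s (t + h / 2 * Y)%R (h / 2)) in E.
  set (F := J (s + h / 2 * X)%R (t + h / 2 * Y)%R (h / 2)) in E.
  assert (HJ : Cmod (J s t h) <= Cmod A + Cmod B + Cmod D + Cmod F).
  { rewrite E. eapply Rle_trans; [apply Cmod_triangle|]. apply Rplus_le_compat_r.
    eapply Rle_trans; [apply Cmod_triangle|]. apply Rplus_le_compat_r.
    apply Cmod_triangle. }
  destruct Hin as [I1 [I2 [I3 I4]]].
  assert (R0 : forall x : R, Rabs (x - x) = 0%R)
    by (intros x; replace (x - x)%R with 0%R by ring; apply Rabs_R0).
  assert (R1 : forall x y : R, 0 <= y -> Rabs (x + y - x) = y)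
    by (intros x y Hy; replace (x + y - x)%R with y by ring; apply Rabs_pos_eq, Hy).
  destruct (Rle_lt_dec (Cmod (J s t h)) (4 * Cmod A)) as [HA|HA];
    [exists (s, t)|
  destruct (Rle_lt_dec (Cmod (J s t h)) (4 * Cmod B)) as [HB|HB];
    [exists ((s + h / 2 * X)%R, t)|
  destruct (Rle_lt_dec (Cmod (J s t h)) (4 * Cmod D)) as [HD|HD];
    [exists (s, (t + h / 2 * Y)%R)|
  exists ((s + h / 2 * X)%R, (t + h / 2 * Y)%R)]]];
  unfold inside; simpl; rewrite ?R0, ?R1 by assumption; repeat split; try assumption; try lra.
  fold F. lra.
Qed.

(** At stage [n] the chosen rectangle carries at least [4 ^ (-n)] times the modulus of [J 0 0 1],
    while [Hsmall] at the limit point allows at most [e * 4 ^ (-n)]. *)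
Lemma subdivision_vanishing : J 0 0 1 = 0.
Proof.
  apply Cmod_eq_0. apply Rle_antisym; [|apply Cmod_ge_0].
  apply le_epsilon. intros e He. rewrite Rplus_0_l.
  (* Outside the range of [subdivision_step] the corner is returned unchanged; [Hin] shows that this
     default never occurs along the sequence [c]. *)
  set (step := fun (h : R) (st : R * R) =>
    match excluded_middle_informative (0 <= h /\ inside (fst st) (snd st) h) with
    | left H => proj1_sig (constructive_indefinite_description _
                  (subdivision_step (fst st) (snd st) h (proj1 H) (proj2 H)))
    | right _ => st
    end).
  set (c := fix c (n : nat) : R * R :=
    match n with O => (0, 0)%R | S n => step ((/ 2) ^ n)%R (c n) end).
  assert (Hpos : forall n, 0 < (/ 2) ^ n) by (intros n; apply pow_lt; lra).
  assert (Hstep : forall n, inside (fst (c n)) (snd (c n)) ((/ 2) ^ n) ->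
    inside (fst (c (S n))) (snd (c (S n))) ((/ 2) ^ S n) /\
    Cmod (J (fst (c n)) (snd (c n)) ((/ 2) ^ n))
      <= 4 * Cmod (J (fst (c (S n))) (snd (c (S n))) ((/ 2) ^ S n)) /\
    Rabs (fst (c (S n)) - fst (c n)) <= (/ 2) ^ n / 2 * X /\
    Rabs (snd (c (S n)) - snd (c n)) <= (/ 2) ^ n / 2 * Y).
  { intros n Hn. simpl (c (S n)). unfold step at 1 2 3 4 5 6.
    destruct (excluded_middle_informative _) as [H|H].
    - destruct (constructive_indefinite_description _ _) as [st Hst]. cbn [proj1_sig].
      replace ((/ 2) ^ S n)%R with ((/ 2) ^ n / 2)%R by (simpl; field). exact Hst.
    - exfalso. apply H. split; auto. left; auto. }
  assert (Hin : forall n, inside (fst (c n)) (snd (c n)) ((/ 2) ^ n)).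
  { intros n. induction n as [|n IH]; [simpl; unfold inside; lra|]. now apply Hstep. }
  assert (HJ : forall n, Cmod (J 0 0 1) * ((/ 2) ^ n) ^ 2
                   <= Cmod (J (fst (c n)) (snd (c n)) ((/ 2) ^ n))).
  { intros n. induction n as [|n IH]; [simpl; lra|].
    destruct (Hstep n (Hin n)) as [_ [H _]].
    replace (((/ 2) ^ S n) ^ 2)%R with (((/ 2) ^ n) ^ 2 / 4)%R by (simpl; field). lra. }
  (* A corner is a pair of reals, hence a complex number, and the convergence lemma applies to it as
     such. *)
  destruct (geometric_sequence_converges (fun n => c n) ((X + Y) / 2)) as [l Hl].
  { intros n. destruct (Hstep n (Hin n)) as [_ [_ [H1 H2]]].
    eapply Rle_trans; [apply Cmod_le_Re_Im|].
    change (Rabs (fst (c (S n)) - fst (c n)) + Rabs (snd (c (S n)) - snd (c n))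
      <= (X + Y) / 2 * (/ 2) ^ n). lra. }
  destruct l as [x y].
  assert (Hx : forall n, Rabs (fst (c n) - x) <= (X + Y) * (/ 2) ^ n).
  { intros n. eapply Rle_trans; [|eapply Rle_trans; [apply (Hl n)|lra]].
    apply (re_le_Cmod (c n - (x, y))). }
  assert (Hy : forall n, Rabs (snd (c n) - y) <= (X + Y) * (/ 2) ^ n).
  { intros n. eapply Rle_trans; [|eapply Rle_trans; [apply (Hl n)|lra]].
    apply (im_le_Cmod (c n - (x, y))). }
  assert (Hbox : forall n, 0 <= fst (c n) <= X /\ 0 <= snd (c n) <= Y).
  { intros n. destruct (Hin n) as [I1 [I2 [I3 I4]]]. specialize (Hpos n).
    assert (0 <= (/ 2) ^ n * X) by (apply Rmult_le_pos; lra).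
    assert (0 <= (/ 2) ^ n * Y) by (apply Rmult_le_pos; lra). lra. }
  assert (Hlim : forall (u : nat -> R) (v m : R), (forall n, 0 <= u n <= m) ->
            (forall n, Rabs (u n - v) <= (X + Y) * (/ 2) ^ n) -> 0 <= v <= m).
  { intros u v m Hu Hv. split; apply le_epsilon; intros e' He';
      destruct (pow_half_small (X + Y) e' He') as [n Hn];
      generalize (Hu n) (Rabs_le_between (u n - v) ((X + Y) * (/ 2) ^ n)) (Hv n);
      intros U1 [U2 _] U3; specialize (U2 U3); lra. }
  destruct (Hsmall x y e) as [d [Hd HJd]]; auto.
  { apply (Hlim (fun n => fst (c n))); auto. intros n; apply Hbox. }
  { apply (Hlim (fun n => snd (c n))); auto. intros n; apply Hbox. }
  destruct (pow_half_small 1 d Hd) as [n Hn]. rewrite Rmult_1_l in Hn.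
  assert (HXY : 0 <= (X + Y) * (/ 2) ^ n) by (apply Rmult_le_pos; [lra|left; auto]).
  assert (H1 := HJd (fst (c n)) (snd (c n)) ((/ 2) ^ n)%R (conj (Hpos n) Hn) (Hin n)
    ltac:(generalize (Hx n); lra) ltac:(generalize (Hy n); lra)).
  generalize (HJ n). intros H2.
  apply Rmult_le_reg_r with (((/ 2) ^ n) ^ 2)%R; [apply pow_lt; auto|]. lra.
Qed.
End Subdivision.

(** The mean value inequality, obtained by integrating [c'] since there is no mean value equality
    for complex values. *)
Lemma curve_increment_bound (c c' : R -> C) (a b L : R) :
  a <= b ->
  (forall t : R, a <= t <= b -> curve_derive c t (c' t)) ->
  (forall t : R, a <= t <= b -> continuous c' t) ->
  (forall t : R, a <= t <= b -> Cmod (c' t) <= L) ->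
  forall s t : R, a <= s <= b -> a <= t <= b -> Cmod (c t - c s) <= L * Rabs (t - s).
Proof.
  intros Hab Hc Hc' HL.
  assert (H : forall s t : R, a <= s <= t -> t <= b -> Cmod (c t - c s) <= L * Rabs (t - s)).
  { intros s t Hs Ht. rewrite Rabs_right by lra. rewrite Rmult_comm.
    apply (is_CInt_bound c' s t); [lra| |].
    - intros u Hu. apply HL. lra.
    - apply is_CInt_derive; [lra| |]; intros u Hu; [apply Hc|apply Hc']; lra. }
  intros s t Hs Ht. destruct (Rle_lt_dec s t).
  - apply H; lra.
  - rewrite <- (Copp_minus_distr (c s)), Cmod_opp, Rabs_minus_sym. apply H; lra.
Qed.

Lemma cderive_affine_approx (h : C -> C) (z l : C) (e : R) :
  cderive h z l -> 0 < e ->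
  exists d : R, 0 < d /\ forall w : C, Cmod (w - z) < d ->
    Cmod (h w - (h z + l * (w - z))) <= e * Cmod (w - z).
Proof.
  intros Hh He. apply cderive_iff in Hh. destruct Hh as [Q [HQ [<- E]]].
  rewrite continuous_CC_iff in HQ. destruct (HQ e He) as [d [Hd H]].
  exists d. split; auto. intros w Hw. rewrite (E w).
  replace (h z + Q w * (w - z) - (h z + Q z * (w - z))) with ((Q w - Q z) * (w - z)) by ring.
  rewrite Cmod_mult. apply Rmult_le_compat_r; [apply Cmod_ge_0|]. left; auto.
Qed.

(** * Cauchy's theorem for the image of a parameter rectangle *)

Section Homotopy.
Variables (h : C -> C) (b : C) (c c' : R -> C) (A X Y : R).
Hypotheses (HX : 0 <= X) (HY : 0 <= Y).
Hypothesis Hc : forall t : R, curve_derive c t (c' t).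
Hypothesis Hc' : forall t : R, continuous c' t.
Let Phi (s t : R) : C := b + s * c t.
Hypothesis Hh : forall s t : R, A <= s <= A + X -> 0 <= t <= Y -> ex_derive h (Phi s t).

Let fs (t s : R) : C := h (Phi s t) * c t.
Let ft (s t : R) : C := h (Phi s t) * (s * c' t).

Lemma curve_derive_RtoC (x : R) : curve_derive RtoC x 1.
Proof.
  apply curve_derive_iff. exists (fun _ => RtoC 1). repeat split; [apply continuous_const|].
  intros y. rewrite RtoC_minus. ring.
Qed.

Lemma curve_derive_Phi_s (s t : R) : curve_derive (fun s => Phi s t) s (c t).
Proof.
  unfold Phi. replace (c t) with ((0 + (1 * c t + s * 0)) * 1) at 1 by ring.
  apply (curve_derive_comp (fun z => b + z * c t) RtoC); [|apply curve_derive_RtoC].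
  apply (cderive_plus (fun _ => b) (fun z => z * c t)); [apply cderive_const|].
  apply (cderive_mult (fun z => z) (fun _ => c t)); [apply cderive_id|apply cderive_const].
Qed.

Lemma curve_derive_Phi_t (s t : R) : curve_derive (fun t => Phi s t) t (s * c' t).
Proof.
  unfold Phi. replace (s * c' t) with ((0 + (0 * c t + s * 1)) * c' t) at 1 by ring.
  apply (curve_derive_comp (fun z => b + s * z) c); [|apply Hc].
  apply (cderive_plus (fun _ => b) (fun z => s * z)); [apply cderive_const|].
  apply (cderive_mult (fun _ => s) (fun z => z)); [apply cderive_const|apply cderive_id].
Qed.

Lemma homotopy_is_CInt_s (s0 s1 t : R) : A <= s0 -> s0 <= s1 -> s1 <= A + X -> 0 <= t <= Y ->
  is_CInt (fs t) s0 s1 (CInt (fs t) s0 s1).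
Proof.
  intros. apply continuous_is_CInt; auto. intros s Hs. apply continuous_Cmult.
  - apply (continuous_comp (fun s => Phi s t) h).
    + eapply curve_derive_continuous, curve_derive_Phi_s.
    + apply ex_cderive_continuous. apply Hh; lra.
  - apply continuous_const.
Qed.

Lemma homotopy_is_CInt_t (s t0 t1 : R) : A <= s <= A + X -> 0 <= t0 -> t0 <= t1 -> t1 <= Y ->
  is_CInt (ft s) t0 t1 (CInt (ft s) t0 t1).
Proof.
  intros. apply continuous_is_CInt; auto. intros t Ht. apply continuous_Cmult.
  - apply (continuous_comp (fun t => Phi s t) h).
    + eapply curve_derive_continuous, curve_derive_Phi_t.
    + apply ex_cderive_continuous. apply Hh; lra.
  - apply continuous_Cmult; [apply continuous_const|apply Hc'].
Qed.

(** The integral of [h dz] along the image under [Phi] of the boundary of the rectangle with corner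
    [(A + x, t)] and sides [k * X], [k * Y], taken counterclockwise. *)
Let J (x t k : R) : C :=
  CInt (fs t) (A + x) (A + x + k * X) + CInt (ft (A + x + k * X)%R) t (t + k * Y)
  - CInt (fs (t + k * Y)%R) (A + x) (A + x + k * X) - CInt (ft (A + x)%R) t (t + k * Y).

Lemma homotopy_boundary_additive (x t k : R) : 0 <= k ->
  0 <= x /\ x + k * X <= X /\ 0 <= t /\ t + k * Y <= Y ->
  J x t k = J x t (k / 2) + J (x + k / 2 * X)%R t (k / 2)
    + J x (t + k / 2 * Y)%R (k / 2) + J (x + k / 2 * X)%R (t + k / 2 * Y)%R (k / 2).
Proof.
  intros Hk [I1 [I2 [I3 I4]]].
  assert (HkX : 0 <= k / 2 * X) by (apply Rmult_le_pos; lra).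
  assert (HkY : 0 <= k / 2 * Y) by (apply Rmult_le_pos; lra).
  assert (Es : forall u, 0 <= u <= Y -> CInt (fs u) (A + x) (A + x + k * X)
    = CInt (fs u) (A + x) (A + x + k / 2 * X)
      + CInt (fs u) (A + x + k / 2 * X) (A + x + k * X)).
  { intros u Hu. apply is_CInt_unique.
    eapply is_CInt_Chasles; apply homotopy_is_CInt_s; lra. }
  assert (Et : forall s, A <= s <= A + X -> CInt (ft s) t (t + k * Y)
    = CInt (ft s) t (t + k / 2 * Y) + CInt (ft s) (t + k / 2 * Y) (t + k * Y)).
  { intros s Hs. apply is_CInt_unique.
    eapply is_CInt_Chasles; apply homotopy_is_CInt_t; lra. }
  unfold J.
  replace (A + (x + k / 2 * X) + k / 2 * X)%R with (A + x + k * X)%R by field.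
  replace (t + k / 2 * Y + k / 2 * Y)%R with (t + k * Y)%R by field.
  replace (A + (x + k / 2 * X))%R with (A + x + k / 2 * X)%R by ring.
  rewrite (Es t), (Es (t + k * Y)%R), (Et (A + x + k * X)%R), (Et (A + x)%R) by lra.
  ring.
Qed.

(** Near [w] the function [h] is affine up to an error [o(k)]. The affine part has the primitive
    [P], whose values at the four corners cancel; the error is integrated over a boundary of length
    [O(k)]. *)
Lemma homotopy_boundary_small (x y e : R) : 0 <= x <= X -> 0 <= y <= Y -> 0 < e ->
  exists d : R, 0 < d /\ forall s t k : R, 0 < k < d ->
    0 <= s /\ s + k * X <= X /\ 0 <= t /\ t + k * Y <= Y ->
    Rabs (s - x) <= 2 * (X + Y) * k -> Rabs (t - y) <= 2 * (X + Y) * k ->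
    Cmod (J s t k) <= e * k ^ 2.
Proof.
  intros Hx Hy He.
  destruct (continuous_bounded c 0 Y HY) as [L1 [HL1 Hb1]].
  { intros t _. eapply curve_derive_continuous, Hc. }
  destruct (continuous_bounded c' 0 Y HY) as [L2 [HL2 Hb2]]; [auto|].
  set (S := Rmax 1 (Rabs A + X)). set (L := (S * (L1 + L2))%R).
  assert (HS : 1 <= S) by apply Rmax_l.
  assert (HSs : forall s, A <= s <= A + X -> Rabs s <= S).
  { intros s Hs. apply Rle_trans with (Rabs A + X)%R; [|apply Rmax_r].
    replace s with (A + (s - A))%R by ring.
    eapply Rle_trans; [apply Rabs_triang|]. rewrite (Rabs_right (s - A)); lra. }
  assert (HL : L1 <= L /\ S * L2 <= L).
  { unfold L. assert (1 * L1 <= S * L1) by (apply Rmult_le_compat_r; lra).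
    assert (0 <= S * L2) by (apply Rmult_le_pos; lra). lra. }
  assert (HL0 : 0 < L) by lra.
  set (w := Phi (A + x) y).
  destruct (Hh (A + x) y) as [be Hbe]; [lra|lra|]. fold w in Hbe.
  (* Each parameter stays within [3 (X + Y) k] of the limit point, and [L] bounds both partial
     derivatives of [Phi]; so the image stays within [M * k] of [w]. *)
  set (M := (3 * (X + Y) * L * 2)%R).
  assert (HM : 0 <= M) by (unfold M; repeat apply Rmult_le_pos; lra).
  (* The boundary has length at most [2 (X + Y) L k], and the error on it is at most [M * k] times
     the tolerance [e / (N + 1)]. The product is [N * (e / (N + 1)) * k ^ 2]. *)
  set (N := (2 * (X + Y) * (M * L))%R).
  assert (HN : 0 <= N) by (unfold N; repeat apply Rmult_le_pos; lra).
  destruct (cderive_affine_approx h w be (e / (N + 1)) Hbe) as [d [Hd Hap]].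
  { apply Rdiv_lt_0_compat; lra. }
  exists (d / (M + 1))%R. split; [apply Rdiv_lt_0_compat; lra|].
  intros s t k [Hk Hkd] [I1 [I2 [I3 I4]]] Hsx Hty.
  assert (HkX : 0 <= k * X) by (apply Rmult_le_pos; lra).
  assert (HkY : 0 <= k * Y) by (apply Rmult_le_pos; lra).
  assert (Hdist : forall u v : R, s <= u <= s + k * X -> t <= v <= t + k * Y ->
            Cmod (Phi (A + u) v - w) <= M * k).
  { intros u v Hu Hv. unfold w, Phi.
    replace (b + (A + u)%R * c v - (b + (A + x)%R * c y))
      with (RtoC (u - x) * c v + RtoC (A + x) * (c v - c y))
      by (rewrite ?RtoC_plus, ?RtoC_minus; ring).
    eapply Rle_trans; [apply Cmod_triangle|]. rewrite !Cmod_mult, !Cmod_R.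
    assert (Hu' : Rabs (u - x) <= 3 * (X + Y) * k).
    { replace (u - x)%R with ((u - s) + (s - x))%R by ring.
      eapply Rle_trans; [apply Rabs_triang|]. rewrite (Rabs_right (u - s)) by lra. lra. }
    assert (Hv' : Rabs (v - y) <= 3 * (X + Y) * k).
    { replace (v - y)%R with ((v - t) + (t - y))%R by ring.
      eapply Rle_trans; [apply Rabs_triang|]. rewrite (Rabs_right (v - t)) by lra. lra. }
    assert (H1 : Cmod (c v - c y) <= L2 * Rabs (v - y)).
    { apply (curve_increment_bound c c' 0 Y); auto; lra. }
    assert (H2 : Rabs (u - x) * Cmod (c v) <= 3 * (X + Y) * k * L).
    { apply Rmult_le_compat; [apply Rabs_pos|apply Cmod_ge_0|lra|].
      eapply Rle_trans; [apply Hb1|]; lra. }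
    assert (H3 : Rabs (A + x) * Cmod (c v - c y) <= S * (L2 * (3 * (X + Y) * k))).
    { apply Rmult_le_compat; [apply Rabs_pos|apply Cmod_ge_0|apply HSs; lra|].
      eapply Rle_trans; [apply H1|]. apply Rmult_le_compat_l; lra. }
    assert (H4 : S * L2 * (3 * (X + Y) * k) <= L * (3 * (X + Y) * k)).
    { apply Rmult_le_compat_r; [|lra]. repeat apply Rmult_le_pos; lra. }
    unfold M. lra. }
  assert (HMk : M * k < d).
  { apply Rle_lt_trans with ((M + 1) * k)%R; [apply Rmult_le_compat_r; lra|].
    apply Rlt_le_trans with ((M + 1) * (d / (M + 1)))%R.
    - apply Rmult_lt_compat_l; lra.
    - right; field; lra. }
  set (e' := (e / (N + 1) * (M * k))%R).
  assert (He' : 0 <= e / (N + 1)) by (left; apply Rdiv_lt_0_compat; lra).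
  assert (Herr : forall u v : R, s <= u <= s + k * X -> t <= v <= t + k * Y ->
            Cmod (h (Phi (A + u) v) - (h w + be * (Phi (A + u) v - w))) <= e').
  { intros u v Hu Hv. specialize (Hdist u v Hu Hv).
    eapply Rle_trans; [apply Hap; lra|]. apply Rmult_le_compat_l; auto. }
  set (P := fun z => h w * z + be / 2 * (z - w) ^ 2).
  assert (Bs : forall v, t <= v <= t + k * Y ->
    Cmod (CInt (fs v) (A + s) (A + s + k * X)
      - (P (Phi (A + s + k * X) v) - P (Phi (A + s) v))) <= k * X * (e' * L)).
  { intros v Hv. replace (k * X)%R with ((A + s + k * X) - (A + s))%R at 3 by ring.
    apply (path_integral_affine_approx h (fun s => Phi s v) (fun _ => c v)); [lra| | | | |].
    - intros u _. apply curve_derive_Phi_s.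
    - intros u _. apply continuous_const.
    - intros u Hu. replace u with (A + (u - A))%R by ring. apply Herr; lra.
    - intros u Hu. eapply Rle_trans; [apply Hb1; lra|]. lra.
    - apply homotopy_is_CInt_s; lra. }
  assert (Bt : forall u, s <= u <= s + k * X ->
    Cmod (CInt (ft (A + u)%R) t (t + k * Y)
      - (P (Phi (A + u) (t + k * Y)) - P (Phi (A + u) t))) <= k * Y * (e' * L)).
  { intros u Hu. replace (k * Y)%R with ((t + k * Y) - t)%R at 3 by ring.
    apply (path_integral_affine_approx h (fun t => Phi (A + u) t)
             (fun t => RtoC (A + u) * c' t)); [lra| | | | |].
    - intros v _. apply curve_derive_Phi_t.
    - intros v _. apply continuous_Cmult; [apply continuous_const|apply Hc'].
    - intros v Hv. apply Herr; lra.
    - intros v Hv. rewrite Cmod_mult, Cmod_R.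
      apply Rle_trans with (S * L2)%R; [|lra].
      apply Rmult_le_compat; [apply Rabs_pos|apply Cmod_ge_0| |].
      + apply HSs; lra.
      + apply Hb2; lra.
    - apply homotopy_is_CInt_t; lra. }
  assert (B1 := Bs t ltac:(lra)). assert (B2 := Bs (t + k * Y)%R ltac:(lra)).
  assert (B3 := Bt s ltac:(lra)). assert (B4 := Bt (s + k * X)%R ltac:(lra)).
  rewrite <- Rplus_assoc in B4.
  apply Rle_trans with (2 * (k * X * (e' * L)) + 2 * (k * Y * (e' * L)))%R.
  - unfold J. revert B1 B2 B3 B4.
    generalize (P (Phi (A + s) t)) (P (Phi (A + s + k * X) t))
      (P (Phi (A + s) (t + k * Y))) (P (Phi (A + s + k * X) (t + k * Y))).
    generalize (CInt (fs t) (A + s) (A + s + k * X))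
      (CInt (ft (A + s + k * X)%R) t (t + k * Y))
      (CInt (fs (t + k * Y)%R) (A + s) (A + s + k * X))
      (CInt (ft (A + s)%R) t (t + k * Y)).
    intros K1 K2 K3 K4 p1 p2 p3 p4 B1 B2 B3 B4.
    replace (K1 + K2 - K3 - K4)
      with ((K1 - (p2 - p1)) + (K2 - (p4 - p2)) + - (K3 - (p4 - p3)) + - (K4 - (p3 - p1)))
      by ring.
    eapply Rle_trans; [apply Cmod_triangle|]. rewrite Cmod_opp.
    eapply Rle_trans; [apply Rplus_le_compat_r, Cmod_triangle|]. rewrite Cmod_opp.
    eapply Rle_trans; [apply Rplus_le_compat_r, Rplus_le_compat_r, Cmod_triangle|].
    lra.
  - replace (2 * (k * X * (e' * L)) + 2 * (k * Y * (e' * L)))%R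
      with (N * (e / (N + 1)) * k ^ 2)%R by (unfold e'; generalize (e / (N + 1))%R; intros r; unfold N; ring).
    apply Rmult_le_compat_r; [apply pow_le; lra|].
    apply Rle_trans with ((N + 1) * (e / (N + 1)))%R.
    + apply Rmult_le_compat_r; lra.
    + right; field; lra.
Qed.

Lemma homotopy_boundary_integral :
  CInt (fs 0) A (A + X) + CInt (ft (A + X)%R) 0 Y
  = CInt (fs Y) A (A + X) + CInt (ft A) 0 Y.
Proof.
  assert (H := subdivision_vanishing J X Y HX HY homotopy_boundary_additive
    homotopy_boundary_small).
  unfold J in H. rewrite !Rmult_1_l, !Rplus_0_r, !Rplus_0_l in H.
  apply Ceq_minus. rewrite <- H. ring.
Qed.
End Homotopy.

(** * Cauchy's integral formula *)

Lemma curve_derive_plus (p q : R -> C) (t : R) (a b : C) :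
  curve_derive p t a -> curve_derive q t b -> curve_derive (fun s => p s + q s) t (a + b).
Proof. exact (is_derive_plus (V := C_R_NormedModule) p q t a b). Qed.

Lemma curve_derive_scal (c : C) (p : R -> C) (t : R) (a : C) :
  curve_derive p t a -> curve_derive (fun s => c * p s) t (c * a).
Proof.
  intros H. apply (curve_derive_comp (fun z => c * z) p); [|exact H].
  eapply cderive_eq.
  - apply (cderive_mult (fun _ => c) (fun z => z)); [apply cderive_const|apply cderive_id].
  - ring.
Qed.

Lemma curve_derive_const (c : C) (t : R) : curve_derive (fun _ => c) t 0.
Proof. exact (is_derive_const (V := C_R_NormedModule) c t). Qed.

Lemma curve_derive_eq (p : R -> C) (t : R) (a b : C) :
  curve_derive p t a -> a = b -> curve_derive p t b.
Proof. now intros H <-. Qed.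

Lemma curve_derive_RtoC_comp (p : R -> R) (t a : R) :
  is_derive p t a -> curve_derive (fun s => RtoC (p s)) t (RtoC a).
Proof.
  intros [_ H]. split; [exact (is_linear_scal_l (K := R_AbsRing) (V := C_R_NormedModule) (RtoC a))|].
  intros t' Ht' e. generalize (H t' Ht' e). apply filter_imp. intros s Hs.
  rewrite <- Cmod_norm.
  change (minus (minus (RtoC (p s)) (RtoC (p t'))) (scal (minus s t') (RtoC a)))
    with (RtoC (p s) - RtoC (p t') - scal (s - t')%R (RtoC a)).
  rewrite scal_R_Cmult, <- RtoC_mult, <- !RtoC_minus, Cmod_R. exact Hs.
Qed.

Definition cis (t : R) : C := (cos t, sin t).

Lemma curve_derive_cis (t : R) : curve_derive cis t (Ci * cis t).
Proof.
  assert (E : forall s, RtoC (cos s) + Ci * RtoC (sin s) = cis s)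
    by (intros s; apply injective_projections; simpl; ring).
  apply (is_derive_ext (V := C_R_NormedModule) (fun s => RtoC (cos s) + Ci * RtoC (sin s)));
    [exact E|].
  eapply curve_derive_eq.
  - apply curve_derive_plus.
    + apply curve_derive_RtoC_comp. apply is_derive_cos.
    + apply curve_derive_scal, curve_derive_RtoC_comp. apply is_derive_sin.
  - apply injective_projections; simpl; ring.
Qed.

Lemma continuous_cis (t : R) : continuous cis t.
Proof. eapply curve_derive_continuous, curve_derive_cis. Qed.

Lemma Cmod_cis (t : R) : Cmod (cis t) = 1%R.
Proof.
  unfold Cmod, cis. simpl. rewrite !Rmult_1_r.
  replace (cos t * cos t + sin t * sin t)%R with 1%R; [apply sqrt_1|].
  generalize (sin2_cos2 t). unfold Rsqr. lra.
Qed.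

Lemma segment_increment_bound (f f' : C -> C) (z w : C) (M : R) :
  (forall s : R, 0 <= s <= 1 ->
     cderive f (z + s * (w - z)) (f' (z + s * (w - z))) /\
     continuous f' (z + s * (w - z)) /\ Cmod (f' (z + s * (w - z))) <= M) ->
  Cmod (f w - f z) <= M * Cmod (w - z).
Proof.
  intros H. set (p := fun s : R => z + (w - z) * s).
  assert (Hp : forall s, curve_derive p s (0 + (w - z) * 1)).
  { intros s. apply curve_derive_plus; [apply curve_derive_const|].
    apply curve_derive_scal, curve_derive_RtoC. }
  assert (Ep : forall s : R, p s = z + s * (w - z)) by (intros s; unfold p; ring).
  assert (H1 := curve_increment_bound (fun s => f (p s)) (fun s => f' (p s) * (0 + (w - z) * 1))
    0 1 (M * Cmod (w - z)) ltac:(lra)).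
  assert (H2 : Cmod (f (p 1) - f (p 0)) <= M * Cmod (w - z) * Rabs (1 - 0)).
  2: { replace (p 1) with w in H2 by (unfold p; ring).
       replace (p 0) with z in H2 by (unfold p; ring).
       now rewrite Rminus_0_r, Rabs_R1, Rmult_1_r in H2. }
  apply H1; try lra; intros t Ht; rewrite ?Ep; destruct (H t Ht) as [D1 [D2 D3]].
  - apply curve_derive_comp; [|apply Hp]. rewrite Ep. exact D1.
  - apply continuous_Cmult; [|apply continuous_const].
    apply (continuous_comp p f'); [|rewrite Ep; exact D2].
    eapply curve_derive_continuous, Hp.
  - replace (0 + (w - z) * 1) with (w - z) by ring. rewrite Cmod_mult.
    apply Rmult_le_compat_r; [apply Cmod_ge_0|exact D3].
Qed.

Definition circle (a : C) (r t : R) : C := a + r * cis t.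

(** The line element and the factor [1 / (2 pi i)] are left to the density [u]. Any continuous [u]
    gives a function differentiable in [b] inside the circle, and the derivative for [n = 1] is the
    case [n = 2]. *)
Definition Cauchy_transform (a : C) (r : R) (u : R -> C) (n : nat) (b : C) : C :=
  CInt (fun t => u t / (circle a r t - b) ^ n) 0 (2 * PI).

Section CauchyTransform.
Variables (a : C) (r : R).
Hypothesis Hr : 0 < r.

Lemma two_PI_pos : 0 <= 2 * PI.
Proof. generalize PI_RGT_0; lra. Qed.

Lemma curve_derive_circle (t : R) : curve_derive (circle a r) t (r * (Ci * cis t)).
Proof.
  eapply curve_derive_eq.
  - apply curve_derive_plus; [apply curve_derive_const|].
    apply curve_derive_scal, curve_derive_cis.
  - ring.
Qed.

Lemma continuous_circle (t : R) : continuous (circle a r) t.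
Proof. eapply curve_derive_continuous, curve_derive_circle. Qed.

Lemma circle_dist (t : R) (b : C) : r - Cmod (b - a) <= Cmod (circle a r t - b).
Proof.
  assert (H := Cmod_triangle (circle a r t - b) (b - a)).
  replace (circle a r t - b + (b - a)) with (r * cis t) in H by (unfold circle; ring).
  rewrite Cmod_mult, Cmod_R, Cmod_cis, Rabs_right in H by lra. lra.
Qed.

Lemma circle_dist_le (t : R) (b : C) : Cmod (circle a r t - b) <= r + Cmod (b - a).
Proof.
  replace (circle a r t - b) with (r * cis t + - (b - a)) by (unfold circle; ring).
  eapply Rle_trans; [apply Cmod_triangle|].
  rewrite Cmod_opp, Cmod_mult, Cmod_R, Cmod_cis, Rabs_right by lra. lra.
Qed.

Lemma circle_neq (t : R) (b : C) : Cmod (b - a) < r -> circle a r t - b <> 0.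
Proof. intros Hb. apply Cmod_gt_0. generalize (circle_dist t b). lra. Qed.

Lemma circle_minus_center (t : R) : circle a r t - a <> 0.
Proof.
  apply circle_neq. replace (a - a) with (RtoC 0) by ring. now rewrite Cmod_0.
Qed.

Lemma continuous_Cauchy_kernel (u : R -> C) n b t :
  (forall t, continuous u t) -> Cmod (b - a) < r ->
  continuous (fun t => u t / (circle a r t - b) ^ n) t.
Proof.
  intros Hu Hb. apply continuous_Cdiv; auto.
  - apply continuous_Cpow, continuous_Cminus; [apply continuous_circle|apply continuous_const].
  - now apply Cpow_nz, circle_neq.
Qed.

Lemma is_CInt_Cauchy_transform (u : R -> C) n b :
  (forall t, continuous u t) -> Cmod (b - a) < r ->
  is_CInt (fun t => u t / (circle a r t - b) ^ n) 0 (2 * PI) (Cauchy_transform a r u n b).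
Proof.
  intros Hu Hb. apply continuous_is_CInt; [apply two_PI_pos|].
  intros t _. now apply continuous_Cauchy_kernel.
Qed.

Lemma Cauchy_kernel_bounds (b : C) : Cmod (b - a) < r ->
  exists d : R, 0 < d /\ forall w t, Cmod (w - b) < d ->
    Cmod (w - a) < r /\ d <= Cmod (circle a r t - w).
Proof.
  intros Hb. exists ((r - Cmod (b - a)) / 2)%R. split; [lra|].
  intros w t Hw.
  assert (H : Cmod (w - a) <= Cmod (w - b) + Cmod (b - a)).
  { replace (w - a) with ((w - b) + (b - a)) by ring. apply Cmod_triangle. }
  split; [lra|]. eapply Rle_trans; [|apply circle_dist]. lra.
Qed.

(** With [c] on the circle, [1/(c-w) - 1/(c-z) - (w-z)/(c-z)^2 = (w-z)^2 / ((c-w)(c-z)^2)]. The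
    constant is explicit because a bound uniform in [z] is wanted later. *)
Lemma Cauchy_transform_quadratic_bound (u : R -> C) (M d : R) (z w : C) :
  (forall t, continuous u t) -> (forall t, 0 <= t <= 2 * PI -> Cmod (u t) <= M) -> 0 < d ->
  Cmod (z - a) + d <= r -> Cmod (w - a) + d <= r ->
  Cmod (Cauchy_transform a r u 1 w - Cauchy_transform a r u 1 z
    - (w - z) * Cauchy_transform a r u 2 z) <= (2 * PI - 0) * (M * / d ^ 3) * Cmod (w - z) ^ 2.
Proof.
  intros Hu HM Hd Hz Hw. rewrite Rmult_assoc.
  assert (Hz' : Cmod (z - a) < r) by lra. assert (Hw' : Cmod (w - a) < r) by lra.
  eapply is_CInt_bound; [apply two_PI_pos| |apply is_CInt_minus;
    [apply is_CInt_minus|apply is_CInt_scal]; apply is_CInt_Cauchy_transform; auto].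
  intros t Ht. cbv beta.
  assert (Bz := circle_dist t z). assert (Bw := circle_dist t w).
  assert (Nw := circle_neq t w Hw'). assert (Nz := circle_neq t z Hz').
  replace (u t / (circle a r t - w) ^ 1 - u t / (circle a r t - z) ^ 1
      - (w - z) * (u t / (circle a r t - z) ^ 2))
    with (u t * / ((circle a r t - w) * (circle a r t - z) ^ 2) * (w - z) ^ 2)
    by (simpl; field; auto).
  rewrite !Cmod_mult, Cmod_pow. apply Rmult_le_compat_r; [apply pow_le, Cmod_ge_0|].
  apply Rmult_le_compat; try apply Cmod_ge_0; auto.
  rewrite Cmod_inv by (apply Cmult_neq_0; auto; now apply Cpow_nz).
  apply Rinv_le_contravar; [now apply pow_lt|].
  rewrite Cmod_mult, Cmod_pow. replace (d ^ 3)%R with (d * d ^ 2)%R by ring.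
  apply Rmult_le_compat; try lra; [apply pow_le; lra|]. apply pow_incr; lra.
Qed.

Lemma Cauchy_transform_2_bound (u : R -> C) (M d : R) (z : C) :
  (forall t, continuous u t) -> (forall t, 0 <= t <= 2 * PI -> Cmod (u t) <= M) -> 0 < d ->
  Cmod (z - a) + d <= r ->
  Cmod (Cauchy_transform a r u 2 z) <= (2 * PI - 0) * (M * / d ^ 2).
Proof.
  intros Hu HM Hd Hz. assert (Hz' : Cmod (z - a) < r) by lra.
  eapply is_CInt_bound; [apply two_PI_pos| |apply is_CInt_Cauchy_transform; auto].
  intros t Ht. cbv beta. assert (Bz := circle_dist t z).
  assert (Nz := circle_neq t z Hz').
  unfold Cdiv. rewrite Cmod_mult. apply Rmult_le_compat; try apply Cmod_ge_0; auto.
  rewrite Cmod_inv, Cmod_pow by now apply Cpow_nz.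
  apply Rinv_le_contravar; [now apply pow_lt|]. apply pow_incr; lra.
Qed.

Lemma cderive_Cauchy_transform_1 (u : R -> C) b :
  (forall t, continuous u t) -> Cmod (b - a) < r ->
  cderive (Cauchy_transform a r u 1) b (Cauchy_transform a r u 2 b).
Proof.
  intros Hu Hb.
  destruct (continuous_bounded u 0 (2 * PI) two_PI_pos) as [M [HM Hbd]]; auto.
  set (d := ((r - Cmod (b - a)) / 2)%R). assert (Hd : 0 < d) by (unfold d; lra).
  apply cderive_of_quadratic_bound with ((2 * PI - 0) * (M * / d ^ 3))%R d; auto.
  intros w Hw. apply Cauchy_transform_quadratic_bound; auto; [unfold d; lra|].
  apply Rle_trans with (Cmod (w - b) + Cmod (b - a) + d)%R; [|unfold d in *; lra].
  apply Rplus_le_compat_r. replace (w - a) with ((w - b) + (b - a)) by ring. apply Cmod_triangle.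
Qed.

(** Through Cauchy's formula this makes the derivative of a holomorphic function holomorphic
    again. *)
Lemma ex_derive_Cauchy_transform_2 (u : R -> C) b :
  (forall t, continuous u t) -> Cmod (b - a) < r ->
  ex_derive (Cauchy_transform a r u 2) b.
Proof.
  intros Hu Hb. destruct (Cauchy_kernel_bounds b Hb) as [d [Hd Hk]].
  destruct (continuous_bounded u 0 (2 * PI) two_PI_pos) as [M [HM Hbd]]; auto.
  assert (Hbb : Cmod (b - b) < d)
    by (replace (b - b) with (RtoC 0) by ring; rewrite Cmod_0; auto).
  exists (CInt (fun t => 2 * u t / (circle a r t - b) ^ 3) 0 (2 * PI)).
  apply (cderive_CInt_param (fun w t => u t / (circle a r t - w) ^ 2)
    (* The remainder has numerator [(c - b) + 2 (c - w)], at most [6 r] because points of the disc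
       are within [2 r] of the circle, and five factors of modulus at least [d] in the
       denominator. *)
    (fun t => 2 * u t / (circle a r t - b) ^ 3) 0 (2 * PI) b (M * (6 * r * / d ^ 5))%R d);
    [apply two_PI_pos|auto| | |].
  - intros w t Hw _. apply continuous_Cauchy_kernel; auto. now apply (Hk w t).
  - intros t _. apply (continuous_Cauchy_kernel (fun t => 2 * u t)); auto.
    intros s. apply continuous_Cmult; auto. apply continuous_const.
  - intros w t Hw Ht. destruct (Hk w t Hw) as [Hw1 Hw2]. destruct (Hk b t Hbb) as [_ Hb2].
    assert (Nw := circle_neq t w Hw1). assert (Nb := circle_neq t b Hb).
    replace (u t / (circle a r t - w) ^ 2 - u t / (circle a r t - b) ^ 2
        - (w - b) * (2 * u t / (circle a r t - b) ^ 3))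
      with (u t * (((circle a r t - b) + 2 * (circle a r t - w))
        * / ((circle a r t - w) ^ 2 * (circle a r t - b) ^ 3)) * (w - b) ^ 2)
      by (simpl; field; auto).
    rewrite !Cmod_mult, Cmod_pow. apply Rmult_le_compat_r; [apply pow_le, Cmod_ge_0|].
    apply Rmult_le_compat; try apply Cmod_ge_0; auto.
    { apply Rmult_le_pos; apply Cmod_ge_0. }
    apply Rmult_le_compat; try apply Cmod_ge_0.
    + eapply Rle_trans; [apply Cmod_triangle|]. rewrite Cmod_mult, Cmod_R, Rabs_right by lra.
      generalize (circle_dist_le t b) (circle_dist_le t w). lra.
    + rewrite Cmod_inv by (apply Cmult_neq_0; now apply Cpow_nz).
      apply Rinv_le_contravar; [now apply pow_lt|].
      rewrite Cmod_mult, !Cmod_pow. replace (d ^ 5)%R with (d ^ 2 * d ^ 3)%R by ring.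
      apply Rmult_le_compat; try (apply pow_le; lra); apply pow_incr; lra.
Qed.

(** The derivative in [b] is the integral of [dz / (z - b)^2], which vanishes because [-1 / (z - b)]
    is a primitive on the closed circle. So [b] may be moved to the centre, where the integrand is
    the constant [Ci]. *)
Lemma winding_integral (b : C) : Cmod (b - a) < r ->
  Cauchy_transform a r (fun t => r * (Ci * cis t)) 1 b = 2 * PI * Ci.
Proof.
  intros Hb. set (u := fun t : R => r * (Ci * cis t)).
  assert (Hu : forall t, continuous u t).
  { intros t. apply continuous_Cmult; [apply continuous_const|].
    apply continuous_Cmult; [apply continuous_const|apply continuous_cis]. }
  assert (Haa : Cmod (a - a) < r)
    by (replace (a - a) with (RtoC 0) by ring; rewrite Cmod_0; auto).
  assert (H0 : forall w, Cmod (w - a) < r -> Cauchy_transform a r u 2 w = 0).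
  { intros w Hw. apply is_CInt_unique.
    assert (cis0 : cis (2 * PI) = cis 0)
      by (unfold cis; now rewrite cos_2PI, sin_2PI, cos_0, sin_0).
    replace (RtoC 0) with (- / (circle a r (2 * PI) - w) - - / (circle a r 0 - w))
      by (unfold circle; rewrite cis0; ring).
    apply (is_CInt_derive (fun t => - / (circle a r t - w))); [apply two_PI_pos| |].
    - intros t _. eapply curve_derive_eq.
      + apply (curve_derive_comp (fun z => - / (z - w)) (circle a r));
          [|apply curve_derive_circle].
        apply cderive_opp, (cderive_inv (fun z => z - w)); [|now apply circle_neq].
        apply (cderive_minus (fun z => z) (fun _ => w)); [apply cderive_id|apply cderive_const].
      + unfold u. simpl. field. now apply circle_neq.
    - intros t _. now apply continuous_Cauchy_kernel. }
  assert (E : Cauchy_transform a r u 1 b - Cauchy_transform a r u 1 a = 0).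
  { apply Cmod_eq_0, Rle_antisym; [|apply Cmod_ge_0].
    rewrite <- (Rmult_0_l (Cmod (b - a))).
    apply segment_increment_bound with (Cauchy_transform a r u 2).
    intros s Hs. assert (Hin : Cmod (a + s * (b - a) - a) < r).
    { replace (a + s * (b - a) - a) with (s * (b - a)) by ring.
      rewrite Cmod_mult, Cmod_R, Rabs_right by lra.
      apply Rle_lt_trans with (2 := Hb). rewrite <- (Rmult_1_l (Cmod (b - a))) at 2.
      apply Rmult_le_compat_r; [apply Cmod_ge_0|lra]. }
    split; [|split].
    - now apply cderive_Cauchy_transform_1.
    - now apply ex_cderive_continuous, ex_derive_Cauchy_transform_2.
    - rewrite H0, Cmod_0 by auto. lra. }
  apply Ceq_minus in E. rewrite E. clear E.
  apply is_CInt_unique.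
  apply (is_CInt_ext (fun _ => Ci)); [apply two_PI_pos| |].
  - intros t _. unfold u, circle. simpl. field.
    exact (circle_minus_center t).
  - replace (2 * PI * Ci) with (Ci * RtoC (2 * PI) - Ci * RtoC 0) by (rewrite RtoC_mult; ring).
    apply (is_CInt_derive (fun t => Ci * RtoC t)); [apply two_PI_pos| |].
    + intros t _. eapply curve_derive_eq; [apply curve_derive_scal, curve_derive_RtoC|ring].
    + intros t _. apply continuous_const.
Qed.

End CauchyTransform.

Lemma CInt_ext (p q : R -> C) (a b : R) :
  a <= b -> (forall t : R, a <= t <= b -> p t = q t) -> CInt p a b = CInt q a b.
Proof.
  intros Hab E. apply (RInt_ext (V := C_R_CompleteNormedModule)).
  intros t Ht. rewrite Rmin_left, Rmax_right in Ht by assumption. apply E. lra.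
Qed.

Definition holo_disc (f : C -> C) (a : C) (r : R) : Prop :=
  forall z : C, Cmod (z - a) < r -> ex_derive f z.

(** The factor [r * cis t / (2 * PI)] is [dz / (2 pi i)] on the circle, the two imaginary units
    having cancelled. *)
Definition Cauchy_density (f : C -> C) (a : C) (r t : R) : C :=
  f (circle a r t) * (r * cis t) / (2 * PI).

Section CauchyFormula.
Variables (f : C -> C) (a : C) (r R0 : R).
Hypotheses (Hr : 0 < r < R0) (Hf : holo_disc f a R0).

Lemma circle_inside (t : R) : Cmod (circle a r t - a) < R0.
Proof.
  replace (circle a r t - a) with (r * cis t) by (unfold circle; ring).
  rewrite Cmod_mult, Cmod_R, Cmod_cis, Rabs_right; lra.
Qed.

Lemma continuous_Cauchy_density (t : R) : continuous (Cauchy_density f a r) t.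
Proof.
  apply continuous_Cmult; [|apply continuous_const]. apply continuous_Cmult.
  - apply (continuous_comp (circle a r) f); [apply continuous_circle|].
    apply ex_cderive_continuous, Hf, circle_inside.
  - apply continuous_Cmult; [apply continuous_const|apply continuous_cis].
Qed.

Variable b : C.
Hypothesis Hb : Cmod (b - a) < r.
Let c (t : R) : C := circle a r t - b.
Let c' (t : R) : C := r * (Ci * cis t).

Lemma continuous_radial (t : R) : continuous c t.
Proof. apply continuous_Cminus; [apply continuous_circle|apply continuous_const]. Qed.

Lemma radial_neq_0 (t : R) : c t <> 0.
Proof. apply circle_neq; [lra|exact Hb]. Qed.

Lemma continuous_radial_derivative (t : R) : continuous c' t.
Proof.
  apply continuous_Cmult; [apply continuous_const|].
  apply continuous_Cmult; [apply continuous_const|apply continuous_cis].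
Qed.

Lemma segment_to_circle_inside (s t : R) : 0 <= s <= 1 -> Cmod (b + s * c t - a) < R0.
Proof.
  intros Hs.
  replace (b + s * c t - a) with (RtoC (1 - s) * (b - a) + s * (r * cis t))
    by (unfold c, circle; rewrite RtoC_minus; ring).
  eapply Rle_lt_trans; [apply Cmod_triangle|].
  rewrite !Cmod_mult, !Cmod_R, Cmod_cis, !Rabs_right by lra.
  assert ((1 - s) * Cmod (b - a) <= (1 - s) * r) by (apply Rmult_le_compat_l; lra). lra.
Qed.

(** Cauchy's theorem for [f w / (w - b)] with [s] running from [e] to 1, which keeps the image away
    from [b]. The sides [t = 0] and [t = 2 pi] coincide and cancel; on the other two the factor [s]
    drops out of [s * c' / (s * c)]. *)
Lemma shrinking_circle_integral (e : R) : 0 < e <= 1 ->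
  CInt (fun t => f (b + 1 * c t) * (c' t / c t)) 0 (2 * PI)
  = CInt (fun t => f (b + e * c t) * (c' t / c t)) 0 (2 * PI).
Proof.
  intros He.
  assert (H := homotopy_boundary_integral (fun w => f w / (w - b)) b c c' e (1 - e) (2 * PI)
    ltac:(lra) two_PI_pos).
  replace (e + (1 - e))%R with 1%R in H by ring.
  assert (Ecc : c (2 * PI) = c 0).
  { unfold c, circle, cis. now rewrite cos_2PI, sin_2PI, cos_0, sin_0. }
  rewrite Ecc in H.
  assert (Hint : forall s : R, 0 < s ->
    CInt (fun t => f (b + s * c t) / (b + s * c t - b) * (s * c' t)) 0 (2 * PI)
    = CInt (fun t => f (b + s * c t) * (c' t / c t)) 0 (2 * PI)).
  { intros s Hs. apply CInt_ext; [apply two_PI_pos|]. intros t _.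
    assert (N := radial_neq_0 t).
    assert (s <> 0 :> C) by (intro E; apply RtoC_inj in E; lra).
    replace (b + s * c t - b) with (s * c t) by ring. field. auto. }
  rewrite (Hint 1), (Hint e) in H by lra.
  match type of H with ?A -> ?B -> ?D -> _ =>
    assert (HA : A); [|assert (HB : B); [|assert (HD : D)]] end.
  - intros t. eapply curve_derive_eq.
    + apply (curve_derive_plus (circle a r) (fun _ => - b));
        [apply curve_derive_circle|apply curve_derive_const].
    + unfold c'. ring.
  - apply continuous_radial_derivative.
  - intros s t Hs _. destruct (Hf (b + s * c t)) as [l Hl].
    + apply segment_to_circle_inside. lra.
    + eexists. apply (cderive_div f (fun w => w - b)).
      * exact Hl.
      * apply (cderive_minus (fun w => w) (fun _ => b)); [apply cderive_id|apply cderive_const].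
      * replace (b + s * c t - b) with (s * c t) by ring.
        apply Cmult_neq_0; [intro E; apply RtoC_inj in E; lra|apply radial_neq_0].
  - specialize (H HA HB HD). revert H.
    generalize (CInt (fun t => f (b + 1 * c t) * (c' t / c t)) 0 (2 * PI))
      (CInt (fun t => f (b + e * c t) * (c' t / c t)) 0 (2 * PI)).
    intros K1 K2 H. apply Ceq_minus. apply Ceq_minus in H. rewrite <- H. ring.
Qed.

Lemma is_CInt_shrinking (e : R) : 0 <= e <= 1 ->
  is_CInt (fun t => f (b + e * c t) * (c' t / c t)) 0 (2 * PI)
    (CInt (fun t => f (b + e * c t) * (c' t / c t)) 0 (2 * PI)).
Proof.
  intros He. apply continuous_is_CInt; [apply two_PI_pos|]. intros t _.
  apply continuous_Cmult.
  - apply (continuous_comp (fun t => b + e * c t) f).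
    + apply continuous_Cplus; [apply continuous_const|].
      apply continuous_Cmult; [apply continuous_const|apply continuous_radial].
    + apply ex_cderive_continuous, Hf, segment_to_circle_inside, He.
  - apply continuous_Cdiv; [apply continuous_radial_derivative|apply continuous_radial|].
    apply radial_neq_0.
Qed.

(** The circle is shrunk until [f] is nearly [f b] on it; what remains is [f b] times the winding
    integral. *)
Lemma Cauchy_integral_raw :
  CInt (fun t => f (b + 1 * c t) * (c' t / c t)) 0 (2 * PI) = f b * (2 * PI * Ci).
Proof.
  apply Ceq_minus, Cmod_eq_0, Rle_antisym; [|apply Cmod_ge_0].
  apply le_epsilon. intros e He. rewrite Rplus_0_l.
  destruct (continuous_bounded (fun t => c' t / c t) 0 (2 * PI) two_PI_pos) as [M [HM Hbd]].
  { intros t _. apply continuous_Cdiv;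
      [apply continuous_radial_derivative|apply continuous_radial|apply radial_neq_0]. }
  destruct (continuous_bounded c 0 (2 * PI) two_PI_pos) as [L [HL HLb]].
  { intros t _. apply continuous_radial. }
  assert (Cf : continuous f b) by (apply ex_cderive_continuous, Hf; lra).
  rewrite continuous_CC_iff in Cf. assert (HPI := PI_RGT_0).
  destruct (Cf (e / (2 * PI * M))%R) as [d [Hd Hfd]].
  { apply Rdiv_lt_0_compat; auto. apply Rmult_lt_0_compat; lra. }
  (* The shrunken circle [b + x * c t] lies in the disc of radius [d] around [b], because [L] bounds
     [c]. *)
  set (x := Rmin 1 (d / (2 * L))).
  assert (Hx : 0 < x <= 1).
  { split; [|apply Rmin_l]. apply Rmin_pos; [lra|]. apply Rdiv_lt_0_compat; lra. }
  assert (HxL : x * L < d).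
  { apply Rle_lt_trans with (d / (2 * L) * L)%R.
    - apply Rmult_le_compat_r; [lra|apply Rmin_r].
    - replace (d / (2 * L) * L)%R with (d / 2)%R by (field; lra). lra. }
  rewrite (shrinking_circle_integral x Hx).
  assert (HW : is_CInt (fun t => c' t / c t) 0 (2 * PI) (2 * PI * Ci)).
  { rewrite <- (winding_integral a r ltac:(lra) b Hb).
    apply (is_CInt_ext (fun t => c' t / c t ^ 1)); [apply two_PI_pos| |].
    - intros t _. simpl. now rewrite Cmult_1_r.
    - apply is_CInt_Cauchy_transform; [lra| |exact Hb]. apply continuous_radial_derivative. }
  replace e with ((2 * PI - 0) * (e / (2 * PI * M) * M))%R by (field; lra).
  eapply is_CInt_bound; [apply two_PI_pos| |apply is_CInt_minus;
    [apply is_CInt_shrinking; lra|apply is_CInt_scal, HW]].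
  intros t Ht. cbv beta.
  replace (f (b + x * c t) * (c' t / c t) - f b * (c' t / c t))
    with ((f (b + x * c t) - f b) * (c' t / c t)) by ring.
  rewrite Cmod_mult. apply Rmult_le_compat; try apply Cmod_ge_0; [|now apply Hbd].
  left. apply Hfd. replace (b + x * c t - b) with (x * c t) by ring.
  rewrite Cmod_mult, Cmod_R, Rabs_right by lra.
  apply Rle_lt_trans with (2 := HxL). apply Rmult_le_compat_l; [lra|]. now apply HLb.
Qed.

Lemma Cauchy_integral_formula : f b = Cauchy_transform a r (Cauchy_density f a r) 1 b.
Proof.
  assert (HPI := PI_RGT_0).
  assert (NPI : RtoC PI <> 0) by (intro E; apply RtoC_inj in E; lra).
  symmetry. apply is_CInt_unique.
  replace (f b) with (/ (2 * PI * Ci) * (f b * (2 * PI * Ci))).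
  2: { field. auto using Ci_nz. }
  rewrite <- Cauchy_integral_raw.
  apply (is_CInt_ext (fun t => / (2 * PI * Ci) * (f (b + 1 * c t) * (c' t / c t))));
    [apply two_PI_pos| |].
  - intros t _. unfold Cauchy_density. assert (N := radial_neq_0 t).
    replace (b + 1 * c t) with (circle a r t) by (unfold c; ring).
    unfold c'. fold (c t). simpl. field.
    auto using Ci_nz.
  - apply is_CInt_scal, is_CInt_shrinking. lra.
Qed.
End CauchyFormula.

(** * Taylor expansion and removable singularities *)

Lemma ex_cderive_ext_loc (f g : C -> C) (z : C) :
  locally z (fun w => f w = g w) -> ex_derive f z -> ex_derive g z.
Proof. intros E [l H]. exists l. now apply (cderive_ext_loc f). Qed.

Lemma disc_open (a : C) (r : R) (z : C) :
  Cmod (z - a) < r -> locally z (fun w : C => Cmod (w - a) < r).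
Proof.
  intros Hz. apply locally_C_iff. exists (r - Cmod (z - a))%R. split; [lra|].
  intros w Hw. replace (w - a) with ((w - z) + (z - a)) by ring.
  eapply Rle_lt_trans; [apply Cmod_triangle|]. lra.
Qed.

Lemma Cmod_minus_diag (a : C) : Cmod (a - a) = 0%R.
Proof. replace (a - a) with (RtoC 0) by ring. apply Cmod_0. Qed.

Lemma locally_disc (a : C) (r : R) (P : C -> Prop) :
  0 < r -> (forall z : C, Cmod (z - a) < r -> P z) -> locally a P.
Proof. intros Hr H. apply locally_C_iff. exists r. auto. Qed.

Lemma holomorphic_at_iff (f : C -> C) (a : C) :
  holomorphic_at f a <-> exists r : R, 0 < r /\ holo_disc f a r.
Proof. apply locally_C_iff. Qed.

Lemma cderive_Cauchy_formula (f : C -> C) (a : C) (r R0 : R) (b : C) :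
  0 < r < R0 -> holo_disc f a R0 -> Cmod (b - a) < r ->
  cderive f b (Cauchy_transform a r (Cauchy_density f a r) 2 b).
Proof.
  intros Hr Hf Hb. apply cderive_ext_loc with (Cauchy_transform a r (Cauchy_density f a r) 1).
  - generalize (disc_open a r b Hb). apply filter_imp. intros w Hw. symmetry.
    now apply Cauchy_integral_formula with R0.
  - apply cderive_Cauchy_transform_1; [lra| |exact Hb].
    intros t. now apply continuous_Cauchy_density with R0.
Qed.

Lemma holo_disc_C_derive (f : C -> C) (a : C) (R0 : R) :
  holo_disc f a R0 -> holo_disc (C_derive f) a R0.
Proof.
  intros Hf b Hb. set (r := ((Cmod (b - a) + R0) / 2)%R).
  assert (Hba := Cmod_ge_0 (b - a)).
  assert (Hr : 0 < r < R0) by (unfold r; lra). assert (Hbr : Cmod (b - a) < r) by (unfold r; lra).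
  apply ex_cderive_ext_loc with (Cauchy_transform a r (Cauchy_density f a r) 2).
  - generalize (disc_open a r b Hbr). apply filter_imp. intros w Hw. symmetry.
    apply is_C_derive_unique. now apply (cderive_Cauchy_formula f a r R0).
  - apply ex_derive_Cauchy_transform_2; [lra| |exact Hbr].
    intros t. now apply continuous_Cauchy_density with R0.
Qed.

Lemma holomorphic_at_C_derive (f : C -> C) (a : C) :
  holomorphic_at f a -> holomorphic_at (C_derive f) a.
Proof.
  rewrite !holomorphic_at_iff. intros [r [Hr H]]. exists r. split; auto.
  now apply holo_disc_C_derive.
Qed.

(* The [N]-th Taylor quotient: [f z] minus the Taylor polynomial of degree
   [N - 1] at [a], divided by [(z - a) ^ N]. *)
Definition Taylor_quotient (f : C -> C) (a : C) (r : R) (N : nat) : C -> C :=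
  Cauchy_transform a r (fun t => Cauchy_density f a r t / (circle a r t - a) ^ N) 1.

Section Taylor.
Variables (f : C -> C) (a : C) (r R0 : R).
Hypotheses (Hr : 0 < r < R0) (Hf : holo_disc f a R0).

Lemma continuous_Taylor_density (N : nat) (t : R) :
  continuous (fun t => Cauchy_density f a r t / (circle a r t - a) ^ N) t.
Proof.
  apply continuous_Cauchy_kernel; [lra| |rewrite Cmod_minus_diag; lra].
  intros s. now apply continuous_Cauchy_density with R0.
Qed.

Lemma holo_disc_Taylor_quotient (N : nat) : holo_disc (Taylor_quotient f a r N) a r.
Proof.
  intros b Hb. eexists. apply cderive_Cauchy_transform_1; [lra| |exact Hb].
  apply continuous_Taylor_density.
Qed.

Lemma Taylor_quotient_0 (b : C) : Cmod (b - a) < r -> Taylor_quotient f a r 0 b = f b.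
Proof.
  intros Hb. rewrite (Cauchy_integral_formula f a r R0 Hr Hf b Hb).
  apply CInt_ext; [apply two_PI_pos|]. intros t _.
  assert (N := circle_neq a r ltac:(lra) t b Hb). simpl. field. auto.
Qed.

(** From [1/(c-b) = 1/(c-a) + (b-a)/((c-a)(c-b))] under the integral. The value at [a] is the [N]-th
    Taylor coefficient. *)
Lemma Taylor_quotient_S (N : nat) (b : C) : Cmod (b - a) < r ->
  Taylor_quotient f a r N b = Taylor_quotient f a r N a + (b - a) * Taylor_quotient f a r (S N) b.
Proof.
  intros Hb. assert (Ha : Cmod (a - a) < r) by (rewrite Cmod_minus_diag; lra).
  apply is_CInt_unique.
  assert (H := fun M z Hz => is_CInt_Cauchy_transform a r ltac:(lra)
    (fun t => Cauchy_density f a r t / (circle a r t - a) ^ M) 1 z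
    (continuous_Taylor_density M) Hz).
  eapply is_CInt_ext; [apply two_PI_pos| |apply is_CInt_plus;
    [exact (H N a Ha)|apply is_CInt_scal; exact (H (S N) b Hb)]].
  intros t _. cbv beta. assert (N1 := circle_neq a r ltac:(lra) t b Hb).
  assert (N2 := circle_neq a r ltac:(lra) t a Ha). simpl. field. auto using Cpow_nz.
Qed.

Lemma Taylor_expansion (N : nat) (b : C) : Cmod (b - a) < r ->
  (forall k, (k < N)%nat -> Taylor_quotient f a r k a = 0) ->
  f b = (b - a) ^ N * Taylor_quotient f a r N b.
Proof.
  intros Hb. induction N as [|N IH]; intros H0.
  - rewrite Taylor_quotient_0 by auto. simpl. ring.
  - rewrite IH by (intros; apply H0; lia).
    rewrite Taylor_quotient_S, H0 by (auto; lia). simpl. ring.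
Qed.

Lemma Taylor_quotient_bound (b : C) : Cmod (b - a) < r ->
  exists K : R, forall N, Cmod (Taylor_quotient f a r N b) <= K / r ^ N.
Proof.
  intros Hb. assert (Ha : Cmod (a - a) < r) by (rewrite Cmod_minus_diag; lra).
  destruct (continuous_bounded (fun t => Cauchy_density f a r t / (circle a r t - b) ^ 1)
    0 (2 * PI) two_PI_pos) as [M [HM Hbd]].
  { intros t _. apply continuous_Cauchy_kernel; [lra| |exact Hb].
    intros s. now apply continuous_Cauchy_density with R0. }
  exists ((2 * PI - 0) * M)%R. intros N. unfold Rdiv. rewrite Rmult_assoc.
  eapply is_CInt_bound; [apply two_PI_pos| |apply is_CInt_Cauchy_transform;
    [lra|apply continuous_Taylor_density|exact Hb]].
  intros t Ht. cbv beta. assert (N1 := circle_neq a r ltac:(lra) t b Hb).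
  assert (N2 := circle_neq a r ltac:(lra) t a Ha).
  replace (Cauchy_density f a r t / (circle a r t - a) ^ N / (circle a r t - b) ^ 1)
    with (Cauchy_density f a r t / (circle a r t - b) ^ 1 * / (circle a r t - a) ^ N)
    by (simpl; field; auto using Cpow_nz).
  rewrite Cmod_mult. apply Rmult_le_compat; try apply Cmod_ge_0; auto.
  rewrite Cmod_inv, Cmod_pow by now apply Cpow_nz.
  replace (circle a r t - a) with (r * cis t) by (unfold circle; ring).
  rewrite Cmod_mult, Cmod_R, Cmod_cis, Rabs_right, Rmult_1_r by lra. lra.
Qed.

(** For every [N] the value [f b] is [(b - a)^N] times the [N]-th quotient, at most a constant times
    [(|b - a| / r)^N], which tends to 0. *)
Lemma Taylor_all_zero (b : C) : Cmod (b - a) < r ->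
  (forall k, Taylor_quotient f a r k a = 0) -> f b = 0.
Proof.
  intros Hb H0. destruct (Taylor_quotient_bound b Hb) as [K HK].
  apply Cmod_eq_0, Rle_antisym; [|apply Cmod_ge_0].
  apply le_epsilon. intros e He. rewrite Rplus_0_l.
  set (q := (Cmod (b - a) / r)%R).
  assert (Hba := Cmod_ge_0 (b - a)).
  assert (Hq : 0 <= q < 1).
  { unfold q. split; [apply Rdiv_le_0_compat; lra|].
    apply Rmult_lt_reg_r with r; [lra|]. unfold Rdiv. rewrite Rmult_assoc, Rinv_l; lra. }
  destruct (pow_lt_1_zero q ltac:(rewrite Rabs_right; lra) (e / (Rabs K + 1))) as [n Hn].
  { apply Rdiv_lt_0_compat; auto. generalize (Rabs_pos K); lra. }
  specialize (Hn n (le_n _)). rewrite Rabs_right in Hn by (apply Rle_ge, pow_le; lra).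
  rewrite (Taylor_expansion n b Hb) by auto. rewrite Cmod_mult, Cmod_pow.
  apply Rle_trans with (Cmod (b - a) ^ n * (K / r ^ n))%R.
  { apply Rmult_le_compat_l; [apply pow_le; lra|apply HK]. }
  replace (Cmod (b - a) ^ n * (K / r ^ n))%R with (K * q ^ n)%R.
  2: { unfold q. unfold Rdiv. rewrite Rpow_mult_distr, pow_inv. ring. }
  assert (0 <= q ^ n) by (apply pow_le; lra).
  assert (HKp := Rabs_pos K). assert (HKl := Rle_abs K).
  apply Rle_trans with ((Rabs K + 1) * q ^ n)%R; [apply Rmult_le_compat_r; lra|].
  apply Rle_trans with ((Rabs K + 1) * (e / (Rabs K + 1)))%R.
  - apply Rmult_le_compat_l; lra.
  - right; field; lra.
Qed.
End Taylor.

(** [p] is the index of the first nonzero Taylor coefficient, 0 when [f a <> 0], and [phi] is the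
    Taylor quotient of that index. *)
Lemma zero_factorization (f : C -> C) (a : C) :
  holomorphic_at f a ->
  locally a (fun z => f z = 0) \/
  exists (p : nat) (phi : C -> C), holomorphic_at phi a /\ phi a <> 0 /\
    locally a (fun z => f z = (z - a) ^ p * phi z).
Proof.
  intros Hf. apply holomorphic_at_iff in Hf. destruct Hf as [R0 [HR Hf]].
  assert (Hr : 0 < R0 / 2 < R0) by lra.
  destruct (classic (forall k, Taylor_quotient f a (R0 / 2) k a = 0)) as [H|H].
  - left. apply locally_disc with (R0 / 2)%R; [lra|]. intros z Hz.
    now apply (Taylor_all_zero f a (R0 / 2) R0).
  - right. assert (H' : exists k, Taylor_quotient f a (R0 / 2) k a <> 0).
    { apply NNPP. intros Hn. apply H. intros k. apply NNPP. intros Hk. apply Hn. now exists k. }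
    destruct (Wf_nat.dec_inh_nat_subset_has_unique_least_element _
      (fun k => classic (Taylor_quotient f a (R0 / 2) k a <> 0)) H')
      as [p [[Hp Hmin] _]].
    exists p, (Taylor_quotient f a (R0 / 2) p). split; [|split; [exact Hp|]].
    + apply holomorphic_at_iff. exists (R0 / 2)%R. split; [lra|].
      now apply holo_disc_Taylor_quotient with R0.
    + apply locally_disc with (R0 / 2)%R; [lra|]. intros z Hz.
      apply (Taylor_expansion f a (R0 / 2) R0); auto.
      intros k Hk. apply NNPP. intros Hn. specialize (Hmin k Hn). lia.
Qed.

Lemma continuous_eq_of_punctured (f g : C -> C) (a : C) (r : R) :
  0 < r -> continuous f a -> continuous g a ->
  (forall z : C, Cmod (z - a) < r -> z <> a -> f z = g z) -> f a = g a.
Proof.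
  intros Hr Hf Hg E. apply Ceq_minus, Cmod_eq_0, Rle_antisym; [|apply Cmod_ge_0].
  apply le_epsilon. intros e He. rewrite Rplus_0_l.
  rewrite !continuous_CC_iff in *.
  destruct (Hf (e / 2)%R ltac:(lra)) as [d1 [Hd1 H1]].
  destruct (Hg (e / 2)%R ltac:(lra)) as [d2 [Hd2 H2]].
  set (d := (Rmin r (Rmin d1 d2) / 2)%R).
  assert (Hd : 0 < d) by (unfold d; apply Rdiv_lt_0_compat; [repeat apply Rmin_pos|]; lra).
  assert (Hdr : d < r /\ d < d1 /\ d < d2).
  { unfold d in *. generalize (Rmin_l r (Rmin d1 d2)) (Rmin_r r (Rmin d1 d2))
      (Rmin_l d1 d2) (Rmin_r d1 d2). lra. }
  set (z := a + d).
  assert (Hz : Cmod (z - a) = d).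
  { unfold z. replace (a + d - a) with (RtoC d) by ring. rewrite Cmod_R, Rabs_right; lra. }
  assert (Nz : z <> a) by (intro Ez; rewrite Ez, Cmod_minus_diag in Hz; lra).
  replace (f a - g a) with (- (f z - f a) + (g z - g a)) by (rewrite (E z ltac:(lra) Nz); ring).
  eapply Rle_trans; [apply Cmod_triangle|]. rewrite Cmod_opp.
  generalize (H1 z ltac:(lra)) (H2 z ltac:(lra)). lra.
Qed.

(* [(z - a) ^ 2 * f z] is differentiable at [a] with derivative [0]; dividing
   it twice by [z - a] recovers [f]. *)
Lemma removable_singularity (f : C -> C) (a : C) (R0 : R) :
  0 < R0 -> continuous f a ->
  (forall z : C, Cmod (z - a) < R0 -> z <> a -> ex_derive f z) -> ex_derive f a.
Proof.
  intros HR Cf Hf. set (h := fun z => (z - a) ^ 2 * f z).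
  assert (Dsub : forall z, cderive (fun z => z - a) z (1 - 0)).
  { intros z. apply (cderive_minus (fun z => z) (fun _ => a));
      [apply cderive_id|apply cderive_const]. }
  assert (Csub : forall z, continuous (fun z : C => z - a) z).
  { intros z. eapply cderive_continuous, Dsub. }
  assert (Hh : holo_disc h a R0).
  { intros z Hz. destruct (Ceq_dec z a) as [->|n].
    - exists (RtoC 0). apply cderive_iff. exists (fun w => (w - a) * f w). split; [|split].
      + apply continuous_Cmult; auto.
      + ring.
      + intros w. unfold h. ring.
    - destruct (Hf z Hz n) as [l Hl]. eexists. unfold h.
      apply (cderive_mult (fun z => (z - a) ^ 2) f); [|exact Hl].
      apply (cderive_pow (fun z => z - a)), Dsub. }
  set (r := (R0 / 2)%R). assert (Hr : 0 < r < R0) by (unfold r; lra).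
  set (q := Taylor_quotient h a r).
  assert (Haa : Cmod (a - a) < r) by (rewrite Cmod_minus_diag; lra).
  assert (Cq : forall N, continuous (q N) a).
  { intros N. apply ex_cderive_continuous, (holo_disc_Taylor_quotient h a r R0); auto. }
  assert (q0 : q 0%nat a = 0).
  { unfold q. rewrite (Taylor_quotient_0 h a r R0) by auto. unfold h. ring. }
  assert (E1 : forall z, Cmod (z - a) < r -> h z = (z - a) * q 1%nat z).
  { intros z Hz. rewrite (Taylor_expansion h a r R0 Hr Hh 1 z Hz); [unfold q; simpl; ring|].
    intros k Hk. replace k with 0%nat by lia. exact q0. }
  (* Away from [a] the first quotient is [(z - a) * f z], which tends to 0 because [f] is continuous
     at [a]. *)
  assert (q1 : q 1%nat a = 0).
  { replace (RtoC 0) with ((a - a) * f a) by ring.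
    apply (continuous_eq_of_punctured (q 1%nat) (fun z => (z - a) * f z) a r); auto; [lra| |].
    - apply continuous_Cmult; auto.
    - intros z Hz n. specialize (E1 z Hz). unfold h in E1.
      assert (n' : z - a <> 0) by (intro E; apply n, Ceq_minus, E).
      replace (q 1%nat z) with (/ (z - a) * ((z - a) * q 1%nat z)) by (field; auto).
      rewrite <- E1. simpl. field; auto. }
  assert (E2 : forall z, Cmod (z - a) < r -> h z = (z - a) ^ 2 * q 2%nat z).
  { intros z Hz. apply (Taylor_expansion h a r R0 Hr Hh 2 z Hz).
    intros k Hk. assert (k = 0%nat \/ k = 1%nat) as [-> | ->] by lia; assumption. }
  assert (E3 : forall z, Cmod (z - a) < r -> z <> a -> q 2%nat z = f z).
  { intros z Hz n. specialize (E2 z Hz). unfold h in E2.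
    assert (n' : z - a <> 0) by (intro E; apply n, Ceq_minus, E).
    replace (q 2%nat z) with (/ (z - a) ^ 2 * ((z - a) ^ 2 * q 2%nat z)) by (field; auto).
    rewrite <- E2. field; auto. }
  apply ex_cderive_ext_loc with (q 2%nat).
  - apply locally_disc with r; [lra|]. intros z Hz. destruct (Ceq_dec z a) as [->|n]; auto.
    apply (continuous_eq_of_punctured (q 2%nat) f a r); auto; lra.
  - apply (holo_disc_Taylor_quotient h a r R0); auto.
Qed.

(** * Primitives, exponential and logarithms *)

Definition entire (f : C -> C) : Prop := forall z : C, ex_derive f z.

Lemma entire_holo_disc (f : C -> C) (a : C) (r : R) : entire f -> holo_disc f a r.
Proof. intros H z _. apply H. Qed.

Section ExDeriveRules.
Variables (f g : C -> C) (z : C).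

Lemma ex_cderive_const (c : C) : ex_derive (fun _ : C => c) z.
Proof. eexists. apply cderive_const. Qed.

Lemma ex_cderive_id : ex_derive (fun w : C => w) z.
Proof. eexists. apply cderive_id. Qed.

Lemma ex_cderive_plus : ex_derive f z -> ex_derive g z -> ex_derive (fun w : C => f w + g w) z.
Proof. intros [l H] [m K]. eexists. apply cderive_plus; eassumption. Qed.

Lemma ex_cderive_minus : ex_derive f z -> ex_derive g z -> ex_derive (fun w : C => f w - g w) z.
Proof. intros [l H] [m K]. eexists. apply cderive_minus; eassumption. Qed.

Lemma ex_cderive_mult : ex_derive f z -> ex_derive g z -> ex_derive (fun w : C => f w * g w) z.
Proof. intros [l H] [m K]. eexists. apply cderive_mult; eassumption. Qed.

Lemma ex_cderive_inv : ex_derive f z -> f z <> 0 -> ex_derive (fun w : C => / f w) z.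
Proof. intros [l H] K. eexists. apply cderive_inv; eassumption. Qed.

Lemma ex_cderive_div :
  ex_derive f z -> ex_derive g z -> g z <> 0 -> ex_derive (fun w : C => f w / g w) z.
Proof. intros [l H] [m K] N. eexists. apply cderive_div; eassumption. Qed.

Lemma ex_cderive_pow (n : nat) : ex_derive f z -> ex_derive (fun w : C => f w ^ n) z.
Proof. intros [l H]. eexists. apply cderive_pow; eassumption. Qed.

Lemma ex_cderive_comp :
  ex_derive f (g z) -> ex_derive g z -> ex_derive (fun w : C => f (g w)) z.
Proof. intros [l H] [m K]. eexists. apply cderive_comp; eassumption. Qed.
End ExDeriveRules.

Lemma cderive_zero_constant (f : C -> C) : (forall z, cderive f z 0) -> forall z w, f z = f w.
Proof.
  intros H z w. apply Ceq_minus, Cmod_eq_0, Rle_antisym; [|apply Cmod_ge_0].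
  rewrite <- (Rmult_0_l (Cmod (z - w))).
  apply segment_increment_bound with (fun _ => RtoC 0). intros s _.
  rewrite Cmod_0. split; [apply H|]. split; [apply continuous_const|lra].
Qed.

Lemma entire_C_derive (f : C -> C) : entire f -> entire (C_derive f).
Proof.
  intros H z. apply (holo_disc_C_derive f z 1); [now apply entire_holo_disc|].
  rewrite Cmod_minus_diag. lra.
Qed.

(** Cauchy's formula on the circle of radius [rho + 1], at distance at least 1 from all points
    concerned; hence the powers of 1. The uniformity serves to differentiate under the integral in
    [entire_primitive]. *)
Lemma entire_uniform_bounds (f : C -> C) (rho : R) : entire f -> 0 < rho ->
  exists K : R, 0 < K /\ forall z w : C, Cmod z <= rho -> Cmod w <= rho ->
    Cmod (C_derive f z) <= K /\
    Cmod (f w - f z - (w - z) * C_derive f z) <= K * Cmod (w - z) ^ 2.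
Proof.
  intros Hf Hrho. set (r := (rho + 1)%R). assert (Hr : 0 < r < r + 1) by (unfold r; lra).
  assert (Hd := entire_holo_disc f 0 (r + 1) Hf).
  set (u := Cauchy_density f 0 r).
  assert (Hu : forall t, continuous u t) by (intros t; now apply continuous_Cauchy_density with (r + 1)%R).
  destruct (continuous_bounded u 0 (2 * PI) two_PI_pos) as [M [HM Hbd]]; auto.
  exists ((2 * PI - 0) * (M * / 1 ^ 3))%R. assert (HPI := PI_RGT_0). split.
  { rewrite pow1, Rinv_1. apply Rmult_lt_0_compat; lra. }
  intros z w Hz Hw.
  assert (E0 : forall x : C, Cmod (x - 0) = Cmod x)
    by (intros x; f_equal; ring).
  assert (Hz' : Cmod (z - 0) + 1 <= r) by (rewrite E0; unfold r; lra).
  assert (Hw' : Cmod (w - 0) + 1 <= r) by (rewrite E0; unfold r; lra).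
  rewrite (is_C_derive_unique f z (Cauchy_transform 0 r u 2 z)).
  2: { apply (cderive_Cauchy_formula f 0 r (r + 1)); auto. lra. }
  split.
  - replace (1 ^ 3)%R with (1 ^ 2)%R by ring.
    apply Cauchy_transform_2_bound; auto; lra.
  - rewrite (Cauchy_integral_formula f 0 r (r + 1) Hr Hd w),
      (Cauchy_integral_formula f 0 r (r + 1) Hr Hd z) by lra.
    apply Cauchy_transform_quadratic_bound; auto; lra.
Qed.

(** The primitive is the integral of [f] along the segment from 0 to [w]. Its integrand has the
    [w]-derivative [q s], which is also the [s]-derivative of [s * f (s * z)] and so integrates to
    [f z]. *)
Lemma entire_primitive (f : C -> C) : entire f ->
  exists F : C -> C, F 0 = 0 /\ forall z, cderive F z (f z).
Proof.
  intros Hf. assert (Hf' := entire_C_derive f Hf).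
  set (H := fun (w : C) (s : R) => f (s * w) * w).
  exists (fun w => CInt (H w) 0 1). split.
  { apply is_CInt_unique. apply (is_CInt_ext (fun _ => RtoC 0)); [lra| |].
    - intros; unfold H; ring.
    - apply (is_CInt_eq (fun _ => RtoC 0) 0 1 (RtoC 0 - RtoC 0)); [|ring].
      apply (is_CInt_derive (fun _ => RtoC 0)); [lra| |]; intros.
      + apply curve_derive_const.
      + apply continuous_const. }
  intros z. set (q := fun s : R => f (s * z) + s * z * C_derive f (s * z)).
  assert (Hline : forall (w : C) (s : R), curve_derive (fun s : R => s * w) s w).
  { intros w s. eapply curve_derive_eq.
    - apply (curve_derive_comp (fun x => x * w) RtoC); [|apply curve_derive_RtoC].
      apply (cderive_mult (fun x => x) (fun _ => w)); [apply cderive_id|apply cderive_const].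
    - ring. }
  assert (Cline : forall (w : C) (s : R), continuous (fun s : R => s * w) s)
    by (intros; eapply curve_derive_continuous, Hline).
  assert (Cf : forall (w : C) (s : R), continuous (fun s : R => f (s * w)) s).
  { intros w s. apply (continuous_comp (fun s : R => s * w) f); [apply Cline|].
    apply ex_cderive_continuous, Hf. }
  assert (Cq : forall s : R, continuous q s).
  { intros s. apply continuous_Cplus; [apply Cf|]. apply continuous_Cmult; [apply Cline|].
    apply (continuous_comp (fun s : R => s * z) (C_derive f)); [apply Cline|].
    apply ex_cderive_continuous, Hf'. }
  assert (Eq : CInt q 0 1 = f z).
  { apply is_CInt_unique.
    apply (is_CInt_eq q 0 1 (RtoC 1 * f (RtoC 1 * z) - RtoC 0 * f (RtoC 0 * z))).
    2: { rewrite (Cmult_1_l z). ring. }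
    apply (is_CInt_derive (fun s : R => s * f (s * z))); [lra| |auto].
    intros s _. apply curve_derive_iff.
    assert (D1 : curve_derive (fun s : R => f (s * z)) s (C_derive f (s * z) * z)).
    { apply (curve_derive_comp f (fun s : R => s * z)); [apply C_derive_ok, Hf|apply Hline]. }
    apply curve_derive_iff in D1. destruct D1 as [Q [HQ [EQ E]]].
    exists (fun t : R => f (t * z) + s * Q t). split; [|split].
    - apply continuous_Cplus; [apply Cf|]. apply continuous_Cmult; [apply continuous_const|auto].
    - rewrite EQ. unfold q. ring.
    - intros t. rewrite (E t). rewrite RtoC_minus. ring. }
  rewrite <- Eq.
  destruct (entire_uniform_bounds f (Cmod z + 1) Hf) as [K [HK HB]].
  { generalize (Cmod_ge_0 z); lra. }
  set (rho := (Cmod z + 1)%R) in *.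
  (* The remainder is [z * D] plus [w - z] times two terms, each of modulus at most
     [K * Cmod (w - z)]. Radius 1 keeps [w] in the disc [rho] and makes [x ^ 2 <= x]. *)
  apply (cderive_CInt_param H q 0 1 z (Cmod z * K + (K + K))%R 1); [lra|lra| | |].
  - intros w t _ _. apply continuous_Cmult; [apply Cf|apply continuous_const].
  - auto.
  - intros w t Hw Ht.
    assert (Hx : Cmod (t * z) <= rho /\ Cmod (t * w) <= rho).
    { rewrite !Cmod_mult, Cmod_R, Rabs_right by lra.
      assert (Hw' : Cmod w <= rho).
      { unfold rho. replace w with (z + (w - z)) by ring.
        eapply Rle_trans; [apply Cmod_triangle|]. lra. }
      assert (Hz' : Cmod z <= rho) by (unfold rho; lra).
      assert (H0 := Cmod_ge_0 z). assert (H1 := Cmod_ge_0 w).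
      split; [apply Rle_trans with (1 * Cmod z)%R|apply Rle_trans with (1 * Cmod w)%R];
        try lra; apply Rmult_le_compat_r; lra. }
    destruct (HB (t * z) (t * w) (proj1 Hx) (proj2 Hx)) as [B1 B2].
    set (D := f (t * w) - f (t * z) - (t * w - t * z) * C_derive f (t * z)) in *.
    replace (H w t - H z t - (w - z) * q t)
      with (z * D + (w - z) * (D + t * (w - z) * C_derive f (t * z)))
      by (unfold H, q, D; ring).
    assert (Ew : Cmod (t * w - t * z) <= Cmod (w - z)).
    { replace (t * w - t * z) with (t * (w - z)) by ring.
      rewrite Cmod_mult, Cmod_R, Rabs_right by lra.
      rewrite <- (Rmult_1_l (Cmod (w - z))) at 2.
      apply Rmult_le_compat_r; [apply Cmod_ge_0|lra]. }
    set (x := Cmod (w - z)) in *. assert (Hx0 : 0 <= x) by apply Cmod_ge_0.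
    assert (HD : Cmod D <= K * x ^ 2).
    { eapply Rle_trans; [apply B2|]. apply Rmult_le_compat_l; [lra|].
      apply pow_incr. split; [apply Cmod_ge_0|auto]. }
    assert (Hx2 : x ^ 2 <= x).
    { replace (x ^ 2)%R with (x * x)%R by ring. rewrite <- (Rmult_1_r x) at 3.
      apply Rmult_le_compat_l; lra. }
    eapply Rle_trans; [apply Cmod_triangle|]. rewrite !Cmod_mult. fold x.
    assert (H3 : Cmod (D + t * (w - z) * C_derive f (t * z)) <= K * x + x * K).
    { eapply Rle_trans; [apply Cmod_triangle|]. apply Rplus_le_compat.
      - eapply Rle_trans; [apply HD|]. apply Rmult_le_compat_l; lra.
      - rewrite Cmod_mult. replace (t * (w - z)) with (t * w - t * z) by ring.
        apply Rmult_le_compat; auto; apply Cmod_ge_0. }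
    assert (H4 : Cmod z * Cmod D <= Cmod z * (K * x ^ 2))
      by (apply Rmult_le_compat_l; [apply Cmod_ge_0|auto]).
    assert (H5 : x * Cmod (D + t * (w - z) * C_derive f (t * z)) <= x * (K * x + x * K))
      by (apply Rmult_le_compat_l; auto).
    replace ((Cmod z * K + (K + K)) * x ^ 2)%R
      with (Cmod z * (K * x ^ 2) + x * (K * x + x * K))%R by ring. lra.
Qed.

(** * The complex exponential and logarithms of zero-free functions *)

Definition cexp (z : C) : C := exp (Re z) * cis (Im z).

Lemma cis_plus (s t : R) : cis (s + t) = cis s * cis t.
Proof.
  unfold cis. rewrite cos_plus, sin_plus. apply injective_projections; simpl; ring.
Qed.

Lemma cexp_plus (z w : C) : cexp (z + w) = cexp z * cexp w.
Proof.
  unfold cexp. rewrite re_plus, im_plus, exp_plus, cis_plus, RtoC_mult. ring.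
Qed.

Lemma cexp_0 : cexp 0 = 1.
Proof.
  unfold cexp, cis. simpl. rewrite exp_0, cos_0, sin_0.
  apply injective_projections; simpl; ring.
Qed.

Lemma cexp_opp_l (z : C) : cexp (- z) * cexp z = 1.
Proof. rewrite <- cexp_plus. replace (- z + z) with (RtoC 0) by ring. apply cexp_0. Qed.

Lemma cexp_neq_0 (z : C) : cexp z <> 0.
Proof.
  intros E. assert (H := cexp_opp_l z). rewrite E, Cmult_0_r in H.
  apply RtoC_inj in H. lra.
Qed.

Lemma cexp_opp (z : C) : cexp (- z) = / cexp z.
Proof.
  assert (N := cexp_neq_0 z).
  replace (cexp (- z)) with (cexp (- z) * cexp z * / cexp z) by (field; auto).
  rewrite cexp_opp_l. ring.
Qed.

(** The inequality [1 + x <= exp x], used for [x] and for [- x], encloses [exp x] between [1 + x]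
    and [1 / (1 - x)]. *)
Lemma exp_quadratic_bound (x : R) : Rabs x <= / 2 -> Rabs (exp x - 1 - x) <= 2 * x ^ 2.
Proof.
  intros Hx. apply Rabs_le_between in Hx.
  assert (H1 := exp_ineq1_le x). assert (H2 := exp_ineq1_le (- x)).
  rewrite exp_Ropp in H2. assert (H3 := exp_pos x).
  assert (H4 : (1 - x) * exp x <= 1).
  { apply Rle_trans with (/ exp x * exp x)%R.
    - apply Rmult_le_compat_r; lra.
    - right. field. lra. }
  rewrite Rabs_right by lra. nra.
Qed.

Lemma cis_increment_bound (y : R) : Cmod (cis y - 1) <= Rabs y.
Proof.
  replace (RtoC 1) with (cis 0)
    by (unfold cis; rewrite cos_0, sin_0; reflexivity).
  rewrite <- (Rmult_1_l (Rabs y)). rewrite <- (Rminus_0_r y) at 2.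
  assert (Hy := Rabs_pos y). assert (Hy' := Rabs_le_between y (Rabs y)).
  apply (curve_increment_bound cis (fun t => Ci * cis t) (- Rabs y) (Rabs y)); try lra.
  - intros t _. apply curve_derive_cis.
  - intros t _. apply continuous_Cmult; [apply continuous_const|apply continuous_cis].
  - intros t _. rewrite Cmod_mult, Cmod_Ci, Cmod_cis. lra.
Qed.

Lemma cis_quadratic_bound (y : R) : Cmod (cis y - 1 - Ci * y) <= y ^ 2.
Proof.
  rewrite <- (pow2_abs y).
  assert (Hy := Rabs_pos y). assert (Hy' := Rabs_le_between y (Rabs y)).
  set (p := fun t : R => cis t + (- RtoC 1 + (- Ci) * t)).
  assert (E : cis y - 1 - Ci * y = p y - p 0%R).
  { unfold p. replace (cis 0) with (RtoC 1)
      by (unfold cis; rewrite cos_0, sin_0; reflexivity). ring. }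
  rewrite E. replace (Rabs y ^ 2)%R with (Rabs y * Rabs (y - 0))%R
    by (rewrite Rminus_0_r; ring).
  apply (curve_increment_bound p (fun t => Ci * (cis t - 1)) (- Rabs y) (Rabs y)); try lra.
  - intros t _. eapply curve_derive_eq.
    + apply curve_derive_plus; [apply curve_derive_cis|].
      apply curve_derive_plus; [apply curve_derive_const|].
      apply curve_derive_scal, curve_derive_RtoC.
    + ring.
  - intros t _. apply continuous_Cmult; [apply continuous_const|].
    apply continuous_Cminus; [apply continuous_cis|apply continuous_const].
  - intros t Ht. rewrite Cmod_mult, Cmod_Ci, Rmult_1_l.
    eapply Rle_trans; [apply cis_increment_bound|]. apply Rabs_le. lra.
Qed.

Lemma cderive_cexp_0 : cderive cexp 0 1.
Proof.
  (* 5 = 2 + 2 + 1, one summand for each of the three terms of the decomposition below; the radius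
     is that of [exp_quadratic_bound]. *)
  apply cderive_of_quadratic_bound with 5%R (/ 2)%R; [lra|].
  intros w Hw. replace (w - 0) with w in * by ring. rewrite cexp_0.
  assert (Hre := re_le_Cmod w). assert (Him := im_le_Cmod w).
  set (x := Re w) in *. set (y := Im w) in *. set (r := Cmod w) in *.
  assert (Hr : 0 <= r) by apply Cmod_ge_0.
  assert (Ew : w = x + Ci * y)
    by (unfold x, y; destruct w; apply injective_projections; simpl; ring).
  unfold cexp. fold x y.
  replace (exp x * cis y - 1 - w * 1)
    with (RtoC (exp x - 1 - x) * cis y + (RtoC (1 + x) * (cis y - 1 - Ci * y) + x * (Ci * y)))
    by (rewrite !RtoC_minus, RtoC_plus, Ew; ring).
  eapply Rle_trans; [apply Cmod_triangle|].
  eapply Rle_trans; [apply Rplus_le_compat_l, Cmod_triangle|].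
  rewrite !Cmod_mult, !Cmod_R, Cmod_cis, Cmod_Ci.
  assert (B1 := exp_quadratic_bound x ltac:(lra)).
  assert (B2 := cis_quadratic_bound y).
  assert (Hx2 : x ^ 2 <= r ^ 2).
  { rewrite <- (pow2_abs x). apply pow_incr. split; [apply Rabs_pos|auto]. }
  assert (Hy2 : y ^ 2 <= r ^ 2).
  { rewrite <- (pow2_abs y). apply pow_incr. split; [apply Rabs_pos|auto]. }
  assert (B3 : Rabs (1 + x) * Cmod (cis y - 1 - Ci * y) <= 2 * r ^ 2).
  { apply Rmult_le_compat; [apply Rabs_pos|apply Cmod_ge_0| |lra].
    eapply Rle_trans; [apply Rabs_triang|]. rewrite Rabs_R1. lra. }
  assert (B4 : Rabs x * (1 * Rabs y) <= r ^ 2).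
  { rewrite Rmult_1_l. replace (r ^ 2)%R with (r * r)%R by ring.
    apply Rmult_le_compat; auto; apply Rabs_pos. }
  lra.
Qed.

Lemma cderive_cexp (z : C) : cderive cexp z (cexp z).
Proof.
  apply (cderive_ext (fun w => cexp z * cexp (w - z))).
  { intros w. rewrite <- cexp_plus. f_equal. ring. }
  eapply cderive_eq.
  - apply (cderive_mult (fun _ => cexp z) (fun w => cexp (w - z))); [apply cderive_const|].
    apply (cderive_comp cexp (fun w => w - z) z 1 (1 - 0)).
    + replace (z - z) with (RtoC 0) by ring. apply cderive_cexp_0.
    + apply (cderive_minus (fun w => w) (fun _ => z)); [apply cderive_id|apply cderive_const].
  - ring.
Qed.

Lemma entire_cexp : entire cexp.
Proof. intros z. eexists. apply cderive_cexp. Qed.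

Lemma cexp_surjective (c : C) : c <> 0 -> exists z, cexp z = c.
Proof.
  intros Hc. apply Cmod_gt_0 in Hc. set (r := Cmod c) in *.
  destruct c as [x y].
  assert (Hr2 : (x ^ 2 + y ^ 2 = r ^ 2)%R).
  { unfold r, Cmod. simpl fst. simpl snd. rewrite pow2_sqrt; [reflexivity|].
    generalize (pow2_ge_0 x) (pow2_ge_0 y). lra. }
  set (u := (x / r)%R). set (v := (y / r)%R).
  assert (Huv : (u ^ 2 + v ^ 2 = 1)%R).
  { unfold u, v. replace ((x / r) ^ 2 + (y / r) ^ 2)%R with ((x ^ 2 + y ^ 2) / r ^ 2)%R
      by (field; lra). rewrite Hr2. field. lra. }
  assert (Hu : -1 <= u <= 1) by nra.
  assert (Ht : exists t : R, cos t = u /\ sin t = v).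
  { assert (Es : sin (acos u) = Rabs v).
    { rewrite sin_acos by auto. replace (1 - Rsqr u)%R with (Rsqr v) by (unfold Rsqr; lra).
      apply sqrt_Rsqr_abs. }
    destruct (Rle_lt_dec 0 v).
    - exists (acos u). rewrite Es, cos_acos by auto. split; auto. apply Rabs_pos_eq; auto.
    - exists (- acos u)%R. rewrite cos_neg, sin_neg, Es, cos_acos, Rabs_left by auto.
      split; auto. ring. }
  destruct Ht as [t [Hcos Hsin]].
  exists (ln r, t). unfold cexp, cis. simpl Re. simpl Im. rewrite exp_ln, Hcos, Hsin by auto.
  unfold u, v. apply injective_projections; simpl; field; lra.
Qed.

(** A primitive [L0] of [f' / f] makes [f * cexp (- L0)] constant; adding a logarithm [l] of [f 0]
    adjusts the constant. *)
Lemma entire_log (f : C -> C) : entire f -> (forall z, f z <> 0) ->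
  exists L, entire L /\ forall z, f z = cexp (L z).
Proof.
  intros Hf Hn.
  destruct (entire_primitive (fun z => C_derive f z / f z)) as [L0 [HL0 HL]].
  { intros z. apply ex_cderive_div; auto. now apply entire_C_derive. }
  destruct (cexp_surjective (f 0) (Hn 0)) as [l Hl].
  exists (fun z => L0 z + l). split.
  { intros z. apply ex_cderive_plus; [eexists; apply HL|apply ex_cderive_const]. }
  intros z.
  assert (E : f z * cexp (- L0 z) = f 0 * cexp (- L0 0)).
  { apply (cderive_zero_constant (fun z => f z * cexp (- L0 z))).
    intros w. eapply cderive_eq.
    - apply cderive_mult; [apply C_derive_ok, Hf|].
      apply (cderive_comp cexp (fun z => - L0 z)); [apply cderive_cexp|].
      apply cderive_opp, HL.
    - cbv beta. field. auto. }
  rewrite HL0 in E. replace (- RtoC 0) with (RtoC 0) in E by ring.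
  rewrite cexp_0, Cmult_1_r, cexp_opp in E.
  rewrite cexp_plus, Hl, <- E. field. apply cexp_neq_0.
Qed.

(** * The hyperbolic cosine and its integer values *)

Definition ccosh (z : C) : C := (cexp z + cexp (- z)) / 2.

(* With [s ^ 2 = f ^ 2 - 1], the function [f + s] is zero-free and its inverse
   is [f - s]. *)
Lemma ccosh_lift (f : C -> C) : entire f -> (forall z, f z <> 1) -> (forall z, f z <> - (1)) ->
  exists U, entire U /\ forall z, f z = ccosh (U z).
Proof.
  intros Hf H1 H2.
  destruct (entire_log (fun z => f z ^ 2 - 1)) as [L [HL EL]].
  { intros z. apply ex_cderive_minus; [apply ex_cderive_pow, Hf|apply ex_cderive_const]. }
  { intros z E. replace (f z ^ 2 - 1) with ((f z - 1) * (f z + 1)) in E by ring.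
    assert (f z - 1 <> 0) by (intro E'; apply (H1 z), Ceq_minus, E').
    assert (f z + 1 <> 0).
    { intro E'. apply (H2 z), Ceq_minus. rewrite <- E'. ring. }
    revert E. now apply Cmult_neq_0. }
  set (s := fun z => cexp (L z / 2)).
  assert (Hs : entire s).
  { intros z. apply (ex_cderive_comp cexp (fun z => L z / 2)); [apply entire_cexp|].
    apply ex_cderive_mult; [apply HL|apply ex_cderive_const]. }
  assert (Es : forall z, s z * s z = f z ^ 2 - 1).
  { intros z. unfold s. rewrite EL, <- cexp_plus. f_equal. field. }
  assert (Einv : forall z, (f z + s z) * (f z - s z) = 1).
  { intros z. replace ((f z + s z) * (f z - s z)) with (f z ^ 2 - s z * s z) by ring.
    rewrite Es. ring. }
  destruct (entire_log (fun z => f z + s z)) as [U [HU EU]].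
  { intros z. now apply ex_cderive_plus. }
  { intros z E. specialize (Einv z). rewrite E, Cmult_0_l in Einv.
    apply RtoC_inj in Einv. lra. }
  exists U. split; auto. intros z. unfold ccosh. rewrite cexp_opp, <- EU.
  assert (N : f z + s z <> 0) by (rewrite EU; apply cexp_neq_0).
  replace (/ (f z + s z)) with (f z - s z).
  - field.
  - replace (f z - s z) with ((f z + s z) * (f z - s z) / (f z + s z)) by (field; auto).
    rewrite Einv. field. auto.
Qed.

Lemma ccosh_real (x : R) : ccosh x = cosh x.
Proof.
  unfold ccosh, cexp, cis, cosh. simpl Re. simpl Im.
  rewrite Ropp_0, cos_0, sin_0. apply injective_projections; simpl; field.
Qed.

Lemma cos_Z_PI_sqr (k : Z) : (cos (IZR k * PI) * cos (IZR k * PI) = 1)%R.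
Proof.
  assert (Hs : sin (IZR k * PI) = 0%R) by (apply sin_eq_0_1; eauto).
  generalize (sin2_cos2 (IZR k * PI)). unfold Rsqr. rewrite Hs. lra.
Qed.

Lemma cexp_imaginary (y : R) : cexp (Ci * y) = cis y.
Proof.
  unfold cexp. replace (Re (Ci * y)) with 0%R by (simpl; ring).
  replace (Im (Ci * y)) with y by (simpl; ring). rewrite exp_0. ring.
Qed.

Lemma cexp_periodic (z : C) (k : Z) : cexp (z + Ci * RtoC (2 * (IZR k * PI))) = cexp z.
Proof.
  rewrite cexp_plus, cexp_imaginary. unfold cis.
  rewrite cos_2a_sin, sin_2a, (sin_eq_0_1 (IZR k * PI)) by eauto.
  apply injective_projections; simpl; ring.
Qed.

Lemma ccosh_periodic (z : C) (k : Z) : ccosh (z + Ci * RtoC (2 * (IZR k * PI))) = ccosh z.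
Proof.
  unfold ccosh. rewrite !cexp_opp, cexp_periodic. reflexivity.
Qed.

Lemma ccosh_Z_Ci_PI (k : Z) : ccosh (IZR k * (Ci * PI)) = 1 \/ ccosh (IZR k * (Ci * PI)) = - (1).
Proof.
  replace (IZR k * (Ci * PI)) with (Ci * RtoC (IZR k * PI)) by (rewrite RtoC_mult; ring).
  assert (E : ccosh (Ci * RtoC (IZR k * PI)) = RtoC (cos (IZR k * PI))).
  { unfold ccosh.
    replace (- (Ci * RtoC (IZR k * PI))) with (Ci * RtoC (- (IZR k * PI)))
      by (rewrite RtoC_opp; ring).
    rewrite !cexp_imaginary. unfold cis. rewrite cos_neg, sin_neg.
    apply injective_projections; simpl; field. }
  rewrite E. assert (H := cos_Z_PI_sqr k).
  assert ((cos (IZR k * PI) - 1) * (cos (IZR k * PI) + 1) = 0)%R as H' by lra.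
  apply Rmult_integral in H'. destruct H' as [H'|H'].
  - left. f_equal. lra.
  - right. rewrite <- RtoC_opp. f_equal. lra.
Qed.

(** For [x >= 0] the increase of [cosh] on [[x, x + 4]] is at least 1, because [exp 4 >= 5]; so the
    next integer is attained there. Negative [x] follow by evenness. *)
Lemma cosh_hits_integer (x : R) :
  exists (x' : R) (n : Z), Rabs (x' - x) <= 4 /\ cosh x' = IZR n.
Proof.
  assert (Hpos : forall x : R, 0 <= x ->
    exists (x' : R) (n : Z), x <= x' <= x + 4 /\ cosh x' = IZR n).
  { clear x. intros x Hx. destruct (archimed (cosh x)) as [A1 A2].
    set (n := up (cosh x)) in *.
    assert (Hg : cosh x + 1 <= cosh (x + 4)).
    { unfold cosh. rewrite Ropp_plus_distr, !exp_plus.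
      assert (E4 := exp_ineq1_le 4). assert (Ex := exp_ineq1_le x).
      assert (Em := exp_pos (- x)). assert (Em4 := exp_pos (- (4))).
      assert (Ei : exp (- x) <= 1).
      { rewrite <- exp_0. destruct (Req_dec x 0) as [->|n0]; [rewrite Ropp_0; lra|].
        left. apply exp_increasing. lra. }
      assert (0 <= exp (- x) * exp (- (4))) by (apply Rmult_le_pos; lra).
      assert (exp x * 5 <= exp x * exp 4) by (apply Rmult_le_compat_l; lra).
      lra. }
    destruct (IVT_cor (fun t => cosh t - IZR n)%R x (x + 4)) as [x' [Hx' E]].
    - intros t. apply derivable_continuous_pt. apply derivable_pt_minus.
      + apply derivable_pt_cosh.
      + apply derivable_pt_const.
    - lra.
    - assert (0 <= (IZR n - cosh x) * (cosh (x + 4) - IZR n)) by (apply Rmult_le_pos; lra). lra.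
    - exists x', n. split; auto. lra. }
  destruct (Rle_lt_dec 0 x) as [Hx|Hx].
  - destruct (Hpos x Hx) as [x' [n [H E]]]. exists x', n. split; auto. apply Rabs_le. lra.
  - destruct (Hpos (- x)%R) as [x' [n [H E]]]; [lra|]. exists (- x')%R, n. split.
    + apply Rabs_le. lra.
    + rewrite <- E. unfold cosh. rewrite Ropp_involutive. field.
Qed.

(** The abscissa moves by at most 4 and the ordinate to the next multiple of [2 pi], by at most 8.
    There periodicity reduces [ccosh] to the real [cosh]. *)
Lemma ccosh_hits_integer (w : C) :
  exists (w' : C) (n : Z), Cmod (w' - w) <= 12 /\ ccosh w' = IZR n.
Proof.
  destruct w as [x y].
  destruct (cosh_hits_integer x) as [x' [n [Hx E]]].
  assert (HPI := PI_RGT_0). assert (HP4 := PI_4).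
  destruct (archimed (y / (2 * PI))) as [A1 A2]. set (k := up (y / (2 * PI))) in *.
  assert (Hk : Rabs (2 * (IZR k * PI) - y) <= 8).
  { assert (Ey : (y = y / (2 * PI) * (2 * PI))%R) by (field; lra).
    set (q := (y / (2 * PI))%R) in *. clearbody q. subst y.
    replace (2 * (IZR k * PI) - q * (2 * PI))%R with ((IZR k - q) * (2 * PI))%R by ring.
    rewrite Rabs_right by (apply Rle_ge, Rmult_le_pos; lra).
    apply Rle_trans with (1 * (2 * PI))%R; [apply Rmult_le_compat_r|]; lra. }
  exists (RtoC x' + Ci * RtoC (2 * (IZR k * PI))), n. split.
  - eapply Rle_trans; [apply Cmod_le_Re_Im|].
    replace (fst (x' + Ci * RtoC (2 * (IZR k * PI)) - (x, y))) with (x' - x)%R by (simpl; ring).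
    replace (snd (x' + Ci * RtoC (2 * (IZR k * PI)) - (x, y)))
      with (2 * (IZR k * PI) - y)%R by (simpl; ring).
    lra.
  - rewrite ccosh_periodic, ccosh_real, E. reflexivity.
Qed.

(** * Little Picard theorem *)

(* Otherwise [M] could be doubled again and again within a total distance
   [2 * k / M p0], and would be unbounded near the limit point. *)
Lemma doubling (M : C -> R) (p0 : C) (k : R) :
  (forall z : C, continuous M z) -> 0 < M p0 -> 0 < k ->
  exists p : C, M p0 <= M p /\ forall z : C, Cmod (z - p) <= k / M p -> M z <= 2 * M p.
Proof.
  intros HM H0 Hk. apply NNPP. intros Hn.
  (* The condition is put under the existential so that the choice is total and can be iterated;
     [Hge] shows that it holds along the orbit. *)
  assert (Hstep : forall p : C, exists z : C, M p0 <= M p ->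
            Cmod (z - p) <= k / M p /\ 2 * M p < M z).
  { intros p. destruct (Rle_lt_dec (M p0) (M p)) as [Hp|Hp]; [|exists p; lra].
    apply NNPP. intros Hz. apply Hn. exists p. split; auto. intros z Hzp.
    apply Rnot_lt_le. intros Hlt. apply Hz. now exists z. }
  set (next := fun p => proj1_sig (constructive_indefinite_description _ (Hstep p))).
  assert (Hnext : forall p, M p0 <= M p -> Cmod (next p - p) <= k / M p /\ 2 * M p < M (next p)).
  { intros p Hp. unfold next. destruct (constructive_indefinite_description _ _) as [z Hz].
    exact (Hz Hp). }
  set (c := fix c (n : nat) : C := match n with O => p0 | S n => next (c n) end).
  assert (Hp2 : forall n, 1 <= 2 ^ n) by (intros n; apply pow_R1_Rle; lra).
  assert (Hge1 : forall n, M p0 <= 2 ^ n * M p0).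
  { intros n. rewrite <- (Rmult_1_l (M p0)) at 1. apply Rmult_le_compat_r; [lra|auto]. }
  assert (Hgrow : forall n, 2 ^ n * M p0 <= M (c n)).
  { intros n. induction n as [|n IH]; [simpl; lra|].
    destruct (Hnext (c n)) as [_ H].
    - specialize (Hge1 n). lra.
    - change (c (S n)) with (next (c n)). simpl. lra. }
  assert (Hge : forall n, M p0 <= M (c n)).
  { intros n. eapply Rle_trans; [apply Hge1|apply Hgrow]. }
  destruct (geometric_sequence_converges c (k / M p0)) as [l Hl].
  { intros n. simpl. eapply Rle_trans; [apply (Hnext (c n)), Hge|].
    replace (k / M p0 * (/ 2) ^ n)%R with (k * / (2 ^ n * M p0))%R
      by (rewrite pow_inv; field; split; try (apply pow_nonzero); lra).
    apply Rmult_le_compat_l; [lra|]. apply Rinv_le_contravar; auto.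
    apply Rmult_lt_0_compat; auto. specialize (Hp2 n). lra. }
  assert (Hloc : locally l (fun z : C => M z < M l + 1)).
  { generalize (HM l (ball (M l) (mkposreal 1 Rlt_0_1)) (locally_ball _ _)).
    unfold filtermap. apply filter_imp. intros z Hz.
    change (Rabs (M z - M l) < 1) in Hz. apply Rabs_def2 in Hz. lra. }
  apply locally_C_iff in Hloc. destruct Hloc as [d [Hd Hloc]].
  destruct (pow_half_small (2 * (k / M p0)) d Hd) as [n1 Hn1].
  destruct (pow_half_small (M l + 1) (M p0) H0) as [n2 Hn2].
  assert (Hmono : forall n m, (n <= m)%nat -> (/ 2) ^ m <= (/ 2) ^ n).
  { intros n m Hnm. rewrite !pow_inv. apply Rinv_le_contravar; [apply pow_lt; lra|].
    apply Rle_pow; auto. lra. }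
  (* [n1] brings [c n] into the neighbourhood of [l] where [M < M l + 1]; [n2] makes [2 ^ n * M p0]
     exceed [M l + 1]. *)
  set (n := (n1 + n2)%nat).
  assert (Hkp : 0 < k / M p0) by now apply Rdiv_lt_0_compat.
  assert (H1 : M (c n) < M l + 1).
  { apply Hloc. eapply Rle_lt_trans; [apply Hl|].
    eapply Rle_lt_trans; [|apply Hn1]. apply Rmult_le_compat_l; [lra|].
    apply Hmono. unfold n. lia. }
  assert (H2 := Hgrow n). assert (H3 : 0 < M l + 1) by (specialize (Hge n); lra).
  assert (H4 : (M l + 1) * (/ 2) ^ n < M p0).
  { eapply Rle_lt_trans; [|apply Hn2]. apply Rmult_le_compat_l; [lra|].
    apply Hmono. unfold n. lia. }
  assert (H5 : (M l + 1) * (/ 2) ^ n * 2 ^ n < M p0 * 2 ^ n).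
  { apply Rmult_lt_compat_r; auto. specialize (Hp2 n). lra. }
  rewrite Rmult_assoc, <- Rpow_mult_distr, Rinv_l, pow1 in H5 by lra. lra.
Qed.

(* Newton's iteration with the fixed slope [f' p] is a contraction. *)
Lemma image_contains_disc (f : C -> C) (p w : C) (rho : R) :
  entire f -> C_derive f p <> 0 -> 0 < rho ->
  (forall z, Cmod (z - p) <= rho -> Cmod (C_derive f z - C_derive f p) <= Cmod (C_derive f p) / 2) ->
  Cmod (w - f p) <= rho * Cmod (C_derive f p) / 2 ->
  exists z, f z = w.
Proof.
  intros Hf Hc Hrho Hd Hw. set (c := C_derive f p) in *.
  assert (Hc0 : 0 < Cmod c) by now apply Cmod_gt_0.
  set (T := fun z => z - (f z - w) / c). set (T' := fun z => 1 - (C_derive f z - 0) * / c).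
  assert (HT : forall z, cderive T z (T' z)).
  { intros z. unfold T, T'. apply cderive_minus; [apply cderive_id|].
    eapply cderive_eq.
    - apply (cderive_mult (fun z => f z - w) (fun _ => / c)); [|apply cderive_const].
      apply (cderive_minus f (fun _ => w)); [apply C_derive_ok, Hf|apply cderive_const].
    - cbv beta. ring. }
  assert (HT' : forall z, continuous T' z).
  { intros z. apply continuous_Cminus; [apply continuous_const|].
    apply continuous_Cmult; [|apply continuous_const].
    apply continuous_Cminus; [|apply continuous_const].
    now apply ex_cderive_continuous, entire_C_derive. }
  assert (HTb : forall z, Cmod (z - p) <= rho -> Cmod (T' z) <= / 2).
  { intros z Hz. unfold T'.
    replace (1 - (C_derive f z - 0) * / c) with (- (C_derive f z - c) / c) by (field; auto).
    rewrite Cmod_div, Cmod_opp by auto.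
    apply Rmult_le_reg_r with (Cmod c); auto. unfold Rdiv.
    rewrite Rmult_assoc, Rinv_l by lra. specialize (Hd z Hz). lra. }
  assert (Hcontr : forall x y, Cmod (x - p) <= rho -> Cmod (y - p) <= rho ->
            Cmod (T y - T x) <= / 2 * Cmod (y - x)).
  { intros x y Hx Hy. apply segment_increment_bound with T'. intros s Hs.
    split; [apply HT|]. split; [apply HT'|]. apply HTb.
    replace (x + s * (y - x) - p) with (RtoC (1 - s) * (x - p) + s * (y - p))
      by (rewrite RtoC_minus; ring).
    eapply Rle_trans; [apply Cmod_triangle|]. rewrite !Cmod_mult, !Cmod_R, !Rabs_right by lra.
    assert ((1 - s) * Cmod (x - p) <= (1 - s) * rho) by (apply Rmult_le_compat_l; lra).
    assert (s * Cmod (y - p) <= s * rho) by (apply Rmult_le_compat_l; lra). lra. }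
  set (z := fix z (n : nat) : C := match n with O => p | S n => T (z n) end).
  assert (Hp2 : forall n, 0 < (/ 2) ^ n) by (intros n; apply pow_lt; lra).
  (* The steps halve from [rho / 2] on, so their partial sums never leave the disc on which [T]
     contracts. *)
  assert (Hz : forall n, Cmod (z n - p) <= rho * (1 - (/ 2) ^ n) /\
                         Cmod (z (S n) - z n) <= rho / 2 * (/ 2) ^ n).
  { intros n. induction n as [|n [IH1 IH2]].
    - split.
      + simpl. rewrite Cmod_minus_diag. lra.
      + simpl. unfold T. replace (p - (f p - w) / c - p) with ((w - f p) / c) by (field; auto).
        rewrite Cmod_div by auto. apply Rmult_le_reg_r with (Cmod c); auto.
        unfold Rdiv. rewrite Rmult_assoc, Rinv_l by lra. lra.
    - assert (H1 : Cmod (z (S n) - p) <= rho * (1 - (/ 2) ^ S n)).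
      { replace (z (S n) - p) with ((z (S n) - z n) + (z n - p)) by ring.
        eapply Rle_trans; [apply Cmod_triangle|].
        replace ((/ 2) ^ S n)%R with ((/ 2) ^ n / 2)%R by (simpl; field). lra. }
      split; auto.
      assert (Hin : forall k, Cmod (z k - p) <= rho * (1 - (/ 2) ^ k) -> Cmod (z k - p) <= rho).
      { intros k Hk. eapply Rle_trans; [apply Hk|].
        assert (0 <= rho * (/ 2) ^ k) by (apply Rmult_le_pos; [lra|left; auto]). lra. }
      change (Cmod (T (z (S n)) - T (z n)) <= rho / 2 * (/ 2) ^ S n).
      eapply Rle_trans; [apply Hcontr; now apply Hin|].
      replace ((/ 2) ^ S n)%R with (/ 2 * (/ 2) ^ n)%R by (simpl; field). lra. }
  destruct (geometric_sequence_converges z (rho / 2)) as [l Hl]; [apply Hz|].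
  exists l. apply Ceq_minus, Cmod_eq_0, Rle_antisym; [|apply Cmod_ge_0].
  apply le_epsilon. intros e He. rewrite Rplus_0_l.
  assert (Cf : continuous f l) by now apply ex_cderive_continuous.
  rewrite continuous_CC_iff in Cf. destruct (Cf (e / 2)%R ltac:(lra)) as [d [Hdp Hcf]].
  destruct (pow_half_small (2 * (rho / 2)) d Hdp) as [n1 Hn1].
  destruct (pow_half_small (Cmod c * (rho / 2)) (e / 2) ltac:(lra)) as [n2 Hn2].
  assert (Hmono : forall n m, (n <= m)%nat -> (/ 2) ^ m <= (/ 2) ^ n).
  { intros n m Hnm. rewrite !pow_inv. apply Rinv_le_contravar; [apply pow_lt; lra|].
    apply Rle_pow; auto. lra. }
  set (n := (n1 + n2)%nat).
  assert (H1 : Cmod (f (z n) - f l) < e / 2).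
  { apply Hcf. eapply Rle_lt_trans; [apply Hl|].
    eapply Rle_lt_trans; [|apply Hn1]. apply Rmult_le_compat_l; [lra|].
    apply Hmono. unfold n. lia. }
  assert (H2 : Cmod (f (z n) - w) < e / 2).
  (* The error [f (z n) - w] is the Newton step times the slope, and the steps tend to 0. *)
  { replace (f (z n) - w) with (c * - (z (S n) - z n)).
    2: { simpl. unfold T. field. auto. }
    rewrite Cmod_mult, Cmod_opp. eapply Rle_lt_trans; [|apply Hn2].
    rewrite Rmult_assoc. apply Rmult_le_compat_l; [lra|].
    eapply Rle_trans; [apply Hz|]. apply Rmult_le_compat_l; [lra|].
    apply Hmono. unfold n. lia. }
  replace (f l - w) with (- (f (z n) - f l) + (f (z n) - w)) by ring.
  eapply Rle_trans; [apply Cmod_triangle|]. rewrite Cmod_opp. lra.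
Qed.

(** Cauchy's estimate for a difference: with [c] on the circle, the two kernels differ by
    [(z-p) / ((c-z)(c-p))], where the second factor has modulus [r] and the first at least
    [r - |z-p|]. *)
Lemma holo_disc_increment_bound (f : C -> C) (p z : C) (r B : R) :
  entire f -> 0 < r -> (forall w, Cmod (w - p) <= r -> Cmod (f w) <= B) ->
  Cmod (z - p) < r ->
  Cmod (f z - f p) <= B * Cmod (z - p) / (r - Cmod (z - p)).
Proof.
  intros Hf Hr HB Hz. assert (HPI := PI_RGT_0).
  assert (Hp : Cmod (p - p) < r) by (rewrite Cmod_minus_diag; lra).
  assert (Hrr : 0 < r < r + 1) by lra.
  assert (Hd := entire_holo_disc f p (r + 1) Hf).
  rewrite (Cauchy_integral_formula f p r (r + 1) Hrr Hd z Hz),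
    (Cauchy_integral_formula f p r (r + 1) Hrr Hd p Hp).
  assert (Hu : forall t, continuous (Cauchy_density f p r) t)
    by (intros t; now apply continuous_Cauchy_density with (r + 1)%R).
  replace (B * Cmod (z - p) / (r - Cmod (z - p)))%R
    with ((2 * PI - 0) * (B * r / (2 * PI) * (Cmod (z - p) * / ((r - Cmod (z - p)) * r))))%R
    by (field; lra).
  eapply is_CInt_bound; [apply two_PI_pos| |apply is_CInt_minus;
    apply is_CInt_Cauchy_transform; auto].
  intros t Ht. cbv beta.
  assert (N1 := circle_neq p r Hr t z Hz). assert (N2 := circle_neq p r Hr t p Hp).
  replace (Cauchy_density f p r t / (circle p r t - z) ^ 1
      - Cauchy_density f p r t / (circle p r t - p) ^ 1)
    with (Cauchy_density f p r t * ((z - p) * / ((circle p r t - z) * (circle p r t - p))))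
    by (simpl; field; auto).
  assert (Hcp : Cmod (circle p r t - p) = r).
  { replace (circle p r t - p) with (r * cis t) by (unfold circle; ring).
    rewrite Cmod_mult, Cmod_R, Cmod_cis, Rabs_right; lra. }
  rewrite !Cmod_mult. apply Rmult_le_compat; try apply Cmod_ge_0.
  - apply Rmult_le_pos; apply Cmod_ge_0.
  - unfold Cauchy_density. rewrite Cmod_div.
    2: { rewrite <- RtoC_mult. intro E; apply RtoC_inj in E; lra. }
    rewrite !Cmod_mult, !Cmod_R, Cmod_cis, !Rabs_right by lra. rewrite Rmult_1_r.
    apply Rmult_le_compat_r; [left; apply Rinv_0_lt_compat; lra|].
    apply Rmult_le_compat_r; [lra|]. apply HB. lra.
  - apply Rmult_le_compat_l; [apply Cmod_ge_0|].
    rewrite Cmod_inv, Cmod_mult, Hcp by now apply Cmult_neq_0.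
    apply Rinv_le_contravar; [apply Rmult_lt_0_compat; lra|].
    apply Rmult_le_compat_r; [lra|]. now apply circle_dist.
Qed.

Lemma Bloch_entire (f : C -> C) (p0 : C) (rho : R) :
  entire f -> C_derive f p0 <> 0 -> 0 < rho ->
  exists c, forall w, Cmod (w - c) <= rho -> exists z, f z = w.
Proof.
  intros Hf H0 Hrho. assert (Hf' := entire_C_derive f Hf).
  destruct (doubling (fun z => Cmod (C_derive f z)) p0 (20 * rho)) as [p [Hp Hdbl]].
  - intros z. now apply continuous_Cmod, ex_cderive_continuous.
  - now apply Cmod_gt_0.
  - lra.
  - exists (f p). intros w Hw. apply Cmod_gt_0 in H0.
    set (m := Cmod (C_derive f p)) in *. assert (Hm : 0 < m) by lra.
    set (r := (20 * rho / m)%R) in *.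
    assert (Hr : 0 < r) by (apply Rdiv_lt_0_compat; lra).
    (* Both constants fit: on the disc of radius [r / 10] the derivative varies by at most
       [2m * (r/10) / (r/2 - r/10) = m / 2], and the image then contains a disc of radius
       [(r/10) * m / 2 = rho]. *)
    apply (image_contains_disc f p w (r / 10)); auto.
    + apply Cmod_gt_0. exact Hm.
    + lra.
    + intros z Hz. fold m.
      assert (Hz0 := Cmod_ge_0 (z - p)).
      eapply Rle_trans; [apply (holo_disc_increment_bound (C_derive f) p z (r / 2) (2 * m))|];
        auto; try lra.
      { intros x Hx. apply Hdbl. lra. }
      apply Rmult_le_reg_r with (r / 2 - Cmod (z - p))%R; [lra|].
      unfold Rdiv at 1. rewrite Rmult_assoc, Rinv_l by lra.
      assert (m * Cmod (z - p) <= m * (r / 10)) by (apply Rmult_le_compat_l; lra). lra.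
    + fold m. eapply Rle_trans; [apply Hw|]. right. unfold r. field. lra.
Qed.

Lemma entire_constant_of_derive (f : C -> C) :
  entire f -> (forall z, C_derive f z = 0) -> forall z w, f z = f w.
Proof.
  intros Hf H. apply cderive_zero_constant. intros z. rewrite <- (H z). now apply C_derive_ok.
Qed.

Lemma Picard_1_m1 (f : C -> C) : entire f ->
  (forall z, f z <> 1) -> (forall z, f z <> - (1)) -> forall z w, f z = f w.
Proof.
  intros Hf H1 H2.
  destruct (ccosh_lift f Hf H1 H2) as [U [HU EU]].
  assert (HPI := PI_RGT_0).
  assert (NPI : RtoC PI <> 0) by (intro E; apply RtoC_inj in E; lra).
  assert (NCi := Ci_nz).
  set (V := fun z => U z / (Ci * PI)).
  assert (HV : entire V) by (intros z; apply ex_cderive_mult; [apply HU|apply ex_cderive_const]).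
  assert (EV : forall z, U z = V z * (Ci * PI)) by (intros z; unfold V; field; auto).
  assert (HVZ : forall z (k : Z), V z <> IZR k).
  { intros z k E. assert (Ef := EU z). rewrite EV, E in Ef.
    destruct (ccosh_Z_Ci_PI k) as [Ek|Ek]; rewrite Ek in Ef; [now apply (H1 z)|now apply (H2 z)]. }
  (* Among the integers that [V] omits are 1 and -1, so it can be lifted through [ccosh] in its
     turn. *)
  destruct (ccosh_lift V HV) as [W [HW EW]].
  { intros z. exact (HVZ z 1%Z). }
  { intros z E. apply (HVZ z (-1)%Z). rewrite E. apply injective_projections; simpl; ring. }
  assert (HW' : forall z, C_derive W z = 0).
  { intros z. apply NNPP. intros Hn.
    destruct (Bloch_entire W z 12 HW Hn ltac:(lra)) as [c Hc].
    destruct (ccosh_hits_integer c) as [w [n [Hw En]]].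
    destruct (Hc w Hw) as [x Hx]. apply (HVZ x n). now rewrite EW, Hx. }
  intros z w. rewrite !EU, !EV, !EW.
  now rewrite (entire_constant_of_derive W HW HW' z w).
Qed.

Theorem little_Picard (f : C -> C) (a b : C) : entire f -> a <> b ->
  (forall z, f z <> a) -> (forall z, f z <> b) -> forall z w, f z = f w.
Proof.
  intros Hf Hab Ha Hb.
  assert (N : a - b <> 0) by (intro E; apply Hab, Ceq_minus, E).
  (* The affine change of variable that sends [a] to 1 and [b] to -1. *)
  set (g := fun z => (2 * f z - (a + b)) / (a - b)).
  assert (Eg : forall z, f z = (g z * (a - b) + (a + b)) / 2)
    by (intros z; unfold g; field; auto).
  intros z w. rewrite !Eg. rewrite (Picard_1_m1 g) with (w := w); auto.
  - intros x. apply ex_cderive_mult; [|apply ex_cderive_const].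
    apply ex_cderive_minus; [|apply ex_cderive_const].
    apply ex_cderive_mult; [apply ex_cderive_const|apply Hf].
  - intros x E. apply (Ha x). rewrite Eg, E. field.
  - intros x E. apply (Hb x). rewrite Eg, E. field.
Qed.

(** * The Fermat equation *)

(* The indicator function of a clopen set has zero derivative. *)
Lemma clopen_full (P : C -> Prop) (a : C) :
  (forall z, P z -> locally z P) -> (forall z, ~ P z -> locally z (fun w => ~ P w)) ->
  P a -> forall z, P z.
Proof.
  intros Hopen Hclosed Ha z.
  set (chi := fun z : C => if excluded_middle_informative (P z) then RtoC 1 else RtoC 0).
  assert (E : chi z = chi a).
  { apply (cderive_zero_constant chi). intros w.
    apply cderive_ext_loc with (fun _ => chi w); [|apply cderive_const].
    unfold chi. destruct (excluded_middle_informative (P w)) as [H|H].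
    - generalize (Hopen w H). apply filter_imp. intros x Hx.
      destruct (excluded_middle_informative (P x)); [reflexivity|contradiction].
    - generalize (Hclosed w H). apply filter_imp. intros x Hx.
      destruct (excluded_middle_informative (P x)); [contradiction|reflexivity]. }
  unfold chi in E. destruct (excluded_middle_informative (P z)); auto.
  destruct (excluded_middle_informative (P a)); [|contradiction].
  apply RtoC_inj in E. lra.
Qed.

(** * Local behaviour of meromorphic solutions *)

Lemma locally'_C_inhabited (a : C) (P : C -> Prop) :
  locally' a P -> exists z, z <> a /\ P z.
Proof.
  intros H. apply locally_C_iff in H. destruct H as [d [Hd H]].
  assert (Hz : a + RtoC (d / 2) <> a).
  { intros E. assert (E' : RtoC (d / 2) = 0).
    { replace (RtoC (d / 2)) with (a + RtoC (d / 2) - a) by ring. rewrite E. ring. }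
    apply RtoC_inj in E'. lra. }
  exists (a + RtoC (d / 2)). split; auto. apply H; auto.
  replace (a + RtoC (d / 2) - a) with (RtoC (d / 2)) by ring.
  rewrite Cmod_R, Rabs_right; lra.
Qed.

Lemma regular_at_Some (f : C -> option C) (a : C) :
  regular_at f a -> f a = Some (finite_value f a).
Proof.
  intros [H _]. apply locally_singleton in H. unfold finite_value.
  destruct (f a); [reflexivity|contradiction].
Qed.

Lemma regular_at_ex_derive (f : C -> option C) (a : C) :
  regular_at f a -> ex_derive (finite_value f) a.
Proof. intros [_ H]. now apply locally_singleton in H. Qed.

Lemma meromorphic_regular (f : C -> option C) (a w : C) :
  meromorphic f -> f a = Some w -> regular_at f a.
Proof. intros Hf E. destruct (Hf a) as [H|[H _]]; [exact H|congruence]. Qed.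

Lemma pole_large (f : C -> option C) (a : C) (K : R) :
  pole_at f a -> locally' a (fun z => K < Cmod (finite_value f z)).
Proof. intros [_ [_ H]]. apply (H (fun x => K < x)). now exists K. Qed.

Lemma fermat_identity_sym (m n : nat) (f g : C -> option C) :
  fermat_identity m n f g -> fermat_identity n m g f.
Proof. intros H z u v Hu Hv. rewrite Cplus_comm. eapply H; eassumption. Qed.

(** Near a pole of [g] the power [g ^ n] is arbitrarily large while [f ^ m] stays bounded. The
    identity says nothing at the pole itself, so it is read off at a nearby point. *)
Lemma fermat_regular (m n : nat) (f g : C -> option C) (a : C) :
  (1 <= n)%nat -> meromorphic g -> fermat_identity m n f g ->
  regular_at f a -> regular_at g a.
Proof.
  intros Hn Hg Hfg Hf. destruct (Hg a) as [H|Hpole]; [exact H|exfalso].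
  assert (Cf : continuous (fun z => finite_value f z ^ m) a)
    by now apply continuous_Cpow, ex_cderive_continuous, regular_at_ex_derive.
  rewrite continuous_C_iff in Cf. specialize (Cf 1%R Rlt_0_1).
  (* One unit for the variation of [f ^ m] near [a], one for the right-hand side 1; as [K >= 1], a
     value of [g] beyond [K] has modulus at most that of its [n]-th power. *)
  set (K := (Cmod (finite_value f a ^ m) + 2)%R).
  assert (H1 : locally' a (fun z => Cmod (finite_value f z ^ m - finite_value f a ^ m) < 1 /\
                 f z <> None)).
  { unfold locally', within. generalize (filter_and _ _ Cf (proj1 Hf)).
    apply filter_imp. auto. }
  assert (H2 := pole_large g a K Hpole). assert (H3 := proj1 (proj2 Hpole)).
  assert (H4 := filter_and _ _ H1 (filter_and _ _ H2 H3)).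
  apply locally'_C_inhabited in H4. destruct H4 as [z [_ [[Hz1 Hz2] [Hz3 Hz4]]]].
  assert (Eg := regular_at_Some g z Hz4).
  assert (Ef : f z = Some (finite_value f z)).
  { unfold finite_value. destruct (f z); [reflexivity|contradiction]. }
  assert (E := Hfg z _ _ Ef Eg).
  set (u := finite_value f z ^ m) in *. set (v := finite_value g z) in *.
  assert (Hu : Cmod u <= K - 1).
  { replace u with ((u - finite_value f a ^ m) + finite_value f a ^ m) by ring.
    eapply Rle_trans; [apply Cmod_triangle|]. unfold K. lra. }
  assert (HK : 2 <= K) by (unfold K; generalize (Cmod_ge_0 (finite_value f a ^ m)); lra).
  assert (Hv : Cmod v <= Cmod (v ^ n)).
  { rewrite Cmod_pow. rewrite <- (pow_1 (Cmod v)) at 1. apply Rle_pow; [lra|auto]. }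
  assert (Hv' : Cmod (v ^ n) <= K).
  { replace (v ^ n) with (1 + - u) by (rewrite <- E; ring).
    eapply Rle_trans; [apply Cmod_triangle|]. rewrite Cmod_opp, Cmod_1. lra. }
  lra.
Qed.

Lemma holomorphic_at_mult (f g : C -> C) (a : C) :
  holomorphic_at f a -> holomorphic_at g a -> holomorphic_at (fun z => f z * g z) a.
Proof.
  intros Hf Hg. generalize (filter_and _ _ Hf Hg). unfold holomorphic_at. apply filter_imp.
  intros z [H1 H2]. now apply ex_cderive_mult.
Qed.

Lemma holomorphic_at_pow (f : C -> C) (a : C) (n : nat) :
  holomorphic_at f a -> holomorphic_at (fun z => f z ^ n) a.
Proof. unfold holomorphic_at. apply filter_imp. intros z. apply ex_cderive_pow. Qed.

Lemma holomorphic_at_continuous (f : C -> C) (a : C) : holomorphic_at f a -> continuous f a.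
Proof. intros H. apply ex_cderive_continuous. now apply locally_singleton in H. Qed.

Lemma holomorphic_at_div (f g : C -> C) (a : C) :
  holomorphic_at f a -> holomorphic_at g a -> g a <> 0 -> holomorphic_at (fun z => f z / g z) a.
Proof.
  intros Hf Hg H0.
  generalize (filter_and _ _ Hf (filter_and _ _ Hg
    (locally_neq g a 0 (holomorphic_at_continuous g a Hg) H0))).
  unfold holomorphic_at. apply filter_imp. intros z [H1 [H2 H3]]. now apply ex_cderive_div.
Qed.

Lemma INR_C_neq_0 (n : nat) : (1 <= n)%nat -> RtoC (INR n) <> 0.
Proof. intros Hn E. apply RtoC_inj in E. apply (not_0_INR n); [lia|exact E]. Qed.

Lemma Cpow_eq_1_neq_0 (w : C) (n : nat) : (1 <= n)%nat -> w ^ n = 1 -> w <> 0.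
Proof.
  intros Hn E ->. destruct n as [|n]; [lia|]. rewrite Cpow_S, Cmult_0_l in E.
  apply RtoC_inj in E. lra.
Qed.

Lemma Cpow_0_l (n : nat) : (1 <= n)%nat -> 0 ^ n = 0.
Proof. intros Hn. destruct n as [|n]; [lia|]. rewrite Cpow_S. ring. Qed.

(* If [f] vanishes at [a] to order [p], then [f'] does to order [p - 1] and
   [g' = - m f^(m-1) f' / (n g^(n-1))] to order [p - 1 + (m - 1) p]. *)
Lemma zero_of_f_not_isolated (m n : nat) (f g : C -> option C) (a : C) :
  (2 <= m)%nat -> (2 <= n)%nat -> meromorphic f -> meromorphic g -> fermat_identity m n f g ->
  (forall k, zero_of_order (mderive g) a k -> zero_of_order (mderive f) a k) ->
  f a = Some (RtoC 0) -> locally a (fun z => f z = Some (RtoC 0)).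
Proof.
  intros Hm Hn Hf Hg Hfg Hord Ha.
  assert (Rf := meromorphic_regular f a _ Hf Ha).
  assert (Rg := fermat_regular m n f g a ltac:(lia) Hg Hfg Rf).
  assert (Eg := regular_at_Some g a Rg).
  assert (Efa : finite_value f a = 0) by (unfold finite_value; now rewrite Ha).
  destruct Rf as [Lf Of]. destruct Rg as [Lg Og].
  set (fv := finite_value f) in *. set (gv := finite_value g) in *.
  assert (Sf : forall z, f z <> None -> f z = Some (fv z)).
  { intros z Hz. unfold fv, finite_value. destruct (f z); [reflexivity|contradiction]. }
  assert (Sg : forall z, g z <> None -> g z = Some (gv z)).
  { intros z Hz. unfold gv, finite_value. destruct (g z); [reflexivity|contradiction]. }
  destruct (zero_factorization fv a Of) as [H0|[p [phi [Ophi [Hphi Efac]]]]].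
  { generalize (filter_and _ _ Lf H0). apply filter_imp. intros z [H1 H2].
    now rewrite (Sf z H1), H2. }
  exfalso.
  (* Order 0 would give [f a <> 0]. From here the order of [f] is [S q], and the exponent becomes
     [S (S m)]. *)
  destruct p as [|q].
  { apply locally_singleton in Efac. rewrite Efa in Efac. simpl in Efac.
    apply Hphi. rewrite Efac. ring. }
  destruct m as [|[|m]]; [lia|lia|].
  assert (Hga : gv a ^ n = 1).
  { rewrite <- (Hfg a _ _ Ha Eg). rewrite Cpow_0_l by lia. fold gv. ring. }
  assert (Nga : gv a <> 0) by (apply Cpow_eq_1_neq_0 with n; [lia|auto]).
  (* [chi] and [psi] are the cofactors of the powers of [z - a] in [f'] and [g']: [chi] by the
     product rule, [psi] by solving the differentiated identity for [g']. *)
  set (chi := fun z => INR (S q) * phi z + (z - a) * C_derive phi z).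
  set (psi := fun z => - RtoC (INR (S (S m))) * (phi z ^ S m * chi z) / (INR n * gv z ^ pred n)).
  assert (Ochi : holomorphic_at chi a).
  { generalize (filter_and _ _ Ophi (holomorphic_at_C_derive phi a Ophi)). unfold holomorphic_at. apply filter_imp.
    intros z [H1 H2]. apply ex_cderive_plus; apply ex_cderive_mult; auto.
    - apply ex_cderive_const.
    - apply ex_cderive_minus; [apply ex_cderive_id|apply ex_cderive_const]. }
  assert (Hchi : chi a <> 0).
  { unfold chi. replace (INR (S q) * phi a + (a - a) * C_derive phi a)
      with (INR (S q) * phi a) by ring.
    apply Cmult_neq_0; auto. apply INR_C_neq_0. lia. }
  assert (Oconst : forall c : C, holomorphic_at (fun _ => c) a).
  { intros c. unfold holomorphic_at. apply filter_forall. intros z. apply ex_cderive_const. }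
  assert (Nn : RtoC (INR n) <> 0) by (apply INR_C_neq_0; lia).
  assert (Nm : RtoC (INR (S (S m))) <> 0) by (apply INR_C_neq_0; lia).
  assert (Opsi : holomorphic_at psi a).
  { apply holomorphic_at_div.
    - apply holomorphic_at_mult; [apply Oconst|].
      apply holomorphic_at_mult; auto. now apply holomorphic_at_pow.
    - apply holomorphic_at_mult; [apply Oconst|]. now apply holomorphic_at_pow.
    - apply Cmult_neq_0; auto. now apply Cpow_nz. }
  assert (Hpsi : psi a <> 0).
  { unfold psi. apply Cmult_neq_0.
    - apply Cmult_neq_0; [|apply Cmult_neq_0; auto; now apply Cpow_nz].
      intros E. apply Nm. replace (RtoC (INR (S (S m)))) with (- - RtoC (INR (S (S m)))) by ring.
      rewrite E. ring.
    - intros E. assert (E' : INR n * gv a ^ pred n <> 0)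
        by (apply Cmult_neq_0; auto; now apply Cpow_nz).
      assert (E2 := Cinv_l _ E'). rewrite E, Cmult_0_l in E2. apply RtoC_inj in E2. lra. }
  (* With the original exponent this is [m p - 1]: order [q = p - 1] from [f'] and [(m - 1) p] from
     the power of [f]. *)
  set (N := (q + S m * S q)%nat).
  assert (Hgv := locally_neq gv a 0 (holomorphic_at_continuous gv a Og) Nga).
  assert (Hid : locally a (fun z => fv z ^ S (S m) + gv z ^ n = 1)).
  { generalize (filter_and _ _ Lf Lg). apply filter_imp. intros z [H1 H2].
    exact (Hfg z _ _ (Sf z H1) (Sg z H2)). }
  assert (Hnear : locally a (fun z =>
    mderive f z = Some ((z - a) ^ q * chi z) /\ mderive g z = Some ((z - a) ^ N * psi z))).
  { generalize (filter_and _ _ (filter_and _ _ (filter_and _ _ Lf Lg) (filter_and _ _ Of Og))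
      (filter_and _ _ (filter_and _ _ Ophi Hgv)
        (filter_and _ _ (locally_locally _ _ Efac) (locally_locally _ _ Hid)))).
    apply filter_imp. intros z [[[H1 H2] [H3 H4]] [[H5 H6] [H7 H8]]].
    assert (Df : cderive fv z ((z - a) ^ q * chi z)).
    { apply cderive_ext_loc with (fun w => (w - a) ^ S q * phi w).
      { generalize H7. apply filter_imp. auto. }
      eapply cderive_eq.
      - apply (cderive_mult (fun w => (w - a) ^ S q) phi); [|apply C_derive_ok, H5].
        apply (cderive_pow (fun w => w - a)).
        apply (cderive_minus (fun w => w) (fun _ => a)); [apply cderive_id|apply cderive_const].
      - unfold chi. cbn [pred]. rewrite Cpow_S. ring. }
    assert (Dg := C_derive_ok gv z H4).
    assert (E : INR (S (S m)) * fv z ^ S m * ((z - a) ^ q * chi z)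
                + INR n * gv z ^ pred n * C_derive gv z = 0).
    { apply (cderive_unique (fun w => fv w ^ S (S m) + gv w ^ n) z).
      - apply cderive_plus; [exact (cderive_pow fv z _ (S (S m)) Df)|now apply cderive_pow].
      - apply cderive_ext_loc with (fun _ => RtoC 1); [|apply cderive_const].
        generalize H8. apply filter_imp. auto. }
    unfold mderive. rewrite (Sf z H1), (Sg z H2). fold fv gv. split.
    - now rewrite (is_C_derive_unique fv z _ Df).
    - f_equal.
      assert (Nd : INR n * gv z ^ pred n <> 0) by (apply Cmult_neq_0; auto; now apply Cpow_nz).
      apply locally_singleton in H7. rewrite H7, Cpow_mult_l in E.
      set (D := INR n * gv z ^ pred n) in *.
      replace (C_derive gv z) with ((D * C_derive gv z) / D) by (field; auto).
      replace (D * C_derive gv z)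
        with (- (INR (S (S m)) * (((z - a) ^ S q) ^ S m * phi z ^ S m) * ((z - a) ^ q * chi z))).
      2: { apply Ceq_minus. rewrite <- (Copp_0), <- E. ring. }
      rewrite <- Cpow_mult_r. unfold N. rewrite Cpow_add_r, (Nat.mul_comm (S m)).
      unfold psi. fold D. field. auto. }
  assert (HoG : zero_of_order (mderive g) a N).
  { split; [unfold N; lia|]. exists psi. split; [auto|split; [auto|]].
    generalize Hnear. apply filter_imp. tauto. }
  destruct (Hord N HoG) as [_ [phi3 [O3 [_ E3]]]].
  apply Hchi.
  (* As [f'] vanishes to order [N] as well, cancelling [(z - a) ^ q] off [a] makes [chi] a multiple
     of a positive power of [z - a], and by continuity [chi a = 0]. *)
  replace (RtoC 0) with ((a - a) ^ (S m * S q) * phi3 a).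
  2: { replace (a - a) with (RtoC 0) by ring. rewrite Cpow_0_l by lia. ring. }
  assert (Hboth := filter_and _ _ Hnear E3). apply locally_C_iff in Hboth.
  destruct Hboth as [d [Hd Hboth]].
  apply (continuous_eq_of_punctured chi (fun z => (z - a) ^ (S m * S q) * phi3 z) a d); auto.
  - now apply holomorphic_at_continuous.
  - apply continuous_Cmult; [|now apply holomorphic_at_continuous].
    apply continuous_Cpow, continuous_Cminus; [apply continuous_id|apply continuous_const].
  - intros z Hz Nz. destruct (Hboth z Hz) as [[E1 _] E2]. rewrite E1 in E2.
    assert (E := f_equal (fun o => match o with Some x => x | None => RtoC 0 end) E2).
    cbv beta iota in E. unfold N in E. rewrite Cpow_add_r in E.
    assert (Nza : (z - a) ^ q <> 0) by (apply Cpow_nz; intro E'; apply Nz, Ceq_minus, E').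
    replace (chi z) with (((z - a) ^ q * chi z) / (z - a) ^ q) by (field; auto).
    rewrite E. field. auto.
Qed.

(** The closedness needed in [clopen_full]: zeros accumulate neither at a regular point of nonzero
    value, by continuity, nor at a pole, where [f] is large. *)
Lemma nonzero_locally (f : C -> option C) (a : C) : meromorphic f -> f a <> Some (RtoC 0) ->
  locally a (fun z => f z <> Some (RtoC 0)).
Proof.
  intros Hf Ha. destruct (Hf a) as [H|H].
  - assert (E := regular_at_Some f a H).
    assert (H0 : finite_value f a <> 0) by (intro E0; apply Ha; now rewrite E, E0).
    generalize (locally_neq (finite_value f) a 0
      (ex_cderive_continuous _ _ (regular_at_ex_derive f a H)) H0).
    apply filter_imp. intros z Hz Ez. apply Hz. unfold finite_value. now rewrite Ez.
  - generalize (pole_large f a 1 H). unfold locally', within. apply filter_imp.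
    intros z Hz Ez. destruct (Ceq_dec z a) as [->|n]; [contradiction|].
    specialize (Hz n). unfold finite_value in Hz. rewrite Ez, Cmod_0 in Hz. lra.
Qed.

(** Differentiating [g ^ n = 1] gives [n g^(n-1) g' = 0], and [g] has no zero. *)
Lemma everywhere_regular_constant (g : C -> option C) (n : nat) :
  (1 <= n)%nat -> (forall z, regular_at g z) -> (forall z, finite_value g z ^ n = 1) -> constant g.
Proof.
  intros Hn Hg H1. set (gv := finite_value g) in *.
  assert (He : entire gv) by (intros z; now apply regular_at_ex_derive).
  assert (H0 : forall z, C_derive gv z = 0).
  { intros z. assert (Nz : gv z <> 0) by now apply Cpow_eq_1_neq_0 with n.
    assert (E : INR n * gv z ^ pred n * C_derive gv z = 0).
    { apply (cderive_unique (fun w => gv w ^ n) z).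
      - apply cderive_pow, C_derive_ok, He.
      - apply (cderive_ext (fun _ => RtoC 1)); [intros w; now rewrite H1|apply cderive_const]. }
    assert (Nd : INR n * gv z ^ pred n <> 0).
    { apply Cmult_neq_0; [now apply INR_C_neq_0|now apply Cpow_nz]. }
    replace (C_derive gv z) with (INR n * gv z ^ pred n * C_derive gv z / (INR n * gv z ^ pred n))
      by (field; split; [now apply Cpow_nz|now apply INR_C_neq_0]).
    rewrite E. field. split; [now apply Cpow_nz|now apply INR_C_neq_0]. }
  exists (gv (RtoC 0)). intros z. rewrite (regular_at_Some g z (Hg z)). f_equal.
  now apply entire_constant_of_derive.
Qed.

(** The zero set of [f] is nonempty, open by [zero_of_f_not_isolated] and closed, hence the whole
    plane; then [g ^ n = 1]. *)
Lemma zero_implies_constant (m n : nat) (f g : C -> option C) (a : C) :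
  (2 <= m)%nat -> (2 <= n)%nat -> meromorphic f -> meromorphic g -> fermat_identity m n f g ->
  (forall b k, zero_of_order (mderive g) b k -> zero_of_order (mderive f) b k) ->
  f a = Some (RtoC 0) -> constant f /\ constant g.
Proof.
  intros Hm Hn Hf Hg Hfg Hord Ha.
  assert (H0 : forall z, f z = Some (RtoC 0)).
  { apply (clopen_full (fun z => f z = Some (RtoC 0)) a); auto.
    - intros z Hz. apply (zero_of_f_not_isolated m n f g z); auto.
    - intros z. now apply nonzero_locally. }
  split; [exists (RtoC 0); exact H0|].
  assert (Hreg : forall z, regular_at g z).
  { intros z. apply (fermat_regular m n f g); auto; [lia|].
    now apply meromorphic_regular with (RtoC 0). }
  apply everywhere_regular_constant with n; [lia|auto|].
  intros z. rewrite <- (Hfg z _ _ (H0 z) (regular_at_Some g z (Hreg z))).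
  rewrite Cpow_0_l by lia. ring.
Qed.

(** The value 0 at a pole is the limit of [1 / f] there, in contrast to the junk value in
    [finite_value]. *)
Definition reciprocal (f : C -> option C) (z : C) : C :=
  match f z with Some w => / w | None => 0 end.

Lemma entire_reciprocal (f : C -> option C) :
  meromorphic f -> (forall z, f z <> Some (RtoC 0)) -> entire (reciprocal f).
Proof.
  intros Hf H0.
  assert (Hreg : forall z, regular_at f z -> ex_derive (reciprocal f) z).
  { intros z Hz. apply ex_cderive_ext_loc with (fun w => / finite_value f w).
    - generalize (proj1 Hz). apply filter_imp. intros w Hw.
      unfold reciprocal, finite_value. destruct (f w); [reflexivity|contradiction].
    - apply ex_cderive_inv; [now apply regular_at_ex_derive|].
      intros E. apply (H0 z). now rewrite (regular_at_Some f z Hz), E. }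
  intros a. destruct (Hf a) as [H|H]; [auto|].
  assert (Hpunct := proj1 (proj2 H)). apply locally_C_iff in Hpunct.
  destruct Hpunct as [d [Hd Hpunct]].
  (* Poles are isolated, so only continuity at the pole remains to be shown; it holds because [f]
     exceeds [/ e] nearby. *)
  apply (removable_singularity (reciprocal f) a d); auto.
  apply continuous_C_iff. intros e He.
  assert (Ea : reciprocal f a = 0) by (unfold reciprocal; now rewrite (proj1 H)).
  rewrite Ea. generalize (pole_large f a (/ e) H). unfold locally', within.
  apply filter_imp. intros z Hz. replace (reciprocal f z - 0) with (reciprocal f z) by ring.
  destruct (Ceq_dec z a) as [->|n]; [now rewrite Ea, Cmod_0|].
  specialize (Hz n). revert Hz. unfold reciprocal, finite_value.
  assert (Hie := Rinv_0_lt_compat e He).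
  destruct (f z) as [w|]; [|rewrite Cmod_0; lra].
  intros Hw. rewrite Cmod_inv by (apply Cmod_gt_0; lra).
  rewrite <- (Rinv_inv e). apply Rinv_lt_contravar; auto.
  apply Rmult_lt_0_compat; lra.
Qed.

Lemma cis_pow (t : R) (n : nat) : cis t ^ n = cis (INR n * t).
Proof.
  induction n as [|n IH].
  - simpl. rewrite Rmult_0_l. unfold cis. now rewrite cos_0, sin_0.
  - rewrite Cpow_S, IH, S_INR, <- cis_plus. f_equal. ring.
Qed.

Lemma nontrivial_root_of_unity (m : nat) : (2 <= m)%nat -> exists w : C, w ^ m = 1 /\ w <> 1.
Proof.
  intros Hm. assert (HPI := PI_RGT_0).
  assert (Hm' : 2 <= INR m) by (replace 2%R with (INR 2) by reflexivity; now apply le_INR).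
  (* The angle is written as a double so that its cosine is [1 - 2 sin^2], which differs from 1
     because [PI / m] lies strictly between 0 and [PI]. *)
  exists (cis (2 * (PI / INR m))). split.
  - rewrite cis_pow. replace (INR m * (2 * (PI / INR m)))%R with (2 * PI)%R by (field; lra).
    unfold cis. now rewrite cos_2PI, sin_2PI.
  - intros E. apply (f_equal fst) in E. simpl in E. rewrite cos_2a_sin in E.
    assert (Hs : 0 < sin (PI / INR m)).
    { apply sin_gt_0; [apply Rdiv_lt_0_compat; lra|].
      apply Rmult_lt_reg_r with (INR m); [lra|]. unfold Rdiv.
      rewrite Rmult_assoc, Rinv_l by lra.
      assert (PI * 2 <= PI * INR m) by (apply Rmult_le_compat_l; lra). lra. }
    assert (0 < sin (PI / INR m) * sin (PI / INR m)) by now apply Rmult_lt_0_compat. lra.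
Qed.

Lemma zero_free_constant (m n : nat) (f g : C -> option C) :
  (2 <= m)%nat -> (1 <= n)%nat -> meromorphic f -> meromorphic g -> fermat_identity m n f g ->
  (forall z, f z <> Some (RtoC 0)) -> (forall z, g z <> Some (RtoC 0)) -> constant f.
Proof.
  intros Hm Hn Hf Hg Hfg Hf0 Hg0.
  assert (Homit : forall w : C, w ^ m = 1 -> forall z, reciprocal f z <> w).
  { intros w Hw z E. assert (Nw := Cpow_eq_1_neq_0 w m ltac:(lia) Hw).
    (* At a pole the reciprocal is 0, which is no root of unity; elsewhere [u ^ m = 1] would force a
       zero of [g]. *)
    unfold reciprocal in E. destruct (f z) as [u|] eqn:Eu; [|now apply Nw].
    assert (Rg := fermat_regular m n f g z Hn Hg Hfg (meromorphic_regular f z u Hf Eu)).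
    assert (Ev := regular_at_Some g z Rg). assert (H := Hfg z _ _ Eu Ev).
    assert (Nu : u <> 0) by (intros ->; now apply (Hf0 z)).
    assert (Eum : u ^ m = 1).
    { assert (H1 : / u ^ m = 1) by now rewrite <- Cpow_inv, E.
      assert (Num := Cpow_nz u m Nu).
      replace (u ^ m) with (/ (/ u ^ m)) by (field; auto). rewrite H1.
      apply injective_projections; simpl; field. }
    apply (Hg0 z). rewrite Ev. f_equal.
    rewrite Eum in H.
    apply NNPP. intros Nv. apply (Cpow_nz _ n Nv).
    replace (finite_value g z ^ n) with (1 + finite_value g z ^ n - 1) by ring. rewrite H. ring. }
  destruct (nontrivial_root_of_unity m Hm) as [w [Hw1 Hw]].
  assert (Hc := little_Picard (reciprocal f) w 1 (entire_reciprocal f Hf Hf0) Hw (Homit w Hw1)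
    (Homit 1 (Cpow_1_l m))).
  (* A point of finite value shows that the constant value of the reciprocal is not 0, which
     excludes poles altogether. *)
  assert (Hex : exists z0 u0, f z0 = Some u0).
  { destruct (Hf 0) as [H|[_ [H _]]].
    - exists (RtoC 0). eexists. now apply regular_at_Some.
    - apply locally'_C_inhabited in H. destruct H as [z [_ H]].
      exists z. eexists. now apply regular_at_Some. }
  destruct Hex as [z0 [u0 E0]]. exists u0. intros z.
  assert (N0 : u0 <> 0) by (intros ->; now apply (Hf0 z0)).
  specialize (Hc z z0). unfold reciprocal in Hc. rewrite E0 in Hc.
  destruct (f z) as [u|] eqn:Eu.
  - assert (Nu : u <> 0) by (intros ->; now apply (Hf0 z)).
    f_equal. replace u with (/ / u) by (field; auto). rewrite Hc. field. auto.
  - exfalso. assert (H := Cinv_l u0 N0). rewrite <- Hc, Cmult_0_l in H.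
    apply RtoC_inj in H. lra.
Qed.

Lemma mderive_constant (f : C -> option C) (z : C) : constant f -> mderive f z = Some (RtoC 0).
Proof.
  intros [c Hc]. unfold mderive. rewrite Hc. f_equal. apply is_C_derive_unique.
  apply (cderive_ext (fun _ => c)); [|apply cderive_const].
  intros w. unfold finite_value. now rewrite Hc.
Qed.

Lemma zero_of_order_ext (h1 h2 : C -> option C) (a : C) (k : nat) :
  (forall z, h1 z = h2 z) -> zero_of_order h1 a k -> zero_of_order h2 a k.
Proof.
  intros E [Hk [phi [H1 [H2 H3]]]]. split; auto. exists phi. split; [auto|split; [auto|]].
  generalize H3. apply filter_imp. intros z Hz. now rewrite <- E.
Qed.

Theorem theorem3 (m n : nat) (hm : (2 <= m)%nat) (hn : (2 <= n)%nat)
  (f g : C -> option C) (hf : meromorphic f) (hg : meromorphic g)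
  (hfg : fermat_identity m n f g) :
  (constant f /\ constant g) <->
  same_zeros_counting_multiplicity (mderive f) (mderive g).
Proof.
  assert (hgf := fermat_identity_sym m n f g hfg).
  split.
  - intros [Cf Cg].
    assert (E : forall z, mderive f z = mderive g z) by (intros z; now rewrite !mderive_constant).
    split; [intros a; now rewrite E|].
    intros a k. split; apply zero_of_order_ext; auto.
  - intros [_ Hord].
    destruct (classic (exists a, f a = Some (RtoC 0))) as [[a Ha]|Nf].
    { apply (zero_implies_constant m n f g a); auto. intros b k. apply Hord. }
    destruct (classic (exists a, g a = Some (RtoC 0))) as [[a Ha]|Ng].
    { apply and_comm. apply (zero_implies_constant n m g f a); auto. intros b k. apply Hord. }
    assert (Nf' : forall z, f z <> Some (RtoC 0)) by (intros z Hz; apply Nf; now exists z).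
    assert (Ng' : forall z, g z <> Some (RtoC 0)) by (intros z Hz; apply Ng; now exists z).
    split.
    + apply (zero_free_constant m n f g); auto. lia.
    + apply (zero_free_constant n m g f); auto. lia.
Qed.
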